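(* Let $u$ be the smooth solution of $u_t=-u_{xxxx}$ on $[a,b]$, $t>0$, with $u(x,0)=u_0(x)$ and periodic boundary conditions. Let $(u_h,q_h)(\cdot,t)\in V_h^k\times V_h^k$ be the solution of the semi-discrete DG scheme $$(u_{ht},\phi)=-A(q_h,\phi),\qquad (q_h,\psi)=A(u_h,\psi)\qquad\text{for all }\phi,\psi\in V_h^k,$$ where $u_h(\cdot,0)$ is the (piecewise) $L^2$ projection of $u_0$ onto $V_h^k$. Then $$\|u_h(\cdot,t)-u(\cdot,t)\|\le Ch^{k+1},\qquad 0\le t\le T,$$ where $C$ depends on $\sup_{t\in[0,T]}|u_t(\cdot,t)|_{k+1}$, $\sup_{t\in[0,T]}|u(\cdot,t)|_{k+3}$ and linearly on $T$, but is independent of $h$.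
   Context: Mesh: $[a,b]$ is partitioned into cells $I_j=[x_{j-1/2},x_{j+1/2}]$, $j=1,\dots,N$, with $x_{1/2}=a$, $x_{N+1/2}=b$, $h_j=x_{j+1/2}-x_{j-1/2}$, $h=\max_j h_j$. $V_h^k=\{v\in L^2([a,b]): v|_{I_j}\in P^k(I_j),\ j=1,\dots,N\}$, where $P^k(I_j)$ is the set of polynomials of degree at most $k$ on $I_j$. At $x_{j+1/2}$: $v^\pm$ are the right/left one-sided limits, $\{v\}=(v^-+v^+)/2$, $[v]=v^+-v^-$. Periodicity convention: at $x_{N+1/2}$ one takes $v^+_{N+1/2}:=v^+_{1/2}$. $(\cdot,\cdot)$ and $\|\cdot\|$ are the $L^2([a,b])$ inner product and norm; $|\cdot|_m$ is the $H^m([a,b])$ seminorm. The bilinear form is $$A(w,v)=\sum_{j=1}^N\int_{I_j}w_xv_x\,dx+\sum_{j=1}^N\big(\{w_x\}[v]+[w]\{v_x\}\big)_{j+1/2}.$$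
   Formalization: The formal theorem assumes k ≥ 1, and a uniform mesh when k = 1; meshes are arbitrary for k ≥ 2. For k = 0 the form A vanishes, so u_h stays constant in time; for k = 1 on nonuniform meshes w = (-1)^j on I_j has A(w,v) = 0, so (u_h,w) is conserved and convergence can fail. *)

(* Defs.v *)
From Stdlib Require Import Reals List.
From Coquelicot Require Import Coquelicot.
Open Scope R_scope.

(** ** Meshes *)

(* [node M j] is x_{j+1/2}, so the cell I_j, 1 <= j <= N, is
   [node M (j-1), node M j]. *)
Record mesh (a b : R) : Type := Mesh {
  ncells : nat;
  node : nat -> R;
  ncells_pos : (1 <= ncells)%nat;
  node_first : node 0%nat = a;
  node_last : node ncells = b;
  node_incr : forall j, (1 <= j <= ncells)%nat -> node (j - 1)%nat < node j
}.
Arguments ncells {a b} _.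
Arguments node {a b} _ _.

Definition hcell {a b : R} (M : mesh a b) (j : nat) : R :=
  node M j - node M (j - 1)%nat.

Definition hmax {a b : R} (M : mesh a b) : R :=
  fold_right Rmax 0 (map (hcell M) (seq 1 (ncells M))).

Definition uniform_mesh {a b : R} (M : mesh a b) : Prop :=
  forall j, (1 <= j <= ncells M)%nat -> hcell M j = (b - a) / INR (ncells M).

Definition in_cell {a b : R} (M : mesh a b) (j : nat) (y : R) : Prop :=
  (1 <= j <= ncells M)%nat /\ node M (j - 1)%nat < y < node M j.

(** ** The discontinuous finite element space *)

Definition is_poly (k : nat) (p : R -> R) : Prop :=
  exists c : nat -> R, forall y, p y = sum_f_R0 (fun i => c i * y ^ i) k.

(* Elements of V_h^k are functions on the line of which only the values in the
   open cells matter; their values at the nodes are arbitrary. *)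
Definition in_Vh {a b : R} (M : mesh a b) (k : nat) (v : R -> R) : Prop :=
  forall j, (1 <= j <= ncells M)%nat ->
    exists p, is_poly k p /\ forall y, in_cell M j y -> v y = p y.

(** ** L2 inner product, norm and H^m seminorm on [a,b] *)

Definition inner (a b : R) (f g : R -> R) : R := RInt (fun y => f y * g y) a b.

Definition L2norm (a b : R) (f : R -> R) : R := sqrt (inner a b f f).

Definition Hseminorm (a b : R) (m : nat) (f : R -> R) : R :=
  L2norm a b (Derive_n f m).

(** ** Interface values and the bilinear form *)

Definition lim_left (v : R -> R) (y : R) : R := lim (filtermap v (at_left y)).
Definition lim_right (v : R -> R) (y : R) : R := lim (filtermap v (at_right y)).

Definition trace_minus {a b : R} (M : mesh a b) (v : R -> R) (j : nat) : R :=
  lim_left v (node M j).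

(* v^+_{N+1/2} := v^+_{1/2} *)
Definition trace_plus {a b : R} (M : mesh a b) (v : R -> R) (j : nat) : R :=
  lim_right v (if Nat.eqb j (ncells M) then node M 0%nat else node M j).

Definition avg {a b : R} (M : mesh a b) (v : R -> R) (j : nat) : R :=
  (trace_minus M v j + trace_plus M v j) / 2.

Definition jump {a b : R} (M : mesh a b) (v : R -> R) (j : nat) : R :=
  trace_plus M v j - trace_minus M v j.

Definition A_form {a b : R} (M : mesh a b) (w v : R -> R) : R :=
  sum_n_m (fun j => RInt (fun y => Derive w y * Derive v y)
                         (node M (j - 1)%nat) (node M j)) 1 (ncells M)
  + sum_n_m (fun j => avg M (Derive w) j * jump M v j
                      + jump M w j * avg M (Derive v) j) 1 (ncells M).

(** ** The exact solution

    Functions of time and space take the time variable first. *)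

(* Smoothness on [0,+oo) x R, up to and including t = 0: [U i m] is the
   derivative of order i in time and m in space. *)
Definition smooth_up_to_0 (u : R -> R -> R) : Prop :=
  exists U : nat -> nat -> R -> R -> R,
    (forall t x, 0 <= t -> U 0%nat 0%nat t x = u t x) /\
    (forall i m t x, 0 <= t -> is_derive (U i m t) x (U i (S m) t x)) /\
    (forall i m t x, 0 < t ->
       is_derive (fun s => U i m s x) t (U (S i) m t x)) /\
    (forall i m t x, 0 <= t ->
       filterlim (fun p : R * R => U i m (fst p) (snd p))
                 (within (fun p : R * R => 0 <= fst p) (locally (t, x)))
                 (locally (U i m t x))).

(* Periodic boundary conditions, on the (b-a)-periodic extension of u. *)
Definition periodic_in_space (a b : R) (u : R -> R -> R) : Prop :=
  forall t x, 0 <= t -> u t (x + (b - a)) = u t x.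

Definition biharmonic_solution (a b : R) (u0 : R -> R) (u : R -> R -> R) : Prop :=
  smooth_up_to_0 u /\
  periodic_in_space a b u /\
  (forall x, u 0 x = u0 x) /\
  (forall t x, 0 < t -> is_derive (fun s => u s x) t (- Derive_n (u t) 4 x)).

(* u_t as a right derivative, so that it is also meaningful at t = 0. *)
Definition dt (u : R -> R -> R) (t x : R) : R :=
  lim (filtermap (fun s => (u s x - u t x) / (s - t)) (at_right t)).

(* For a family bounded on [0,T]; [real] would send an infinite supremum to 0. *)
Definition sup_time (T : R) (F : R -> R) : R :=
  real (Lub_Rbar (fun s => exists t, 0 <= t <= T /\ s = F t)).

(** ** The semi-discrete scheme *)

Definition is_L2_projection {a b : R} (M : mesh a b) (k : nat)
    (f v : R -> R) : Prop :=
  in_Vh M k v /\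
  forall phi, in_Vh M k phi -> inner a b v phi = inner a b f phi.

(* V_h^k being finite dimensional, continuity and differentiability in time of
   u_h are the same as those of its point values inside the cells. *)
Definition DG_solution {a b : R} (M : mesh a b) (k : nat) (u0 : R -> R)
    (uh qh : R -> R -> R) : Prop :=
  is_L2_projection M k u0 (uh 0) /\
  (forall t, 0 < t -> in_Vh M k (uh t) /\ in_Vh M k (qh t)) /\
  (forall j y, in_cell M j y ->
     filterlim (fun s => uh s y) (at_right 0) (locally (uh 0 y))) /\
  (forall j y t, in_cell M j y -> 0 < t -> ex_derive (fun s => uh s y) t) /\
  (forall t phi, 0 < t -> in_Vh M k phi ->
     inner a b (fun y => Derive (fun s => uh s y) t) phi
     = - A_form M (qh t) phi) /\
  (forall t psi, 0 < t -> in_Vh M k psi ->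
     inner a b (qh t) psi = A_form M (uh t) psi).

(* Main.v *)
Require Import Defs.
From Stdlib Require Import Reals List Lra Lia Classical IndefiniteDescription.
From Coquelicot Require Import Coquelicot.
Open Scope R_scope.

(** Integrating by parts cellwise, A(w,v) = -sum int w v_xx - sum {w}[v_x] + sum {w_x}[v], so A does not
    see the error of a projection P which preserves the moments up to degree k-2 and the interface averages
    of value and slope. For k >= 2 such a P is obtained from the local interpolation Pi (same moments, exact
    end values) by adding a correction e with opposite values on the two sides of each interface and slope
    averages matching those of u - Pi u. Evaluating A(e,e) in two ways gives
    sum int e_x^2 = - sum {e_x}[e]. This proves that e exists and is unique and that it is of order h^(k+1),
    on any mesh.
    For k = 1 the slope averages of piecewise linear functions need not determine them (already for an even
    number of equal cells), and P is replaced by a cell-local choice whose averages are exact for cubics on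
    uniform meshes, so that A(Pu - u, v) = O(h^2) |u|_4 |v|.
    With e_u = Pu - u_h, e_q = Pq - q_h and q = -u_xx, testing the two error equations with e_u and e_q
    and adding them cancels A(e_q, e_u). What remains is controlled by |u_t|_{k+1} = |q|_{k+3} and
    |u|_{k+3} = |q|_{k+1}; comparing sqrt(|e_u|^2 + c^2 h^(2k+2)) with its initial value yields linear
    growth in time. *)

(** * Finite sums *)

(** Stability must come from the cancellation of the mixed term, and solvability of the interface
    system from an identity valid only on the space of corrections. Regularity in time shapes the
    rest. Only point values of u_h are known to be differentiable, and only for t > 0. The squared
    error is therefore written as a finite quadratic form in nodal values, and P must be assembled
    from functionals (point values, moments) that commute with the time derivative, so that P(u_t)
    is the derivative of Pu. Piecewise smooth functions are carried as one family of derivatives per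
    cell, each defined on the whole line. One-sided traces become evaluations and integrability is
    automatic; limits and arbitrary node values occur only where the given form is compared with its
    broken version. Approximating u itself costs |u|_{k+1}, while the constants may depend only on
    |u|_{k+3}; two periodic Poincare inequalities close this gap. *)

(* [ssum n f] is f 1 + ... + f n. *)
Fixpoint ssum (n : nat) (f : nat -> R) : R :=
  match n with 0%nat => 0 | S m => ssum m f + f (S m) end.

Lemma sum_n_m_ssum (f : nat -> R) n : sum_n_m f 1 n = ssum n f.
Proof.
  induction n as [|n IH].
  - rewrite sum_n_m_zero by lia; reflexivity.
  - rewrite sum_n_Sm by lia. rewrite IH. reflexivity.
Qed.

Lemma sum_f_R0_ssum (f : nat -> R) n :
  sum_f_R0 f n = ssum (S n) (fun i => f (i - 1)%nat).
Proof.
  induction n as [|n IH].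
  - simpl; ring.
  - simpl sum_f_R0. rewrite IH. simpl ssum. rewrite ?Nat.sub_0_r. reflexivity.
Qed.

Lemma ssum_ext n f g :
  (forall i, (1 <= i <= n)%nat -> f i = g i) -> ssum n f = ssum n g.
Proof.
  induction n as [|n IH]; intros H; simpl; [reflexivity|].
  rewrite IH by (intros; apply H; lia). rewrite (H (S n)) by lia. reflexivity.
Qed.

Lemma ssum_plus n f g : ssum n (fun i => f i + g i) = ssum n f + ssum n g.
Proof. induction n as [|n IH]; simpl; [ring|rewrite IH; ring]. Qed.

Lemma ssum_minus n f g : ssum n (fun i => f i - g i) = ssum n f - ssum n g.
Proof. induction n as [|n IH]; simpl; [ring|rewrite IH; ring]. Qed.

Lemma ssum_opp n f : ssum n (fun i => - f i) = - ssum n f.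
Proof. induction n as [|n IH]; simpl; [ring|rewrite IH; ring]. Qed.

Lemma ssum_scal n c f : ssum n (fun i => c * f i) = c * ssum n f.
Proof. induction n as [|n IH]; simpl; [ring|rewrite IH; ring]. Qed.

Lemma ssum_const n c : ssum n (fun _ => c) = INR n * c.
Proof.
  induction n as [|n IH]; [simpl; ring|].
  simpl ssum. rewrite IH, S_INR. ring.
Qed.

Lemma ssum_eq0 n f : (forall i, (1 <= i <= n)%nat -> f i = 0) -> ssum n f = 0.
Proof. intros H. rewrite (ssum_ext n f (fun _ => 0)) by exact H. rewrite ssum_const; ring. Qed.

Lemma ssum_le n f g :
  (forall i, (1 <= i <= n)%nat -> f i <= g i) -> ssum n f <= ssum n g.
Proof.
  induction n as [|n IH]; intros H; simpl; [lra|].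
  apply Rplus_le_compat; [apply IH; intros|]; apply H; lia.
Qed.

Lemma ssum_ge0 n f : (forall i, (1 <= i <= n)%nat -> 0 <= f i) -> 0 <= ssum n f.
Proof. intros H. rewrite <- (ssum_eq0 n (fun _ => 0)) by easy. now apply ssum_le. Qed.

Lemma ssum_abs n f : Rabs (ssum n f) <= ssum n (fun i => Rabs (f i)).
Proof.
  induction n as [|n IH]; simpl; [rewrite Rabs_R0; lra|].
  eapply Rle_trans; [apply Rabs_triang|lra].
Qed.

Lemma ssum_exchange n m (f : nat -> nat -> R) :
  ssum n (fun i => ssum m (f i)) = ssum m (fun j => ssum n (fun i => f i j)).
Proof.
  induction n as [|n IH]; simpl.
  - symmetry; apply ssum_eq0; easy.
  - rewrite IH, ssum_plus. reflexivity.
Qed.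

Lemma ssum_delta n f p : (1 <= p <= n)%nat ->
  ssum n (fun i => if Nat.eqb i p then f i else 0) = f p.
Proof.
  induction n as [|n IH]; intros Hp; [lia|]. cbn [ssum].
  destruct (Nat.eq_dec p (S n)) as [->|Hn].
  - rewrite (ssum_eq0 n).
    + rewrite Nat.eqb_refl; ring.
    + intros i Hi. destruct (Nat.eqb_spec i (S n)); [lia|reflexivity].
  - rewrite IH by lia. destruct (Nat.eqb_spec (S n) p) as [e|]; [congruence|]. ring.
Qed.

Lemma ssum_term_le n f p : (1 <= p <= n)%nat ->
  (forall i, (1 <= i <= n)%nat -> 0 <= f i) -> f p <= ssum n f.
Proof.
  intros Hp H. rewrite <- (ssum_delta n f p Hp). apply ssum_le; intros i Hi.
  destruct (Nat.eqb i p); [lra|now apply H].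
Qed.

Lemma ssum_zero_term n f : (forall i, (1 <= i <= n)%nat -> 0 <= f i) ->
  ssum n f = 0 -> forall i, (1 <= i <= n)%nat -> f i = 0.
Proof.
  intros H H0 i Hi. apply Rle_antisym; [|now apply H].
  rewrite <- H0. now apply ssum_term_le.
Qed.

Lemma ssum_first n f : ssum (S n) f = f 1%nat + ssum n (fun i => f (S i)).
Proof. induction n as [|n IH]; [simpl; ring|]. change (ssum (S (S n)) f) with (ssum (S n) f + f (S (S n))). rewrite IH. simpl. ring. Qed.

Definition skip (p i : nat) : nat := if Nat.ltb i p then i else S i.

Lemma ssum_skip n f p : (1 <= p <= S n)%nat ->
  ssum (S n) f = f p + ssum n (fun i => f (skip p i)).
Proof.
  revert p; induction n as [|n IH]; intros p Hp.
  - assert (p = 1%nat) as -> by lia. simpl; ring.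
  - change (ssum (S (S n)) f) with (ssum (S n) f + f (S (S n))).
    destruct (Nat.eq_dec p (S (S n))) as [->|Hn].
    + rewrite (ssum_ext (S n) (fun i => f (skip (S (S n)) i)) f); [ring|].
      intros i Hi. unfold skip. destruct (Nat.ltb_spec i (S (S n))); [reflexivity|lia].
    + assert (E : skip p (S n) = S (S n))
        by (unfold skip; destruct (Nat.ltb_spec (S n) p); [lia|reflexivity]).
      rewrite (IH p) by lia. simpl ssum. rewrite E. ring.
Qed.

(** * Injective square systems *)

(** Gaussian elimination. If the last equation has a nonzero coefficient in column [p], it
    determines unknown [p], and the induction hypothesis is applied to the Schur complement.
    Otherwise the last equation is void and the last unknown is set to 0. *)
Lemma homogeneous_solution n : forall A : nat -> nat -> R,
  exists x, (exists j, (1 <= j <= S n)%nat /\ x j <> 0) /\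
    forall i, (1 <= i <= n)%nat -> ssum (S n) (fun j => A i j * x j) = 0.
Proof.
  induction n as [|n IH]; intros A.
  - exists (fun _ => 1). split; [exists 1%nat; split; [lia|lra]|]. intros; lia.
  - destruct (classic
      (exists p, (1 <= p <= S (S n))%nat /\ A (S n) p <> 0)) as [[p [Hp Ap]]|HN].
    + destruct (IH (fun i j =>
          A i (skip p j) - A (S n) (skip p j) / A (S n) p * A i p)) as [x [[j0 [Hj0 xj0]] Hx]].
      set (c := - ssum (S n) (fun j => A (S n) (skip p j) / A (S n) p * x j)).
      set (z := fun i => if Nat.eqb i p then c else
                  if Nat.ltb i p then x i else x (i - 1)%nat).
      assert (Hz : forall j, z (skip p j) = x j).
      { intros j. unfold z, skip. destruct (Nat.ltb_spec j p).
        - destruct (Nat.eqb_spec j p); [lia|]. destruct (Nat.ltb_spec j p); [reflexivity|lia].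
        - destruct (Nat.eqb_spec (S j) p); [lia|]. destruct (Nat.ltb_spec (S j) p); [lia|].
          f_equal; lia. }
      assert (Hzp : z p = c) by (unfold z; now rewrite Nat.eqb_refl).
      exists z. split.
      * exists (skip p j0). rewrite Hz. split; [|exact xj0].
        unfold skip. destruct (Nat.ltb j0 p); lia.
      * intros i Hi. rewrite (ssum_skip _ _ p Hp), Hzp.
        rewrite (ssum_ext (S n) _ (fun j => A i (skip p j) * x j)) by (intros; now rewrite Hz).
        assert (E : forall i, A i p * c + ssum (S n) (fun j => A i (skip p j) * x j)
           = ssum (S n) (fun j =>
              (A i (skip p j) - A (S n) (skip p j) / A (S n) p * A i p) * x j)).
        { intros i'. unfold c. rewrite <- ssum_opp, <- ssum_scal, <- ssum_plus.
          apply ssum_ext; intros; ring. }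
        rewrite E. destruct (Nat.eq_dec i (S n)) as [->|Hn].
        -- apply ssum_eq0; intros; field; exact Ap.
        -- apply Hx; lia.
    + destruct (IH A) as [x [[j0 [Hj0 xj0]] Hx]].
      exists (fun j => if Nat.eqb j (S (S n)) then 0 else x j). split.
      * exists j0. split; [lia|]. destruct (Nat.eqb_spec j0 (S (S n))); [lia|exact xj0].
      * intros i Hi. destruct (Nat.eq_dec i (S n)) as [->|Hn].
        -- apply ssum_eq0; intros j Hj. destruct (Req_dec (A (S n) j) 0) as [->|Hne]; [ring|].
           exfalso; apply HN; now exists j.
        -- change (ssum (S (S n)) ?f) with (ssum (S n) f + f (S (S n))).
           cbv beta. rewrite Nat.eqb_refl.
           rewrite (ssum_ext (S n) _ (fun j => A i j * x j)).
           ++ rewrite Hx by lia; ring.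
           ++ intros j Hj. destruct (Nat.eqb_spec j (S (S n))); [lia|reflexivity].
Qed.

(** Append [- y] as an extra column: a nontrivial kernel vector of the enlarged system has nonzero
    last entry by injectivity, and dividing by that entry solves the system. *)
Lemma injective_surjective n (A : nat -> nat -> R) :
  (forall x, (forall i, (1 <= i <= n)%nat -> ssum n (fun j => A i j * x j) = 0) ->
     forall j, (1 <= j <= n)%nat -> x j = 0) ->
  forall y, exists x, forall i, (1 <= i <= n)%nat -> ssum n (fun j => A i j * x j) = y i.
Proof.
  intros Hinj y.
  destruct (homogeneous_solution n (fun i j => if Nat.eqb j (S n) then - y i else A i j))
    as [x [[j0 [Hj0 xj0]] Hx]].
  assert (E : forall i, (1 <= i <= n)%nat -> ssum n (fun j => A i j * x j) = y i * x (S n)).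
  { intros i Hi. specialize (Hx i Hi). cbn [ssum] in Hx. rewrite Nat.eqb_refl in Hx.
    rewrite (ssum_ext n _ (fun j => A i j * x j)) in Hx; [lra|].
    intros j Hj. destruct (Nat.eqb_spec j (S n)); [lia|reflexivity]. }
  assert (Hs : x (S n) <> 0).
  { intros H0. destruct (Nat.eq_dec j0 (S n)) as [->|Hn]; [tauto|].
    apply xj0. apply Hinj; [|lia]. intros i Hi. rewrite E, H0 by exact Hi; ring. }
  exists (fun j => x j / x (S n)). intros i Hi.
  rewrite (ssum_ext n _ (fun j => / x (S n) * (A i j * x j))) by (intros; field; exact Hs).
  rewrite ssum_scal, E by exact Hi. field; exact Hs.
Qed.

(** With an inverse matrix instead of bare solvability, solutions depend on the data through fixed
    coefficients. This is what later lets the projection commute with the time derivative. *)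
Lemma injective_inverse n (A : nat -> nat -> R) :
  (forall x, (forall i, (1 <= i <= n)%nat -> ssum n (fun j => A i j * x j) = 0) ->
     forall j, (1 <= j <= n)%nat -> x j = 0) ->
  exists B : nat -> nat -> R, forall i m, (1 <= i <= n)%nat ->
    ssum n (fun j => A i j * B j m) = if Nat.eqb i m then 1 else 0.
Proof.
  intros Hinj.
  destruct (functional_choice (fun m x => forall i, (1 <= i <= n)%nat ->
     ssum n (fun j => A i j * x j) = if Nat.eqb i m then 1 else 0)) as [B HB].
  - intros m. apply (injective_surjective n A Hinj (fun i => if Nat.eqb i m then 1 else 0)).
  - exists (fun j m => B m j). intros i m Hi. now apply HB.
Qed.

(** * The Cauchy-Schwarz inequality *)

Lemma discriminant_nonpos a b c :
  0 <= a -> 0 <= c -> (forall s, 0 <= a + 2 * s * b + s * s * c) -> b * b <= a * c.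
Proof.
  intros Ha Hc H. destruct (Req_dec c 0) as [->|Hc0].
  - destruct (Req_dec b 0) as [->|Hb]; [lra|].
    (* For c = 0 the expression is affine in s, and at this s it equals -1. *)
    specialize (H (- (a + 1) / (2 * b))).
    replace (a + 2 * (- (a + 1) / (2 * b)) * b + - (a + 1) / (2 * b) * (- (a + 1) / (2 * b)) * 0)
      with (-1) in H by (field; exact Hb). lra.
  - specialize (H (- b / c)).
    replace (a + 2 * (- b / c) * b + - b / c * (- b / c) * c) with ((a * c - b * b) / c) in H
      by (field; exact Hc0).
    apply (Rmult_le_compat_r c) in H; [|lra].
    unfold Rdiv in H. rewrite Rmult_assoc, Rinv_l in H by exact Hc0. lra.
Qed.

Lemma abs_le_sqrt_mult a b c : 0 <= a -> 0 <= c -> b * b <= a * c ->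
  Rabs b <= sqrt a * sqrt c.
Proof.
  intros Ha Hc H. rewrite <- sqrt_mult by assumption.
  rewrite <- sqrt_Rsqr_abs. apply sqrt_le_1_alt. exact H.
Qed.

Lemma ssum_CS n f g :
  Rabs (ssum n (fun i => f i * g i))
  <= sqrt (ssum n (fun i => f i * f i)) * sqrt (ssum n (fun i => g i * g i)).
Proof.
  assert (P : forall h, 0 <= ssum n (fun i => h i * h i))
    by (intros; apply ssum_ge0; intros; nra).
  apply abs_le_sqrt_mult; try apply P. apply discriminant_nonpos; try apply P.
  intros s. generalize (P (fun i => f i + s * g i)).
  rewrite (ssum_ext n (fun i => (f i + s * g i) * (f i + s * g i))
     (fun i => f i * f i + (2 * s * (f i * g i) + s * s * (g i * g i)))) by (intros; ring).
  rewrite !ssum_plus, !ssum_scal. lra.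
Qed.

(** * Integrals of continuous functions *)

(** Continuity is required on the whole line, so that integrability between any two points holds at
    once; the cellwise functions are all extended accordingly. *)
Definition cont (f : R -> R) : Prop := forall x, continuous f x.

Lemma cont_ex_RInt f c d : cont f -> ex_RInt f c d.
Proof. intros H. apply (ex_RInt_continuous (V:=R_CompleteNormedModule)). intros; apply H. Qed.

Lemma cont_plus f g : cont f -> cont g -> cont (fun x => f x + g x).
Proof. intros Hf Hg x. apply (continuous_plus (V:=R_NormedModule)); [apply Hf|apply Hg]. Qed.

Lemma cont_minus f g : cont f -> cont g -> cont (fun x => f x - g x).
Proof. intros Hf Hg x. apply (continuous_minus (V:=R_NormedModule)); [apply Hf|apply Hg]. Qed.

Lemma cont_opp f : cont f -> cont (fun x => - f x).
Proof. intros Hf x. apply (continuous_opp (V:=R_NormedModule)); apply Hf. Qed.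

Lemma cont_mult f g : cont f -> cont g -> cont (fun x => f x * g x).
Proof. intros Hf Hg x. apply (continuous_mult (K:=R_AbsRing)); [apply Hf|apply Hg]. Qed.

Lemma cont_const c : cont (fun _ => c).
Proof. intros x. apply continuous_const. Qed.

Lemma cont_id : cont (fun x => x).
Proof. intros x. apply continuous_id. Qed.

Lemma cont_comp f g : cont f -> cont g -> cont (fun x => f (g x)).
Proof. intros Hf Hg x. apply continuous_comp; [apply Hg|apply Hf]. Qed.

Lemma cont_derive (f g : R -> R) : (forall x, is_derive f x (g x)) -> cont f.
Proof. intros H x. apply (ex_derive_continuous (V:=R_NormedModule)). now exists (g x). Qed.

Lemma cont_ssum n (f : nat -> R -> R) :
  (forall i, cont (f i)) -> cont (fun x => ssum n (fun i => f i x)).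
Proof.
  intros H. induction n as [|n IH]; simpl; [apply cont_const|].
  now apply cont_plus.
Qed.

#[export] Hint Resolve cont_plus cont_minus cont_opp cont_mult cont_const cont_id cont_ssum : cont.

(* Equations between integrals elaborate at the type of a normed module, which [ring] rejects. *)
Ltac as_real := match goal with |- @eq _ ?x ?y => change (@eq R x y) end.

Lemma RInt_extR c d (f g : R -> R) : (forall x, f x = g x) -> RInt f c d = RInt g c d.
Proof. intros H. apply RInt_ext. intros; apply H. Qed.

Lemma RInt_ext_in c d (f g : R -> R) : c <= d -> (forall x, c < x < d -> f x = g x) ->
  RInt f c d = RInt g c d.
Proof.
  intros Hcd H. apply RInt_ext. rewrite Rmin_left, Rmax_right by exact Hcd. exact H.
Qed.

Lemma RInt_plusR c d f g : cont f -> cont g ->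
  RInt (fun x => f x + g x) c d = RInt f c d + RInt g c d.
Proof. intros Hf Hg. apply (RInt_plus (V:=R_CompleteNormedModule)); now apply cont_ex_RInt. Qed.

Lemma RInt_minusR c d f g : cont f -> cont g ->
  RInt (fun x => f x - g x) c d = RInt f c d - RInt g c d.
Proof. intros Hf Hg. apply (RInt_minus (V:=R_CompleteNormedModule)); now apply cont_ex_RInt. Qed.

Lemma RInt_scalR c d f l : cont f -> RInt (fun x => l * f x) c d = l * RInt f c d.
Proof. intros Hf. apply (RInt_scal (V:=R_CompleteNormedModule)); now apply cont_ex_RInt. Qed.

Lemma RInt_constR c d l : RInt (fun _ => l) c d = (d - c) * l.
Proof. rewrite RInt_const. reflexivity. Qed.

Lemma RInt_ssum c d n (f : nat -> R -> R) : (forall i, cont (f i)) ->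
  RInt (fun x => ssum n (fun i => f i x)) c d = ssum n (fun i => RInt (f i) c d).
Proof.
  intros H. induction n as [|n IH]; simpl.
  - rewrite RInt_constR; ring.
  - rewrite RInt_plusR by auto with cont. now rewrite IH.
Qed.

Lemma RInt_deriv c d (f g : R -> R) : (forall x, is_derive f x (g x)) -> cont g ->
  RInt g c d = f d - f c.
Proof.
  intros Hf Hg. apply is_RInt_unique.
  apply (is_RInt_derive (V:=R_CompleteNormedModule)); intros; auto.
Qed.

Lemma RInt_ibp c d (f f' g g' : R -> R) :
  (forall x, is_derive f x (f' x)) -> (forall x, is_derive g x (g' x)) ->
  cont f' -> cont g' ->
  RInt (fun x => f' x * g x) c d
  = f d * g d - f c * g c - RInt (fun x => f x * g' x) c d.
Proof.
  intros Hf Hg Cf Cg.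
  assert (Kf := cont_derive _ _ Hf). assert (Kg := cont_derive _ _ Hg).
  assert (E : RInt (fun x => f' x * g x + f x * g' x) c d = f d * g d - f c * g c).
  { apply (RInt_deriv c d (fun x => f x * g x)); [|auto with cont].
    intros x. apply (is_derive_mult (K:=R_AbsRing) f g); auto. intros; apply Rmult_comm. }
  rewrite RInt_plusR in E by auto with cont. lra.
Qed.

Lemma RInt_leR c d f g : c <= d -> cont f -> cont g -> (forall x, c <= x <= d -> f x <= g x) ->
  RInt f c d <= RInt g c d.
Proof. intros Hcd Hf Hg H. apply RInt_le; try (now apply cont_ex_RInt); [exact Hcd|]. intros; apply H; lra. Qed.

Lemma RInt_ge0 c d f : c <= d -> cont f -> (forall x, c <= x <= d -> 0 <= f x) -> 0 <= RInt f c d.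
Proof.
  intros Hcd Hf H. rewrite <- (Rmult_0_r (d - c)), <- RInt_constR.
  apply RInt_leR; auto with cont.
Qed.

Lemma RInt_sq_ge0 c d f : c <= d -> cont f -> 0 <= RInt (fun x => f x * f x) c d.
Proof. intros Hcd Hf. apply RInt_ge0; [exact Hcd|auto with cont|]. intros; nra. Qed.

Lemma RInt_CS c d f g : c <= d -> cont f -> cont g ->
  Rabs (RInt (fun x => f x * g x) c d) <= L2norm c d f * L2norm c d g.
Proof.
  intros Hcd Hf Hg. apply abs_le_sqrt_mult; try (now apply RInt_sq_ge0).
  apply discriminant_nonpos; try (now apply RInt_sq_ge0). unfold inner.
  intros s. generalize (RInt_sq_ge0 c d (fun x => f x + s * g x) Hcd ltac:(auto with cont)).
  rewrite (RInt_extR c d _ (fun x => f x * f x + (2 * s * (f x * g x) + s * s * (g x * g x))))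
    by (intros; ring).
  rewrite !RInt_plusR, !RInt_scalR by auto 6 with cont. lra.
Qed.

Lemma L2norm_sq c d f : c <= d -> cont f -> L2norm c d f * L2norm c d f = RInt (fun x => f x * f x) c d.
Proof. intros Hcd Hf. apply sqrt_sqrt. now apply RInt_sq_ge0. Qed.

Lemma RInt_sq_sub c d f p q : cont f -> c <= p -> p <= q -> q <= d ->
  RInt (fun x => f x * f x) p q <= RInt (fun x => f x * f x) c d.
Proof.
  intros Hf H1 H2 H3.
  assert (C : cont (fun x => f x * f x)) by auto with cont.
  rewrite <- (RInt_Chasles (V:=R_CompleteNormedModule) (fun x => f x * f x) c p d)
    by now apply cont_ex_RInt.
  rewrite <- (RInt_Chasles (V:=R_CompleteNormedModule) (fun x => f x * f x) p q d)
    by now apply cont_ex_RInt.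
  generalize (RInt_sq_ge0 c p f H1 Hf) (RInt_sq_ge0 q d f H3 Hf).
  unfold plus; simpl. lra.
Qed.

(** * Polynomials *)

Lemma is_poly_ext k p q : (forall x, p x = q x) -> is_poly k p -> is_poly k q.
Proof. intros E [c Hc]. exists c. intros y. now rewrite <- E. Qed.

Lemma is_poly_0_const p : is_poly 0 p -> forall x, p x = p 0.
Proof. intros [c Hc] x. rewrite !Hc. simpl. ring. Qed.

Lemma is_poly_const k a : is_poly k (fun _ => a).
Proof.
  exists (fun i => match i with 0%nat => a | _ => 0 end). intros y.
  induction k as [|k IH]; [simpl; ring|]. rewrite tech5, <- IH. ring.
Qed.

Lemma is_poly_weaken k l p : (k <= l)%nat -> is_poly k p -> is_poly l p.
Proof.
  intros Hkl [c Hc]. exists (fun i => if Nat.leb i k then c i else 0). intros y.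
  rewrite Hc. induction Hkl as [|l Hkl IH].
  - apply sum_eq. intros i Hi. destruct (Nat.leb_spec i k); [reflexivity|lia].
  - rewrite tech5, <- IH. destruct (Nat.leb_spec (S l) k); [lia|]. ring.
Qed.

Lemma is_poly_plus k p q : is_poly k p -> is_poly k q -> is_poly k (fun x => p x + q x).
Proof.
  intros [c Hc] [e He]. exists (fun i => c i + e i). intros y.
  rewrite Hc, He, <- sum_plus. apply sum_eq; intros; ring.
Qed.

Lemma is_poly_scal k a p : is_poly k p -> is_poly k (fun x => a * p x).
Proof.
  intros [c Hc]. exists (fun i => a * c i). intros y.
  rewrite Hc, scal_sum. apply sum_eq; intros; ring.
Qed.

Lemma is_poly_minus k p q : is_poly k p -> is_poly k q -> is_poly k (fun x => p x - q x).
Proof.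
  intros Hp Hq. apply (is_poly_ext k (fun x => p x + -1 * q x)); [intros; ring|].
  apply is_poly_plus; [exact Hp|]. now apply is_poly_scal.
Qed.

Lemma is_poly_ssum k n (p : nat -> R -> R) :
  (forall i, (1 <= i <= n)%nat -> is_poly k (p i)) -> is_poly k (fun x => ssum n (fun i => p i x)).
Proof.
  induction n as [|n IH]; intros H; cbn [ssum]; [apply is_poly_const|].
  apply (is_poly_plus k (fun x => ssum n (fun i => p i x)) (p (S n))).
  - apply IH; intros; apply H; lia.
  - apply H; lia.
Qed.

(** Horner form: inductions on the degree go through this equivalence instead of the
    coefficients. *)
Lemma is_poly_S k p :
  is_poly (S k) p <-> exists a q, is_poly k q /\ forall x, p x = a + x * q x.
Proof.
  split.
  - intros [c Hc]. exists (c 0%nat), (fun x => sum_f_R0 (fun i => c (S i) * x ^ i) k).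
    split; [exists (fun i => c (S i)); reflexivity|]. intros x.
    rewrite Hc, decomp_sum by lia. simpl pred. rewrite scal_sum. simpl pow at 1.
    rewrite Rmult_1_r. f_equal. apply sum_eq; intros; simpl; ring.
  - intros [a [q [[c Hc] H]]].
    exists (fun i => match i with 0%nat => a | S j => c j end). intros x.
    rewrite H, Hc, (decomp_sum _ (S k)) by lia. simpl pred. rewrite scal_sum. simpl pow at 2.
    rewrite Rmult_1_r. f_equal. apply sum_eq; intros; simpl; ring.
Qed.

Lemma is_poly_mulX k p : is_poly k p -> is_poly (S k) (fun x => x * p x).
Proof. intros H. apply is_poly_S. exists 0, p. split; [exact H|]. intros; ring. Qed.

Lemma is_poly_pow k i : (i <= k)%nat -> is_poly k (fun x => x ^ i).
Proof.
  intros Hik. apply (is_poly_weaken i k _ Hik). clear k Hik. induction i as [|i IH].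
  - apply (is_poly_const 0 1).
  - apply (is_poly_mulX i _ IH).
Qed.

Lemma is_poly_mul_affine k s t p : is_poly k p -> is_poly (S k) (fun x => (s * x + t) * p x).
Proof.
  intros H. apply (is_poly_ext _ (fun x => s * (x * p x) + t * p x)); [intros; ring|].
  apply is_poly_plus; apply is_poly_scal; [now apply is_poly_mulX|].
  apply (is_poly_weaken k); [lia|exact H].
Qed.

Lemma is_poly_affine k s t p : is_poly k p -> is_poly k (fun x => p (s * x + t)).
Proof.
  revert p; induction k as [|k IH]; intros p Hp.
  - apply (is_poly_ext _ (fun _ => p 0)); [|apply is_poly_const].
    intros x. symmetry. now apply is_poly_0_const.
  - apply is_poly_S in Hp. destruct Hp as [a [q [Hq E]]].
    apply (is_poly_ext _ (fun x => a + (s * x + t) * q (s * x + t))); [intros; now rewrite E|].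
    apply is_poly_plus; [apply is_poly_const|].
    apply (is_poly_mul_affine k s t (fun x => q (s * x + t))), IH, Hq.
Qed.

Lemma is_poly_derivative k p : is_poly k p ->
  exists q, is_poly (k - 1) q /\ forall x, is_derive p x (q x).
Proof.
  revert p; induction k as [|k IH]; intros p Hp.
  - exists (fun _ => 0). split; [apply is_poly_const|]. intros x.
    apply (is_derive_ext (fun _ => p 0)); [intros t; symmetry; now apply is_poly_0_const|].
    apply (is_derive_const (K:=R_AbsRing) (V:=R_NormedModule)).
  - apply is_poly_S in Hp. destruct Hp as [a [q [Hq E]]].
    destruct (IH q Hq) as [q' [Hq' Dq]].
    exists (fun x => q x + x * q' x). split.
    + replace (S k - 1)%nat with k by lia. destruct k as [|k].
      * apply (is_poly_ext _ q); [|exact Hq]. intros x.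
        assert (q' x = 0); [|rewrite H; ring].
        rewrite <- (is_derive_unique q x (q' x) (Dq x)).
        rewrite (Derive_ext q (fun _ => q 0)); [apply Derive_const|].
        intros; now apply is_poly_0_const.
      * apply is_poly_plus; [exact Hq|]. replace (S k - 1)%nat with k in Hq' by lia.
        now apply is_poly_mulX.
    + intros x. apply (is_derive_ext (fun y => a + y * q y)); [intros; now rewrite E|].
      replace (q x + x * q' x) with (0 + (1 * q x + x * q' x)) by ring.
      apply (is_derive_plus (K:=R_AbsRing) (V:=R_NormedModule) (fun _ => a) (fun y => y * q y)).
      * apply (is_derive_const (K:=R_AbsRing) (V:=R_NormedModule)).
      * apply (is_derive_mult (K:=R_AbsRing) (fun y => y) q); auto.
        -- apply (is_derive_id (K:=R_AbsRing)).
        -- intros; apply Rmult_comm.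
Qed.

Lemma is_poly_Derive k p : is_poly k p ->
  is_poly (k - 1) (Derive p) /\ forall x, is_derive p x (Derive p x).
Proof.
  intros Hp. destruct (is_poly_derivative k p Hp) as [q [Hq Dq]].
  assert (E : forall x, q x = Derive p x) by (intros; symmetry; now apply is_derive_unique).
  split.
  - now apply (is_poly_ext _ q).
  - intros x. rewrite <- E. apply Dq.
Qed.

Lemma is_poly_antiderivative k p : is_poly k p ->
  exists q, is_poly (S k) q /\ forall x, is_derive q x (p x).
Proof.
  intros [c Hc].
  exists (fun x => sum_f_R0 (fun i => c i / INR (S i) * x ^ (S i)) k). split.
  - apply is_poly_S. exists 0, (fun x => sum_f_R0 (fun i => c i / INR (S i) * x ^ i) k).
    split; [exists (fun i => c i / INR (S i)); reflexivity|].
    intros x. rewrite Rplus_0_l, scal_sum. apply sum_eq; intros; simpl pow; ring.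
  - intros x. rewrite Hc. clear Hc. induction k as [|k IH].
    + simpl. auto_derive; [easy|field].
    + rewrite tech5. eapply (is_derive_ext (fun x => _ + _)); [intros; symmetry; apply tech5|].
      apply (is_derive_plus (K:=R_AbsRing) (V:=R_NormedModule)); [apply IH|].
      assert (HS := not_0_INR (S (S k)) ltac:(lia)).
      replace (c (S k) * x ^ S k) with (c (S k) / INR (S (S k)) * (INR (S (S k)) * (1 * x ^ S k)))
        by (field; exact HS).
      apply (is_derive_scal (fun x => x ^ S (S k))).
      replace (INR (S (S k)) * (1 * x ^ S k)) with (INR (S (S k)) * 1 * x ^ S k) by ring.
      apply (is_derive_pow (fun x => x) (S (S k)) x 1). apply (is_derive_id (K:=R_AbsRing)).
Qed.

Lemma is_poly_cont k p : is_poly k p -> cont p.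
Proof. intros Hp. apply (cont_derive p (Derive p)). now apply (is_poly_Derive k). Qed.

Lemma is_poly_divide k p r : is_poly (S k) p ->
  exists q, is_poly k q /\ forall x, p x = p r + (x - r) * q x.
Proof.
  revert p; induction k as [|k IH]; intros p Hp; apply is_poly_S in Hp;
    destruct Hp as [a [p1 [Hp1 E]]].
  - exists p1. split; [exact Hp1|]. intros x. rewrite !E.
    rewrite (is_poly_0_const p1 Hp1 x), (is_poly_0_const p1 Hp1 r). ring.
  - destruct (IH p1 Hp1) as [q [Hq Eq]].
    exists (fun x => p1 r + x * q x). split.
    + apply is_poly_S. now exists (p1 r), q.
    + intros x. rewrite !E, (Eq x). ring.
Qed.

(** Lagrange interpolation, one node at a time. Write p = p(r) + (x - r) q at the new node r and
    interpolate q at the old ones; since (y_i - r) q(y_i) = p(y_i) - p(r), the old basis functions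
    are rescaled by (x - r)/(y_i - r), and the new one is 1 minus their sum. *)
Lemma interpolation k (y : nat -> R) :
  (forall i j, (1 <= i <= S k)%nat -> (1 <= j <= S k)%nat -> i <> j -> y i <> y j) ->
  exists l : nat -> R -> R, (forall i, is_poly k (l i)) /\
    forall p, is_poly k p -> forall x, p x = ssum (S k) (fun i => p (y i) * l i x).
Proof.
  induction k as [|k IH]; intros Hy.
  - exists (fun _ _ => 1). split; [intros; apply is_poly_const|]. intros p Hp x. simpl.
    rewrite (is_poly_0_const p Hp x), (is_poly_0_const p Hp (y 1%nat)). ring.
  - destruct IH as [l [Hl Il]]; [intros; apply Hy; lia|].
    set (r := y (S (S k))).
    set (m := fun i x => / (y i - r) * ((1 * x + - r) * l i x)).
    assert (Hm : forall i, is_poly (S k) (m i)).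
    { intros i. apply is_poly_scal. now apply is_poly_mul_affine. }
    exists (fun i => if Nat.eqb i (S (S k)) then fun x => 1 - ssum (S k) (fun j => m j x) else m i).
    split.
    + intros i. destruct (Nat.eqb i (S (S k))); [|apply Hm].
      apply is_poly_minus; [apply is_poly_const|]. apply is_poly_ssum; auto.
    + intros p Hp x. destruct (is_poly_divide k p r Hp) as [q [Hq E]].
      change (ssum (S (S k)) ?f) with (ssum (S k) f + f (S (S k))).
      cbv beta. rewrite Nat.eqb_refl. fold r.
      rewrite (ssum_ext (S k) _ (fun i => p r * m i x + (x - r) * (q (y i) * l i x))).
      * rewrite ssum_plus, !ssum_scal, <- (Il q Hq). rewrite (E x). ring.
      * intros i Hi. destruct (Nat.eqb_spec i (S (S k))); [lia|].
        rewrite (E (y i)). unfold m.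
        assert (y i - r <> 0) by (apply Rminus_eq_contra; apply Hy; lia). field; assumption.
Qed.

Lemma poly_eq0_everywhere k p c d : c < d -> is_poly k p ->
  (forall x, c < x < d -> p x = 0) -> forall x, p x = 0.
Proof.
  intros Hcd Hp H x.
  (* Since i >= 1, the denominators are at least 2 and all nodes lie strictly inside (c,d). *)
  destruct (interpolation k (fun i => c + (d - c) / INR (S i))) as [l [_ Hl]].
  - intros i j Hi Hj Hij E. apply Hij.
    assert (Hi' := lt_0_INR (S i) ltac:(lia)). assert (Hj' := lt_0_INR (S j) ltac:(lia)).
    assert (INR (S i) = INR (S j)); [|apply INR_eq in H0; lia].
    apply Rplus_eq_reg_l in E. unfold Rdiv in E. apply Rmult_eq_reg_l in E; [|lra].
    rewrite <- (Rinv_inv (INR (S i))), E, Rinv_inv. reflexivity.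
  - rewrite (Hl p Hp). apply ssum_eq0. intros i Hi. rewrite H; [ring|].
    assert (1 < INR (S i)) by (rewrite <- INR_1; apply lt_INR; lia).
    assert (0 < (d - c) / INR (S i)) by (apply Rdiv_lt_0_compat; lra).
    assert ((d - c) / INR (S i) < d - c); [|lra].
    apply Rlt_div_l; nra.
Qed.

Lemma poly_coeff_eq0 k (c : nat -> R) :
  (forall x, sum_f_R0 (fun i => c i * x ^ i) k = 0) -> forall i, (i <= k)%nat -> c i = 0.
Proof.
  revert c; induction k as [|k IH]; intros c H i Hi.
  - assert (i = 0%nat) as -> by lia. specialize (H 0). simpl in H. lra.
  - assert (H0 : c 0%nat = 0).
    { specialize (H 0). rewrite decomp_sum in H by lia. simpl pred in H.
      rewrite (sum_eq _ (fun _ => 0)), sum_cte in H by (intros; simpl; ring). simpl in H. lra. }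
    destruct i as [|i]; [exact H0|]. apply (IH (fun i => c (S i))); [|lia].
    (* The factor x can be cancelled only away from 0, hence the detour through the interval
       (0,1). *)
    apply (poly_eq0_everywhere k _ 0 1); [lra|now exists (fun i => c (S i))|].
    intros x Hx. apply (Rmult_eq_reg_l x); [|lra]. rewrite Rmult_0_r, <- (H x).
    rewrite (decomp_sum _ (S k)), H0, scal_sum by lia. simpl pred.
    rewrite Rmult_0_l, Rplus_0_l. apply sum_eq; intros; simpl; ring.
Qed.

(** * Smooth functions with their derivatives *)

(** Derivatives are carried as data: sums, shifts and translates act componentwise, and
    differentiation is a shift of the index. *)
Definition jet (W : nat -> R -> R) : Prop := forall m x, is_derive (W m) x (W (S m) x).

Lemma jet_cont W : jet W -> forall m, cont (W m).
Proof. intros H m. apply (cont_derive _ (W (S m))), H. Qed.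

Lemma jet_Derive W : jet W -> forall m x, Derive (W m) x = W (S m) x.
Proof. intros H m x. apply is_derive_unique, H. Qed.

Lemma jet_shift W n : jet W -> jet (fun m => W (n + m)%nat).
Proof. intros H m x. rewrite <- plus_n_Sm. apply H. Qed.

Lemma jet_minus V W : jet V -> jet W -> jet (fun m x => V m x - W m x).
Proof. intros HV HW m x. apply (is_derive_minus (K:=R_AbsRing) (V:=R_NormedModule)); auto. Qed.

Lemma jet_plus V W : jet V -> jet W -> jet (fun m x => V m x + W m x).
Proof. intros HV HW m x. apply (is_derive_plus (K:=R_AbsRing) (V:=R_NormedModule)); auto. Qed.

Lemma jet_scal a V : jet V -> jet (fun m x => a * V m x).
Proof. intros HV m x. apply (is_derive_scal (V m)). apply HV. Qed.

Lemma jet_ssum n (V : nat -> nat -> R -> R) :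
  (forall i, jet (V i)) -> jet (fun m x => ssum n (fun i => V i m x)).
Proof.
  intros H. induction n as [|n IH].
  - intros m x. apply (is_derive_const (K:=R_AbsRing) (V:=R_NormedModule) 0).
  - apply (jet_plus (fun m x => ssum n (fun i => V i m x)) (V (S n)) IH (H _)).
Qed.

Lemma poly_Derive_n k p m : is_poly k p -> is_poly (k - m) (Derive_n p m).
Proof.
  intros Hp. induction m as [|m IH].
  - now rewrite Nat.sub_0_r.
  - replace (k - S m)%nat with (k - m - 1)%nat by lia.
    apply (is_poly_Derive (k - m) (Derive_n p m) IH).
Qed.

Lemma poly_jet k p : is_poly k p -> jet (Derive_n p).
Proof. intros Hp m x. apply (is_poly_Derive (k - m) (Derive_n p m)). now apply poly_Derive_n. Qed.

Lemma deriv_bound (f f' : R -> R) c d K y : (forall x, is_derive f x (f' x)) -> c <= y <= d ->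
  (forall x, c <= x <= d -> Rabs (f' x) <= K) -> Rabs (f y - f c) <= (d - c) * K.
Proof.
  intros Hf Hy HK. destruct (MVT_gen f c y f') as [z [Hz E]].
  - intros; apply Hf.
  - intros. apply continuity_pt_filterlim. apply (cont_derive f f' Hf).
  - rewrite Rmin_left, Rmax_right in Hz by lra. rewrite E, Rabs_mult.
    rewrite (Rabs_right (y - c)) by lra.
    assert (Rabs (f' z) <= K) by (apply HK; lra).
    generalize (Rabs_pos (f' z)). nra.
Qed.

(** * From derivatives in L2 to functions *)

Lemma L2norm_nonneg c d f : 0 <= L2norm c d f.
Proof. apply sqrt_pos. Qed.

Lemma increment_L2 c d (f f' : R -> R) z y : (forall x, is_derive f x (f' x)) -> cont f' ->
  c <= z -> z <= y -> y <= d -> Rabs (f y - f z) <= sqrt (d - c) * L2norm c d f'.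
Proof.
  intros Hf Cf H1 H2 H3. rewrite <- (RInt_deriv z y f f' Hf Cf).
  rewrite (RInt_extR z y f' (fun x => 1 * f' x)) by (intros; ring).
  eapply Rle_trans; [apply RInt_CS; auto with cont|].
  apply Rmult_le_compat; try apply L2norm_nonneg.
  - unfold L2norm, inner. apply sqrt_le_1_alt. rewrite RInt_constR. lra.
  - apply sqrt_le_1_alt. now apply RInt_sq_sub.
Qed.

Lemma sup_from_zero c d (f f' : R -> R) z y : (forall x, is_derive f x (f' x)) -> cont f' ->
  c <= z <= d -> c <= y <= d -> f z = 0 -> Rabs (f y) <= sqrt (d - c) * L2norm c d f'.
Proof.
  intros Hf Cf Hz Hy E. destruct (Rle_dec z y) as [H|H].
  - replace (f y) with (f y - f z) by (rewrite E; ring). apply increment_L2; lra || auto.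
  - replace (f y) with (- (f z - f y)) by (rewrite E; ring). rewrite Rabs_Ropp.
    apply increment_L2; lra || auto.
Qed.

(** The mean value theorem applied to an antiderivative of [f]. *)
Lemma mean_zero_root c d f : c < d -> cont f -> RInt f c d = 0 ->
  exists z, c <= z <= d /\ f z = 0.
Proof.
  intros Hcd Cf E.
  assert (D : forall x, is_derive (fun y => RInt f c y) x (f x)).
  { intros x. apply (is_derive_RInt (V:=R_CompleteNormedModule) f _ c x); [|apply Cf].
    exists (mkposreal 1 Rlt_0_1). intros y _.
    apply (RInt_correct (V:=R_CompleteNormedModule)). now apply cont_ex_RInt. }
  destruct (MVT_gen (fun y => RInt f c y) c d f) as [z [Hz Ez]].
  - intros; apply D.
  - intros. apply continuity_pt_filterlim. apply (cont_derive _ f D).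
  - rewrite Rmin_left, Rmax_right in Hz by lra. exists z. split; [exact Hz|].
    rewrite RInt_point, E in Ez. unfold zero in Ez; simpl in Ez.
    apply (Rmult_eq_reg_r (d - c)); lra.
Qed.

Lemma sup_mean_zero c d (f f' : R -> R) y : c < d -> (forall x, is_derive f x (f' x)) -> cont f' ->
  RInt f c d = 0 -> c <= y <= d -> Rabs (f y) <= sqrt (d - c) * L2norm c d f'.
Proof.
  intros Hcd Hf Cf E Hy. destruct (mean_zero_root c d f Hcd (cont_derive _ _ Hf) E) as [z [Hz Ez]].
  now apply (sup_from_zero c d f f' z).
Qed.

Lemma L2norm_le_sup c d f K : c <= d -> cont f -> 0 <= K ->
  (forall x, c <= x <= d -> Rabs (f x) <= K) -> L2norm c d f <= sqrt (d - c) * K.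
Proof.
  intros Hcd Cf HK H. rewrite <- (sqrt_square K HK), <- sqrt_mult by nra.
  apply sqrt_le_1_alt. rewrite <- RInt_constR. apply RInt_leR; auto with cont.
  intros x Hx. specialize (H x Hx). apply Rabs_le_between in H. nra.
Qed.

Lemma poincare c d (f f' : R -> R) : c < d -> (forall x, is_derive f x (f' x)) -> cont f' ->
  RInt f c d = 0 -> L2norm c d f <= (d - c) * L2norm c d f'.
Proof.
  intros Hcd Hf Cf E.
  eapply Rle_trans.
  - apply (L2norm_le_sup c d f (sqrt (d - c) * L2norm c d f')); [lra|now apply (cont_derive f f')| |].
    + apply Rmult_le_pos; [apply sqrt_pos|apply L2norm_nonneg].
    + intros; now apply sup_mean_zero.
  - rewrite <- Rmult_assoc, sqrt_sqrt by lra. lra.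
Qed.

(** An approximation of the derivative is integrated, with the constant of integration fixed by the
    value at [c]. Each integration gains a factor h, and the base case is the Cauchy-Schwarz bound
    on an increment, which is the source of sqrt h. *)
Lemma taylor k : forall W c h, jet W -> 0 < h ->
  exists T, is_poly k T /\ forall y, c <= y <= c + h ->
    Rabs (W 0%nat y - T y) <= h ^ k * (sqrt h * L2norm c (c + h) (W (S k))).
Proof.
  induction k as [|k IH]; intros W c h HW Hh.
  - exists (fun _ => W 0%nat c). split; [apply is_poly_const|]. intros y Hy.
    rewrite pow_O, Rmult_1_l. replace h with (c + h - c) at 1 by ring.
    apply increment_L2; lra || auto. apply (jet_cont W HW).
  - destruct (IH (fun m => W (1 + m)%nat) c h (jet_shift W 1 HW) Hh) as [T1 [HT1 B1]].
    destruct (is_poly_antiderivative k T1 HT1) as [T [HT DT]].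
    exists (fun y => T y + (W 0%nat c - T c)). split.
    + apply is_poly_plus; [exact HT|apply is_poly_const].
    + intros y Hy. simpl pow. rewrite Rmult_assoc. replace h with (c + h - c) at 1 by ring.
      replace (W 0%nat y - (T y + (W 0%nat c - T c)))
        with ((W 0%nat y - T y) - (W 0%nat c - T c)) by ring.
      apply (deriv_bound (fun x => W 0%nat x - T x) (fun x => W 1%nat x - T1 x)); auto.
      intros x. apply (is_derive_minus (K:=R_AbsRing) (V:=R_NormedModule)); [apply HW|apply DT].
Qed.

(** The same polynomial serves for values and slopes: it is an antiderivative of the Taylor
    approximation of the derivative, one degree lower. *)
Lemma taylor1 k W c h : jet W -> 0 < h ->
  exists T, is_poly (S k) T /\ forall y, c <= y <= c + h ->
    Rabs (W 0%nat y - T y) <= h ^ S k * (sqrt h * L2norm c (c + h) (W (S (S k)))) /\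
    Rabs (W 1%nat y - Derive T y) <= h ^ k * (sqrt h * L2norm c (c + h) (W (S (S k)))).
Proof.
  intros HW Hh.
  destruct (taylor k (fun m => W (1 + m)%nat) c h (jet_shift W 1 HW) Hh) as [T1 [HT1 B1]].
  destruct (is_poly_antiderivative k T1 HT1) as [T [HT DT]].
  assert (DT' : forall x : R, is_derive (fun y : R => T y + (W 0%nat c - T c)) x (T1 x)).
  { intros x. rewrite <- (Rplus_0_r (T1 x)).
    apply (is_derive_plus (K:=R_AbsRing) (V:=R_NormedModule)); [apply DT|].
    apply (is_derive_const (K:=R_AbsRing) (V:=R_NormedModule)). }
  exists (fun y : R => T y + (W 0%nat c - T c)). split.
  - apply is_poly_plus; [exact HT|apply is_poly_const].
  - intros y Hy. split.
    + simpl pow. rewrite Rmult_assoc. replace h with (c + h - c) at 1 by ring.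
      replace (W 0%nat y - (T y + (W 0%nat c - T c)))
        with ((W 0%nat y - T y) - (W 0%nat c - T c)) by ring.
      apply (deriv_bound (fun x => W 0%nat x - T x) (fun x => W 1%nat x - T1 x)); auto.
      intros x. apply (is_derive_minus (K:=R_AbsRing) (V:=R_NormedModule)); [apply HW|apply DT].
    + replace (Derive _ y) with (T1 y) by (symmetry; apply is_derive_unique, DT').
      now apply B1.
Qed.

(** * Meshes and broken functions *)

Lemma node_le {a b} (M : mesh a b) i j : (i <= j <= ncells M)%nat -> node M i <= node M j.
Proof.
  intros [H1 H2]. induction H1 as [|j H1 IH]; [lra|].
  assert (node M (S j - 1) < node M (S j)) by (apply node_incr; lia).
  replace (S j - 1)%nat with j in H by lia. specialize (IH ltac:(lia)). lra.
Qed.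

Lemma hcell_pos {a b} (M : mesh a b) j : (1 <= j <= ncells M)%nat -> 0 < hcell M j.
Proof. intros H. unfold hcell. generalize (node_incr a b M j H). lra. Qed.

Lemma fold_Rmax_ge (l : list R) x : In x l -> x <= fold_right Rmax 0 l.
Proof.
  induction l as [|y l IH]; intros []; simpl.
  - subst. apply Rmax_l.
  - eapply Rle_trans; [now apply IH|apply Rmax_r].
Qed.

Lemma hcell_le_hmax {a b} (M : mesh a b) j : (1 <= j <= ncells M)%nat -> hcell M j <= hmax M.
Proof. intros H. apply fold_Rmax_ge, in_map, in_seq. lia. Qed.

Lemma hmax_pos {a b} (M : mesh a b) : 0 < hmax M.
Proof.
  eapply Rlt_le_trans; [|apply (hcell_le_hmax M 1)]; [apply hcell_pos|];
    generalize (ncells_pos a b M); lia.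
Qed.

(* Interface j separates cell j from cell [nx M j], interface N being identified with interface 0. *)
Definition nx {a b} (M : mesh a b) (j : nat) : nat := if Nat.eqb j (ncells M) then 1%nat else S j.
Definition pr {a b} (M : mesh a b) (j : nat) : nat := if Nat.eqb j 1 then ncells M else (j - 1)%nat.

Lemma nx_range {a b} (M : mesh a b) j : (1 <= j <= ncells M)%nat -> (1 <= nx M j <= ncells M)%nat.
Proof. intros H. unfold nx. destruct (Nat.eqb_spec j (ncells M)); lia. Qed.

Lemma pr_range {a b} (M : mesh a b) j : (1 <= j <= ncells M)%nat -> (1 <= pr M j <= ncells M)%nat.
Proof. intros H. unfold pr. destruct (Nat.eqb_spec j 1); lia. Qed.

Lemma pr_nx {a b} (M : mesh a b) j : (1 <= j <= ncells M)%nat -> pr M (nx M j) = j.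
Proof.
  intros H. unfold pr, nx. destruct (Nat.eqb_spec j (ncells M)) as [->|]; [reflexivity|].
  destruct (Nat.eqb_spec (S j) 1); lia.
Qed.

Lemma ssum_nx {a b} (M : mesh a b) f :
  ssum (ncells M) (fun j => f (nx M j)) = ssum (ncells M) f.
Proof.
  assert (HN := ncells_pos a b M). unfold nx. destruct (ncells M) as [|n]; [lia|].
  rewrite (ssum_first n f). cbn [ssum]. rewrite Nat.eqb_refl.
  rewrite (ssum_ext n _ (fun i => f (S i))); [ring|].
  intros i Hi. destruct (Nat.eqb_spec i (S n)); [lia|reflexivity].
Qed.

Definition bint {a b} (M : mesh a b) (F : nat -> R -> R) : R :=
  ssum (ncells M) (fun j => RInt (F j) (node M (j - 1)) (node M j)).
Definition bin {a b} (M : mesh a b) (F G : nat -> R -> R) : R := bint M (fun j x => F j x * G j x).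
Definition bnorm {a b} (M : mesh a b) (F : nat -> R -> R) : R := sqrt (bin M F F).

(** The link between a function on the line, whose node values are arbitrary, and its smooth
    extensions from the open cells. *)
Definition represents {a b} (M : mesh a b) (f : R -> R) (F : nat -> R -> R) : Prop :=
  forall j y, in_cell M j y -> f y = F j y.

Lemma cell_le {a b} (M : mesh a b) j : (1 <= j <= ncells M)%nat -> node M (j - 1) <= node M j.
Proof. intros; apply node_le; lia. Qed.

Lemma RInt_represents {a b} (M : mesh a b) f F : represents M f F -> (forall j, cont (F j)) ->
  RInt f a b = bint M F.
Proof.
  intros HR HF.
  assert (H : forall n, (n <= ncells M)%nat -> is_RInt f (node M 0) (node M n)
      (ssum n (fun j => RInt (F j) (node M (j - 1)) (node M j)))).
  { induction n as [|n IH]; intros Hn.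
    - apply (is_RInt_point (V:=R_NormedModule)).
    - apply (is_RInt_Chasles (V:=R_NormedModule) f _ (node M n)); [apply IH; lia|].
      replace (S n - 1)%nat with n by lia.
      apply (is_RInt_ext (V:=R_NormedModule) (F (S n))).
      + rewrite Rmin_left, Rmax_right by (apply node_le; lia). intros x Hx.
        symmetry. apply HR. split; [lia|]. now replace (S n - 1)%nat with n by lia.
      + apply (RInt_correct (V:=R_CompleteNormedModule)). now apply cont_ex_RInt. }
  specialize (H (ncells M) (le_n _)). rewrite node_first, node_last in H.
  now apply is_RInt_unique.
Qed.

Lemma inner_represents {a b} (M : mesh a b) f F g G :
  represents M f F -> represents M g G -> (forall j, cont (F j)) -> (forall j, cont (G j)) ->
  inner a b f g = bin M F G.
Proof.
  intros Rf Rg CF CG. apply RInt_represents; [|auto with cont].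
  intros j y Hy. now rewrite (Rf j y Hy), (Rg j y Hy).
Qed.

Lemma bnorm_global {a b} (M : mesh a b) w : cont w -> bnorm M (fun _ => w) = L2norm a b w.
Proof.
  intros Cw. unfold bnorm, L2norm. f_equal. symmetry.
  now apply inner_represents.
Qed.

Lemma bint_ext {a b} (M : mesh a b) F G :
  (forall j x, (1 <= j <= ncells M)%nat -> node M (j - 1) < x < node M j -> F j x = G j x) ->
  bint M F = bint M G.
Proof.
  intros H. apply ssum_ext. intros j Hj. apply RInt_ext_in; [now apply cell_le|]. intros; now apply H.
Qed.

Lemma bint_plus {a b} (M : mesh a b) F G : (forall j, cont (F j)) -> (forall j, cont (G j)) ->
  bint M (fun j x => F j x + G j x) = bint M F + bint M G.
Proof.
  intros HF HG. unfold bint. rewrite <- ssum_plus. apply ssum_ext. intros. now apply RInt_plusR.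
Qed.

Lemma bint_minus {a b} (M : mesh a b) F G : (forall j, cont (F j)) -> (forall j, cont (G j)) ->
  bint M (fun j x => F j x - G j x) = bint M F - bint M G.
Proof.
  intros HF HG. unfold bint. rewrite <- ssum_minus. apply ssum_ext. intros. now apply RInt_minusR.
Qed.

Lemma bint_scal {a b} (M : mesh a b) l F : (forall j, cont (F j)) ->
  bint M (fun j x => l * F j x) = l * bint M F.
Proof.
  intros HF. unfold bint. rewrite <- ssum_scal. apply ssum_ext. intros. now apply RInt_scalR.
Qed.

Lemma bin_self_ge0 {a b} (M : mesh a b) F : (forall j, cont (F j)) -> 0 <= bin M F F.
Proof.
  intros HF. apply ssum_ge0. intros j Hj. apply RInt_sq_ge0; [now apply cell_le|apply HF].
Qed.

Lemma bnorm_sq {a b} (M : mesh a b) F : (forall j, cont (F j)) -> bnorm M F * bnorm M F = bin M F F.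
Proof. intros HF. apply sqrt_sqrt. now apply bin_self_ge0. Qed.

Lemma bnorm_nonneg {a b} (M : mesh a b) F : 0 <= bnorm M F.
Proof. apply sqrt_pos. Qed.

Lemma bin_sym {a b} (M : mesh a b) F G : bin M F G = bin M G F.
Proof. apply bint_ext; intros; ring. Qed.

Lemma bin_minus_l {a b} (M : mesh a b) F G H :
  (forall j, cont (F j)) -> (forall j, cont (G j)) -> (forall j, cont (H j)) ->
  bin M (fun j x => F j x - G j x) H = bin M F H - bin M G H.
Proof.
  intros HF HG HH. unfold bin. rewrite <- bint_minus by auto with cont.
  apply bint_ext; intros; ring.
Qed.

Lemma bin_plus_sq {a b} (M : mesh a b) F G s : (forall j, cont (F j)) -> (forall j, cont (G j)) ->
  bin M (fun j x => F j x + s * G j x) (fun j x => F j x + s * G j x)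
  = bin M F F + 2 * s * bin M F G + s * s * bin M G G.
Proof.
  intros HF HG. unfold bin.
  rewrite (bint_ext M _ (fun j x => F j x * F j x +
      (2 * s * (F j x * G j x) + s * s * (G j x * G j x)))) by (intros; ring).
  rewrite !bint_plus, !bint_scal by auto 7 with cont. ring.
Qed.

Lemma bin_CS {a b} (M : mesh a b) F G : (forall j, cont (F j)) -> (forall j, cont (G j)) ->
  Rabs (bin M F G) <= bnorm M F * bnorm M G.
Proof.
  intros HF HG. apply abs_le_sqrt_mult; try (now apply bin_self_ge0).
  apply discriminant_nonpos; try (now apply bin_self_ge0).
  intros s. rewrite <- bin_plus_sq by assumption. apply bin_self_ge0. auto with cont.
Qed.

Lemma bnorm_triangle {a b} (M : mesh a b) F G : (forall j, cont (F j)) -> (forall j, cont (G j)) ->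
  bnorm M (fun j x => F j x + G j x) <= bnorm M F + bnorm M G.
Proof.
  intros HF HG.
  assert (P := bnorm_nonneg M F). assert (Q := bnorm_nonneg M G).
  rewrite <- (sqrt_square (bnorm M F + bnorm M G)) by lra.
  apply sqrt_le_1_alt.
  replace (bin M (fun j x => F j x + G j x) (fun j x => F j x + G j x))
    with (bin M (fun j x => F j x + 1 * G j x) (fun j x => F j x + 1 * G j x))
    by (apply bint_ext; intros; ring).
  rewrite bin_plus_sq by assumption.
  generalize (bin_CS M F G HF HG) (Rle_abs (bin M F G)) (bnorm_sq M F HF) (bnorm_sq M G HG). nra.
Qed.

Lemma bnorm_ext {a b} (M : mesh a b) F G :
  (forall j x, (1 <= j <= ncells M)%nat -> node M (j - 1) < x < node M j -> F j x = G j x) ->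
  bnorm M F = bnorm M G.
Proof. intros H. unfold bnorm. f_equal. apply bint_ext. intros. now rewrite H. Qed.

Lemma bnorm_cells {a b} (M : mesh a b) F : (forall j, cont (F j)) ->
  bnorm M F = sqrt (ssum (ncells M) (fun j =>
    L2norm (node M (j - 1)) (node M j) (F j) * L2norm (node M (j - 1)) (node M j) (F j))).
Proof.
  intros HF. unfold bnorm. f_equal. apply ssum_ext. intros j Hj.
  symmetry. apply L2norm_sq; [now apply cell_le|apply HF].
Qed.

Lemma bnorm_le_cells {a b} (M : mesh a b) F (K : R) (G : nat -> R) :
  (forall j, cont (F j)) -> 0 <= K ->
  (forall j, (1 <= j <= ncells M)%nat -> L2norm (node M (j - 1)) (node M j) (F j) <= K * G j) ->
  bnorm M F <= K * sqrt (ssum (ncells M) (fun j => G j * G j)).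
Proof.
  intros HF HK H. rewrite bnorm_cells by exact HF.
  rewrite <- (sqrt_square K HK) at 1. rewrite <- sqrt_mult; [|nra|apply ssum_ge0; intros; nra].
  apply sqrt_le_1_alt. rewrite <- ssum_scal. apply ssum_le. intros j Hj.
  generalize (H j Hj) (L2norm_nonneg (node M (j - 1)) (node M j) (F j)). nra.
Qed.

(** * The bilinear form on broken smooth functions *)

(* [V j m] is the derivative of order m on cell j. *)
Definition bjet (V : nat -> nat -> R -> R) : Prop := forall j, jet (V j).

Definition tm {a b} (M : mesh a b) (V : nat -> nat -> R -> R) (m j : nat) : R := V j m (node M j).
(** The left end of the next cell. At interface N the next cell is cell 1, so the value is taken at
    node 0, which is the periodicity convention. *)
Definition tp {a b} (M : mesh a b) (V : nat -> nat -> R -> R) (m j : nat) : R :=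
  V (nx M j) m (node M (nx M j - 1)).
Definition av {a b} (M : mesh a b) V (m j : nat) : R := (tm M V m j + tp M V m j) / 2.
Definition jp {a b} (M : mesh a b) V (m j : nat) : R := tp M V m j - tm M V m j.

Definition Bf {a b} (M : mesh a b) (W V : nat -> nat -> R -> R) : R :=
  bin M (fun j => W j 1%nat) (fun j => V j 1%nat)
  + ssum (ncells M) (fun j => av M W 1 j * jp M V 0 j + jp M W 0 j * av M V 1 j).

Lemma bjet_cont V m : bjet V -> forall j, cont (V j m).
Proof. intros HV j. apply (jet_cont (V j) (HV j)). Qed.
#[export] Hint Resolve bjet_cont jet_cont : cont.

Lemma Bf_sym {a b} (M : mesh a b) W V : Bf M W V = Bf M V W.
Proof. unfold Bf. rewrite bin_sym. f_equal. apply ssum_ext; intros; ring. Qed.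

Lemma Bf_minus_l {a b} (M : mesh a b) W V Z : bjet W -> bjet V -> bjet Z ->
  Bf M (fun j m x => W j m x - V j m x) Z = Bf M W Z - Bf M V Z.
Proof.
  intros HW HV HZ. unfold Bf.
  rewrite (bin_minus_l M (fun j => W j 1%nat) (fun j => V j 1%nat)) by auto with cont.
  replace (ssum (ncells M) (fun j => av M (fun j m x => W j m x - V j m x) 1 j * jp M Z 0 j
     + jp M (fun j m x => W j m x - V j m x) 0 j * av M Z 1 j))
  with (ssum (ncells M) (fun j => av M W 1 j * jp M Z 0 j + jp M W 0 j * av M Z 1 j)
     - ssum (ncells M) (fun j => av M V 1 j * jp M Z 0 j + jp M V 0 j * av M Z 1 j)); [ring|].
  rewrite <- ssum_minus. apply ssum_ext. intros. unfold av, jp, tm, tp. field.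
Qed.

(** Integration by parts on each cell leaves end values; the left-end ones are moved to the
    preceding interface by [ssum_nx]. There w^- v_x^- - w^+ v_x^+ = -[w]{v_x} - {w}[v_x], and the
    first product cancels the one in the form. *)
Lemma Bf_parts {a b} (M : mesh a b) W V : bjet W -> bjet V ->
  Bf M W V = - bin M (fun j => W j 0%nat) (fun j => V j 2%nat)
    + ssum (ncells M) (fun j => av M W 1 j * jp M V 0 j - av M W 0 j * jp M V 1 j).
Proof.
  intros HW HV. unfold Bf.
  assert (E : bin M (fun j => W j 1%nat) (fun j => V j 1%nat)
    = ssum (ncells M) (fun j => tm M W 0 j * tm M V 1 j - tp M W 0 j * tp M V 1 j)
      - bin M (fun j => W j 0%nat) (fun j => V j 2%nat)).
  { rewrite ssum_minus. unfold tp, tm.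
    rewrite (ssum_nx M (fun j => W j 0%nat (node M (j - 1)) * V j 1%nat (node M (j - 1)))).
    unfold bin, bint. rewrite <- !ssum_minus. apply ssum_ext. intros j Hj.
    rewrite (RInt_ibp _ _ (W j 0%nat) (W j 1%nat) (V j 1%nat) (V j 2%nat)); auto with cont.
    all: apply HW || apply HV. }
  rewrite E. unfold Rminus at 1. rewrite (Rplus_comm (ssum _ _)), Rplus_assoc, <- ssum_plus.
  f_equal. apply ssum_ext. intros. unfold av, jp. field.
Qed.

Definition periodic_jet (a b : R) (W : nat -> R -> R) : Prop :=
  forall m x, W m (x + (b - a)) = W m x.

Lemma tp_global {a b} (M : mesh a b) W m j : periodic_jet a b W -> (1 <= j <= ncells M)%nat ->
  tp M (fun _ => W) m j = W m (node M j).
Proof.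
  intros HP Hj. unfold tp, nx. destruct (Nat.eqb_spec j (ncells M)) as [->|].
  - simpl. rewrite node_first, node_last, <- (HP m a). f_equal; ring.
  - now replace (S j - 1)%nat with j by lia.
Qed.

(** By symmetry the smooth function may be put in the second slot before integrating by parts. The
    interface terms then contain only its own jumps, which vanish by smoothness and periodicity. *)
Lemma Bf_consistent {a b} (M : mesh a b) W V : jet W -> periodic_jet a b W -> bjet V ->
  Bf M (fun _ => W) V = - bin M (fun _ => W 2%nat) (fun j => V j 0%nat).
Proof.
  intros HW HP HV. rewrite Bf_sym, Bf_parts, bin_sym; [|exact HV|intros j; exact HW].
  rewrite ssum_eq0; [ring|]. intros j Hj. unfold jp. rewrite !tp_global by assumption.
  unfold tm. ring.
Qed.

(** * One-sided limits, and agreement of the given form with its broken version *)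

(** [lim] is specified only on Cauchy filters; convergence provides the Cauchy property, and
    uniqueness of limits then identifies the value. *)
Lemma lim_filter_unique {F : (R -> Prop) -> Prop} {FF : ProperFilter F} l :
  filterlim (fun x => x) F (locally l) -> lim F = l.
Proof.
  intros H.
  assert (Hc : cauchy F) by (intros eps; exists l; apply H; now exists eps).
  apply (is_filter_lim_unique (F:=F)).
  - intros P [eps HP]. generalize (complete_cauchy F FF Hc eps). apply filter_imp. exact HP.
  - exact H.
Qed.

Lemma lim_left_value v V x0 y : x0 < y -> continuous V y ->
  (forall x, x0 < x < y -> v x = V x) -> lim_left v y = V y.
Proof.
  intros Hx CV E. apply (lim_filter_unique (F:=filtermap v (at_left y))).
  apply (filterlim_ext_loc (F:=at_left y) V v).
  - assert (He : 0 < y - x0) by lra. exists (mkposreal _ He). intros x Hb Hl. symmetry. apply E.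
    change (Rabs (x - y) < y - x0) in Hb. apply Rabs_def2 in Hb. lra.
  - intros P HP. apply filter_le_within, CV, HP.
Qed.

Lemma lim_right_value v V x0 y : y < x0 -> continuous V y ->
  (forall x, y < x < x0 -> v x = V x) -> lim_right v y = V y.
Proof.
  intros Hx CV E. apply (lim_filter_unique (F:=filtermap v (at_right y))).
  apply (filterlim_ext_loc (F:=at_right y) V v).
  - assert (He : 0 < x0 - y) by lra. exists (mkposreal _ He). intros x Hb Hl. symmetry. apply E.
    change (Rabs (x - y) < x0 - y) in Hb. apply Rabs_def2 in Hb. lra.
  - intros P HP. apply filter_le_within, CV, HP.
Qed.

Lemma trace_minus_tm {a b} (M : mesh a b) v V m j : bjet V ->
  represents M v (fun j => V j m) -> (1 <= j <= ncells M)%nat ->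
  trace_minus M v j = tm M V m j.
Proof.
  intros HV HR Hj. apply (lim_left_value v (V j m) (node M (j - 1))).
  - now apply node_incr.
  - now apply (bjet_cont V m).
  - intros x Hx. now apply HR.
Qed.

Lemma trace_plus_tp {a b} (M : mesh a b) v V m j : bjet V ->
  represents M v (fun j => V j m) -> (1 <= j <= ncells M)%nat ->
  trace_plus M v j = tp M V m j.
Proof.
  intros HV HR Hj. unfold trace_plus, tp.
  replace (if Nat.eqb j (ncells M) then node M 0 else node M j) with (node M (nx M j - 1)).
  - apply (lim_right_value v (V (nx M j) m) (node M (nx M j))).
    + now apply node_incr, nx_range.
    + now apply (bjet_cont V m).
    + intros x Hx. apply HR. split; [now apply nx_range|exact Hx].
  - unfold nx. destruct (Nat.eqb_spec j (ncells M)); [reflexivity|]. f_equal; lia.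
Qed.

Lemma represents_Derive {a b} (M : mesh a b) v V : bjet V ->
  represents M v (fun j => V j 0%nat) -> represents M (Derive v) (fun j => V j 1%nat).
Proof.
  intros HV HR j y Hy. rewrite <- (jet_Derive (V j) (HV j) 0 y). apply Derive_ext_loc.
  destruct Hy as [Hj [H1 H2]].
  assert (He : 0 < Rmin (y - node M (j - 1)) (node M j - y)) by (apply Rmin_pos; lra).
  exists (mkposreal _ He). intros x Hb. apply HR. split; [exact Hj|].
  change (Rabs (x - y) < Rmin (y - node M (j - 1)) (node M j - y)) in Hb.
  generalize (Rmin_l (y - node M (j - 1)) (node M j - y)) (Rmin_r (y - node M (j - 1)) (node M j - y)).
  apply Rabs_def2 in Hb. lra.
Qed.

Lemma A_form_Bf {a b} (M : mesh a b) w W v V : bjet W -> bjet V ->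
  represents M w (fun j => W j 0%nat) -> represents M v (fun j => V j 0%nat) ->
  A_form M w v = Bf M W V.
Proof.
  intros HW HV Rw Rv. unfold A_form, Bf. rewrite !sum_n_m_ssum.
  assert (Dw := represents_Derive M w W HW Rw). assert (Dv := represents_Derive M v V HV Rv).
  f_equal.
  - apply ssum_ext. intros j Hj. apply RInt_ext_in; [now apply cell_le|]. intros x Hx.
    rewrite (Dw j x), (Dv j x); [reflexivity| |]; now split.
  - apply ssum_ext. intros j Hj. unfold avg, jump, av, jp.
    rewrite (trace_minus_tm M (Derive w) W 1), (trace_plus_tp M (Derive w) W 1) by assumption.
    rewrite (trace_minus_tm M (Derive v) V 1), (trace_plus_tp M (Derive v) V 1) by assumption.
    rewrite (trace_minus_tm M w W 0), (trace_plus_tp M w W 0) by assumption.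
    rewrite (trace_minus_tm M v V 0), (trace_plus_tp M v V 0) by assumption. reflexivity.
Qed.

(** * Elements of V_h^k as families of polynomials *)

Definition poly_jet_broken (k : nat) (V : nat -> nat -> R -> R) : Prop :=
  bjet V /\ forall j, is_poly k (V j 0%nat).

Lemma poly_broken_deriv k V m j : poly_jet_broken k V -> is_poly (k - m) (V j m).
Proof.
  intros [HV HP]. induction m as [|m IH].
  - rewrite Nat.sub_0_r. apply HP.
  - replace (k - S m)%nat with (k - m - 1)%nat by lia.
    apply (is_poly_ext _ (Derive (V j m))); [intros; now apply jet_Derive|].
    now apply is_poly_Derive.
Qed.

Lemma in_Vh_broken {a b} (M : mesh a b) k v : in_Vh M k v ->
  exists V, poly_jet_broken k V /\ represents M v (fun j => V j 0%nat).
Proof.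
  intros H.
  destruct (functional_choice (fun j p => is_poly k p /\ forall y, in_cell M j y -> v y = p y)) as [p Hp].
  - intros j. destruct (Nat.le_gt_cases 1 j) as [H1|H1]; [destruct (Nat.le_gt_cases j (ncells M)) as [H2|H2]|].
    + apply H; lia.
    + exists (fun _ => 0). split; [apply is_poly_const|]. intros y [Hy _]; lia.
    + exists (fun _ => 0). split; [apply is_poly_const|]. intros y [Hy _]; lia.
  - exists (fun j => Derive_n (p j)). split; [split|].
    + intros j. apply (poly_jet k), Hp.
    + intros j. apply Hp.
    + intros j y Hy. now apply Hp.
Qed.

Lemma broken_in_Vh {a b} (M : mesh a b) k v V : poly_jet_broken k V ->
  represents M v (fun j => V j 0%nat) -> in_Vh M k v.
Proof. intros [_ HP] HR j Hj. exists (V j 0%nat). split; [apply HP|]. intros y Hy. now apply HR. Qed.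

(** Open cells are disjoint, so prescriptions on different cells never conflict. This turns broken
    test functions into admissible test functions of the scheme. *)
Lemma glue {a b} (M : mesh a b) (F : nat -> R -> R) : exists f, represents M f F.
Proof.
  destruct (functional_choice (fun y z => forall j, in_cell M j y -> z = F j y)) as [f Hf].
  - intros y. destruct (classic (exists j, in_cell M j y)) as [[j Hj]|HN].
    + exists (F j y). intros i Hi. replace i with j; [reflexivity|].
      destruct Hi as [Hi [Hi1 Hi2]], Hj as [Hj [Hj1 Hj2]].
      destruct (Nat.lt_trichotomy i j) as [Hl|[Hl|Hl]]; [|congruence|]; exfalso.
      * assert (node M i <= node M (j - 1)) by (apply node_le; lia). lra.
      * assert (node M j <= node M (i - 1)) by (apply node_le; lia). lra.
    + exists 0. intros j Hj. exfalso. apply HN. now exists j.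
  - exists f. intros j y Hy. now apply Hf.
Qed.

(** * Functionals commuting with the time derivative *)

Definition evolution (U : nat -> nat -> R -> R -> R) : Prop :=
  (forall i m t x, 0 <= t -> is_derive (U i m t) x (U i (S m) t x)) /\
  (forall i m t x, 0 < t -> is_derive (fun s => U i m s x) t (U (S i) m t x)) /\
  (forall i m t x, 0 <= t ->
     filterlim (fun p : R * R => U i m (fst p) (snd p))
               (within (fun p : R * R => 0 <= fst p) (locally (t, x)))
               (locally (U i m t x))).

(** Commutation with the time derivative, tested along smooth evolutions: differentiation at
    positive times, continuity from the right at 0. Evaluations and moments have this property and
    linear combinations keep it, which covers every coefficient of the projections below. *)
Definition time_linear (L : (nat -> R -> R) -> R) : Prop :=
  forall U, evolution U ->
    (forall t, 0 < t -> is_derive (fun s => L (fun m => U 0%nat m s)) t (L (fun m => U 1%nat m t))) /\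
    filterlim (fun s => L (fun m => U 0%nat m s)) (at_right 0) (locally (L (fun m => U 0%nat m 0))).

Lemma continuous_Rmax0 (f : R * R -> R) z : continuous f z -> continuous (fun y => Rmax 0 (f y)) z.
Proof.
  intros Hf. apply (continuous_comp f (Rmax 0)); [exact Hf|].
  intros P [eps HP]. exists eps. intros y Hy. apply HP.
  change (Rabs (y - f z) < eps) in Hy. change (Rabs (Rmax 0 y - Rmax 0 (f z)) < eps).
  eapply Rle_lt_trans; [|exact Hy]. unfold Rmax, Rabs.
  repeat destruct Rle_dec; repeat destruct Rcase_abs; lra.
Qed.

(* Continuation to negative times by the initial value, so that two-sided continuity results apply. *)
Lemma evolution_continuous U i m z : evolution U ->
  continuous (fun p : R * R => U i m (Rmax 0 (fst p)) (snd p)) z.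
Proof.
  intros [_ [_ HC]].
  assert (C1 : continuous (fun p : R * R => Rmax 0 (fst p)) z)
    by (apply continuous_Rmax0, continuous_fst).
  assert (C2 : continuous (fun p : R * R => (Rmax 0 (fst p), snd p)) z).
  { apply (continuous_comp_2 (fun p : R * R => Rmax 0 (fst p)) snd pair);
      [exact C1|apply continuous_snd|]. apply continuous_ext with (fun p => p); [now intros []|].
    apply continuous_id. }
  assert (E := HC i m (Rmax 0 (fst z)) (snd z) (Rmax_l _ _)).
  intros P HP. specialize (E P HP).
  specialize (C2 _ E). unfold filtermap in *.
  revert C2. apply filter_imp. intros p Hp. apply Hp. apply Rmax_l.
Qed.

Lemma at_right_cont (f : R -> R) : continuous f 0 ->
  filterlim f (at_right 0) (locally (f 0)).
Proof. intros C P HP. apply filter_le_within, C, HP. Qed.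

Lemma filterlim_at_right_ext (f g : R -> R) l : (forall s, 0 < s -> f s = g s) ->
  filterlim f (at_right 0) (locally l) -> filterlim g (at_right 0) (locally l).
Proof.
  intros E. apply filterlim_ext_loc. exists (mkposreal 1 Rlt_0_1). intros s _ Hs. now apply E.
Qed.

Lemma time_linear_eval m y : time_linear (fun W => W m y).
Proof.
  intros U HU. split.
  - intros t Ht. now apply HU.
  - apply (filterlim_at_right_ext (fun s => U 0%nat m (Rmax 0 s) y)).
    + intros s Hs. rewrite Rmax_right; [reflexivity|lra].
    + rewrite <- (Rmax_right 0 0) at 2 by lra.
      apply (at_right_cont (fun s => U 0%nat m (Rmax 0 s) y)).
      apply (continuous_comp_2 (fun s => s) (fun _ => y) (fun s x => U 0%nat m (Rmax 0 s) x));
        [apply continuous_id|apply continuous_const|].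
      now apply (evolution_continuous U 0 m (0, y)).
Qed.

Lemma time_linear_plus L1 L2 : time_linear L1 -> time_linear L2 ->
  time_linear (fun W => L1 W + L2 W).
Proof.
  intros H1 H2 U HU. destruct (H1 U HU) as [D1 F1], (H2 U HU) as [D2 F2]. split.
  - intros t Ht. apply (is_derive_plus (K:=R_AbsRing) (V:=R_NormedModule)); auto.
  - apply (filterlim_comp_2 _ _ Rplus F1 F2).
    apply (filterlim_plus (K:=R_AbsRing) (V:=R_NormedModule)).
Qed.

Lemma time_linear_scal l L : time_linear L -> time_linear (fun W => l * L W).
Proof.
  intros H1 U HU. destruct (H1 U HU) as [D1 F1]. split.
  - intros t Ht. apply (is_derive_scal (fun s => L (fun m => U 0%nat m s))); auto.
  - apply (filterlim_comp _ _ _ _ (fun x => l * x) _ _ _ F1).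
    apply (filterlim_scal_r (K:=R_AbsRing) (V:=R_NormedModule) l).
Qed.

Lemma time_linear_ext L1 L2 : (forall W, L1 W = L2 W) -> time_linear L1 -> time_linear L2.
Proof.
  intros E H U HU. destruct (H U HU) as [D F]. split.
  - intros t Ht. rewrite <- E. eapply is_derive_ext; [intros; apply E|]. now apply D.
  - rewrite <- E. eapply filterlim_ext; [intros; apply E|]. exact F.
Qed.

Lemma time_linear_minus L1 L2 : time_linear L1 -> time_linear L2 ->
  time_linear (fun W => L1 W - L2 W).
Proof.
  intros H1 H2. apply (time_linear_ext (fun W => L1 W + -1 * L2 W)); [intros; ring|].
  apply time_linear_plus; [exact H1|]. now apply time_linear_scal.
Qed.

Lemma time_linear_zero : time_linear (fun _ => 0).
Proof.
  apply (time_linear_ext (fun W => 0 * W 0%nat 0)); [intros; ring|].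
  apply time_linear_scal, time_linear_eval.
Qed.

Lemma time_linear_ssum n (L : nat -> (nat -> R -> R) -> R) :
  (forall i, (1 <= i <= n)%nat -> time_linear (L i)) ->
  time_linear (fun W => ssum n (fun i => L i W)).
Proof.
  induction n as [|n IH]; intros H.
  - apply time_linear_zero.
  - apply (time_linear_plus (fun W => ssum n (fun i => L i W)) (L (S n))).
    + apply IH. intros; apply H; lia.
    + apply H; lia.
Qed.

Lemma param_integral_continuous (f : R -> R -> R) c d t : c <= d ->
  (forall z : R * R, continuous (fun p : R * R => f (fst p) (snd p)) z) ->
  continuous (fun s => RInt (f s) c d) t.
Proof.
  intros Hcd Cf.
  assert (C1 : forall s, cont (f s)).
  { intros s x. apply (continuous_comp_2 (fun _ => s) (fun x => x) f);
      [apply continuous_const|apply continuous_id|apply (Cf (s, x))]. }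
  intros P [eps HP].
  (* The added 1 keeps the denominator positive when c = d. *)
  assert (He : 0 < eps / (d - c + 1)) by (apply Rdiv_lt_0_compat; [apply cond_pos|lra]).
  destruct (uniform_continuity_2d_1d' f c d t) with (eps := mkposreal _ He) as [del Hdel].
  { intros x _. apply continuity_2d_pt_filterlim, (Cf (t, x)). }
  exists del. intros s Hs. apply HP.
  change (Rabs (s - t) < del) in Hs. apply Rabs_def2 in Hs.
  change (Rabs (RInt (f s) c d - RInt (f t) c d) < eps).
  rewrite <- RInt_minusR by apply C1.
  assert (B : forall x, c <= x <= d -> Rabs (f s x - f t x) <= eps / (d - c + 1)).
  { intros x Hx. left. apply (Hdel x t x s); try lra.
    rewrite Rminus_diag, Rabs_R0. apply cond_pos. }
  apply Rle_lt_trans with ((d - c) * (eps / (d - c + 1))).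
  - apply (abs_RInt_le_const (fun x => f s x - f t x)); auto.
    apply cont_ex_RInt. auto with cont.
  - apply (Rmult_lt_reg_r (d - c + 1)); [lra|].
    replace ((d - c) * (eps / (d - c + 1)) * (d - c + 1)) with ((d - c) * eps) by (field; lra).
    generalize (cond_pos eps). nra.
Qed.

Lemma time_linear_integral c h p : cont p ->
  time_linear (fun W => RInt (fun x => W 0%nat (c + h * x) * p x) 0 1).
Proof.
  intros Cp U HU.
  assert (C : forall i z, continuous (fun q : R * R =>
      U i 0%nat (Rmax 0 (fst q)) (c + h * snd q) * p (snd q)) z).
  { intros i z. apply (continuous_mult (K:=R_AbsRing)).
    - apply (continuous_comp_2 fst (fun q : R * R => c + h * snd q) (fun s x => U i 0%nat (Rmax 0 s) x)).
      + apply continuous_fst.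
      + apply (continuous_comp snd (fun x => c + h * x)); [apply continuous_snd|].
        assert (K : cont (fun x => c + h * x)) by auto with cont. apply K.
      + now apply (evolution_continuous U i 0 (fst z, c + h * snd z)).
    - apply (continuous_comp snd p); [apply continuous_snd|apply Cp]. }
  assert (CI : forall s, 0 <= s -> ex_RInt (fun x => U 0%nat 0%nat s (c + h * x) * p x) 0 1).
  { intros s Hs. apply cont_ex_RInt. apply cont_mult; [|exact Cp].
    apply (cont_comp (U 0%nat 0%nat s)); [|auto with cont].
    apply (cont_derive _ (U 0%nat 1%nat s)). intros; now apply HU. }
  assert (Pos : forall t, 0 < t -> locally t (fun s => 0 < s)).
  { intros t Ht. now apply (open_gt 0 t). }
  split.
  - intros t Ht.
    assert (E : forall s v, 0 < s -> is_derive (fun z => U 0%nat 0%nat z (c + h * v) * p v) s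
         (U 1%nat 0%nat s (c + h * v) * p v)).
    { intros s v Hs. apply (is_derive_ext (fun z => p v * U 0%nat 0%nat z (c + h * v)));
        [intros; apply Rmult_comm|].
      rewrite (Rmult_comm _ (p v)). apply (is_derive_scal (fun z => U 0%nat 0%nat z (c + h * v))).
      now apply HU. }
    rewrite (RInt_extR 0 1 (fun x => U 1%nat 0%nat t (c + h * x) * p x)
       (fun x => Derive (fun z => U 0%nat 0%nat z (c + h * x) * p x) t))
      by (intros; symmetry; now apply is_derive_unique, E).
    apply (is_derive_RInt_param (fun z x => U 0%nat 0%nat z (c + h * x) * p x)).
    + generalize (Pos t Ht). apply filter_imp. intros s Hs v _. eexists. now apply E.
    + intros v _.
      (* Near t > 0 the truncation [Rmax 0] acts as the identity, so joint continuity of the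
         truncated extension suffices for differentiation under the integral. *)
      apply (continuity_2d_pt_ext_loc (fun u v => U 1%nat 0%nat (Rmax 0 u) (c + h * v) * p v)).
      * exists (mkposreal t Ht). intros u w Hu _. apply Rabs_def2 in Hu. simpl in Hu.
        assert (Hu0 : 0 < u) by lra.
        rewrite Rmax_right by lra. symmetry. now apply is_derive_unique, E.
      * apply continuity_2d_pt_filterlim. apply (C 1%nat (t, v)).
    + generalize (Pos t Ht). apply filter_imp. intros s Hs. apply CI; lra.
  - apply (filterlim_at_right_ext
        (fun s => RInt (fun x => U 0%nat 0%nat (Rmax 0 s) (c + h * x) * p x) 0 1)).
    + intros s Hs. rewrite Rmax_right; [reflexivity|lra].
    + assert (F : filterlim (fun s => RInt (fun x => U 0%nat 0%nat (Rmax 0 s) (c + h * x) * p x) 0 1)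
         (at_right 0) (locally (RInt (fun x => U 0%nat 0%nat (Rmax 0 0) (c + h * x) * p x) 0 1))).
      { apply (at_right_cont (fun s => RInt (fun x => U 0%nat 0%nat (Rmax 0 s) (c + h * x) * p x) 0 1)).
        apply (param_integral_continuous (fun s x => U 0%nat 0%nat (Rmax 0 s) (c + h * x) * p x));
          [lra|apply C]. }
      rewrite (Rmax_right 0 0) in F by lra. exact F.
Qed.

Lemma cont_bounded f c d : c <= d -> cont f -> exists K, forall x, c <= x <= d -> Rabs (f x) <= K.
Proof.
  intros Hcd Cf.
  destruct (continuity_ab_maj (fun x => Rabs (f x)) c d Hcd) as [z [Hz _]].
  - intros x _. apply (continuity_pt_comp f Rabs); [|apply Rcontinuity_abs].
    apply continuity_pt_filterlim, Cf.
  - exists (Rabs (f z)). exact Hz.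
Qed.

(** The seminorm is continuous in time on the compact interval [0,T]. Finiteness matters because
    [sup_time] is an actual supremum only for bounded families. *)
Lemma evolution_seminorm_bounded U i m c d T : evolution U -> c <= d -> 0 <= T ->
  exists K, forall t, 0 <= t <= T -> L2norm c d (U i m t) <= K.
Proof.
  intros HU Hcd HT.
  destruct (cont_bounded (fun s => RInt (fun x =>
     U i m (Rmax 0 s) x * U i m (Rmax 0 s) x) c d) 0 T HT) as [K HK].
  - intros t. apply (param_integral_continuous (fun s x => U i m (Rmax 0 s) x * U i m (Rmax 0 s) x));
      [exact Hcd|]. intros z.
    apply (continuous_mult (K:=R_AbsRing)); now apply evolution_continuous.
  - exists (sqrt K). intros t Ht. apply sqrt_le_1_alt. eapply Rle_trans; [apply Rle_abs|].
    specialize (HK t Ht). rewrite Rmax_right in HK by lra. exact HK.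
Qed.

(** * Interpolation on the reference cell [0,1] *)

(* Degrees of freedom number 1, ..., k+1: the moments up to degree k-2, then the two end values. *)
Definition dof (k i : nat) (f : R -> R) : R :=
  if Nat.ltb i k then RInt (fun x => f x * x ^ (i - 1)) 0 1
  else if Nat.eqb i k then f 0 else f 1.

Lemma cont_pow n : cont (fun x => x ^ n).
Proof. apply (is_poly_cont n), is_poly_pow. lia. Qed.
#[export] Hint Resolve cont_pow : cont.

Lemma dof_ext k i f g : (forall x, f x = g x) -> dof k i f = dof k i g.
Proof.
  intros E. unfold dof. rewrite !E.
  rewrite (RInt_extR 0 1 _ (fun x => g x * x ^ (i - 1))) by (intros; now rewrite E). reflexivity.
Qed.

Lemma dof_plus k i f g : cont f -> cont g -> dof k i (fun x => f x + g x) = dof k i f + dof k i g.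
Proof.
  intros Cf Cg. unfold dof. destruct (Nat.ltb i k); [|now destruct (Nat.eqb i k)].
  rewrite <- RInt_plusR by auto with cont. apply RInt_extR; intros; ring.
Qed.

Lemma dof_scal k i l f : cont f -> dof k i (fun x => l * f x) = l * dof k i f.
Proof.
  intros Cf. unfold dof. destruct (Nat.ltb i k); [|now destruct (Nat.eqb i k)].
  rewrite <- RInt_scalR by auto with cont. apply RInt_extR; intros; ring.
Qed.

Lemma dof_minus k i f g : cont f -> cont g -> dof k i (fun x => f x - g x) = dof k i f - dof k i g.
Proof.
  intros Cf Cg. rewrite (dof_ext k i _ (fun x => f x + -1 * g x)) by (intros; ring).
  rewrite dof_plus, dof_scal by auto with cont. ring.
Qed.

Lemma dof_ssum k i n (f : nat -> R -> R) : (forall j, cont (f j)) ->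
  dof k i (fun x => ssum n (fun j => f j x)) = ssum n (fun j => dof k i (f j)).
Proof.
  intros Cf. induction n as [|n IH]; cbn [ssum].
  - rewrite (dof_ext k i _ (fun x => 0 * 0)) by (intros; ring).
    rewrite (dof_scal k i 0 (fun _ => 0)) by auto with cont. ring.
  - rewrite (dof_plus k i (fun x => ssum n (fun j => f j x))) by auto with cont. now rewrite IH.
Qed.

Lemma dof_bound k i f K : cont f -> (forall x, 0 <= x <= 1 -> Rabs (f x) <= K) ->
  Rabs (dof k i f) <= K.
Proof.
  intros Cf H. unfold dof. destruct (Nat.ltb i k).
  - replace K with ((1 - 0) * K) by ring. apply (abs_RInt_le_const (fun x => f x * x ^ (i - 1))).
    + lra.
    + apply cont_ex_RInt. auto with cont.
    + intros x Hx. rewrite Rabs_mult. rewrite <- (Rmult_1_r K).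
      apply Rmult_le_compat; try apply Rabs_pos; auto.
      rewrite <- RPow_abs, Rabs_right by lra. rewrite <- (pow1 (i - 1)). apply pow_incr. lra.
  - destruct (Nat.eqb i k); apply H; lra.
Qed.

Lemma dof_moments k f v : cont f -> is_poly (k - 2) v -> (2 <= k)%nat ->
  (forall i, (1 <= i < k)%nat -> dof k i f = 0) -> RInt (fun x => f x * v x) 0 1 = 0.
Proof.
  intros Cf [c Hc] Hk H.
  rewrite (RInt_extR 0 1 _ (fun x => ssum (S (k - 2)) (fun i => c (i - 1)%nat * (f x * x ^ (i - 1))))).
  - rewrite (RInt_ssum 0 1 _ (fun i x => c (i - 1)%nat * (f x * x ^ (i - 1)))) by auto with cont.
    apply ssum_eq0. intros i Hi. rewrite RInt_scalR by auto with cont.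
    specialize (H i ltac:(lia)). unfold dof in H.
    destruct (Nat.ltb_spec i k); [|lia]. rewrite H. ring.
  - intros x. rewrite Hc, sum_f_R0_ssum, <- ssum_scal. apply ssum_ext; intros; ring.
Qed.

(** With zero end values, integration by parts turns the integral of p'^2 into minus that of p p''.
    As p'' has degree at most k-2, the vanishing moments make it zero; then p is constant, and it
    vanishes at 0. *)
Lemma dof_unisolvent k p : (2 <= k)%nat -> is_poly k p ->
  (forall i, (1 <= i <= k + 1)%nat -> dof k i p = 0) -> forall x, p x = 0.
Proof.
  intros Hk Hp H.
  destruct (is_poly_Derive k p Hp) as [Hp1 D1].
  destruct (is_poly_Derive (k - 1) (Derive p) Hp1) as [Hp2 D2].
  assert (C1 := is_poly_cont _ _ Hp1). assert (C2 := is_poly_cont _ _ Hp2).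
  assert (P0 : p 0 = 0).
  { generalize (H k ltac:(lia)). unfold dof. rewrite Nat.ltb_irrefl, Nat.eqb_refl. easy. }
  assert (P1 : p 1 = 0).
  { generalize (H (k + 1)%nat ltac:(lia)). unfold dof.
    destruct (Nat.ltb_spec (k + 1) k); [lia|]. destruct (Nat.eqb_spec (k + 1) k); [lia|easy]. }
  assert (E : RInt (fun x => Derive p x * Derive p x) 0 1 = 0).
  { rewrite (RInt_ibp 0 1 p (Derive p) (Derive p) (Derive (Derive p))) by assumption.
    replace (k - 1 - 1)%nat with (k - 2)%nat in Hp2 by lia.
    assert (Z := dof_moments k p _ (is_poly_cont k p Hp) Hp2 Hk
      (fun i Hi => H i ltac:(lia))).
    rewrite P0, P1, Z. as_real. ring. }
  apply (poly_eq0_everywhere k p 0 1); [lra|exact Hp|]. intros x Hx.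
  assert (B := sup_from_zero 0 1 p (Derive p) 0 x D1 C1 ltac:(lra) ltac:(lra) P0).
  unfold L2norm, inner in B. rewrite E, sqrt_0, Rmult_0_r in B.
  apply Rabs_le_between in B. lra.
Qed.

(** Unisolvence says that the matrix of degrees of freedom on monomials is injective; the columns of
    its inverse are the monomial coefficients of the dual basis. *)
Lemma dof_basis k : (2 <= k)%nat -> exists beta : nat -> R -> R,
  (forall m, is_poly k (beta m)) /\
  (forall i m, (1 <= i <= k + 1)%nat -> dof k i (beta m) = if Nat.eqb i m then 1 else 0).
Proof.
  intros Hk.
  destruct (injective_inverse (k + 1) (fun i j => dof k i (fun x => x ^ (j - 1)))) as [B HB].
  - intros c Hc j Hj.
    assert (Z : forall x, ssum (k + 1) (fun j => c j * x ^ (j - 1)) = 0).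
    { apply (dof_unisolvent k); [exact Hk| |].
      - apply (is_poly_ssum k (k + 1) (fun j x => c j * x ^ (j - 1))). intros i Hi.
        apply is_poly_scal, is_poly_pow. lia.
      - intros i Hi. rewrite (dof_ssum k i (k + 1) (fun j x => c j * x ^ (j - 1))) by auto with cont.
        rewrite <- (Hc i Hi). apply ssum_ext. intros m Hm.
        rewrite dof_scal by auto with cont. ring. }
    replace j with (S (j - 1)) by lia.
    apply (poly_coeff_eq0 k (fun i => c (S i))); [|lia].
    intros x. rewrite sum_f_R0_ssum, <- (Z x), Nat.add_1_r. apply ssum_ext. intros i Hi.
    now replace (S (i - 1)) with i by lia.
  - exists (fun m x => ssum (k + 1) (fun j => B j m * x ^ (j - 1))). split.
    + intros m. apply (is_poly_ssum k (k + 1) (fun j x => B j m * x ^ (j - 1))). intros i Hi.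
      apply is_poly_scal, is_poly_pow. lia.
    + intros i m Hi. rewrite (dof_ssum k i (k + 1) (fun j x => B j m * x ^ (j - 1))) by auto with cont.
      rewrite <- (HB i m Hi). apply ssum_ext. intros j Hj.
      rewrite dof_scal by auto with cont. ring.
Qed.

Lemma finite_bound n (P : nat -> R -> Prop) :
  (forall i K K', P i K -> K <= K' -> P i K') -> (forall i, exists K, P i K) ->
  exists K, 0 <= K /\ forall i, (1 <= i <= n)%nat -> P i K.
Proof.
  intros Hmon Hex. induction n as [|n [K [HK IH]]].
  - exists 0. split; [lra|]. intros; lia.
  - destruct (Hex (S n)) as [K' HK']. exists (Rmax K K'). split.
    + eapply Rle_trans; [exact HK|apply Rmax_l].
    + intros i Hi. destruct (Nat.eq_dec i (S n)) as [->|Hn].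
      * apply (Hmon _ K'); [exact HK'|apply Rmax_r].
      * apply (Hmon _ K); [apply IH; lia|apply Rmax_l].
Qed.

Lemma dof_basis_bounded k : (2 <= k)%nat -> exists (beta : nat -> R -> R) (K : R),
  0 <= K /\ (forall m, is_poly k (beta m)) /\
  (forall i m, (1 <= i <= k + 1)%nat -> dof k i (beta m) = if Nat.eqb i m then 1 else 0) /\
  (forall m x, (1 <= m <= k + 1)%nat -> 0 <= x <= 1 ->
     Rabs (beta m x) <= K /\ Rabs (Derive (beta m) x) <= K).
Proof.
  intros Hk. destruct (dof_basis k Hk) as [beta [Hb Hd]].
  destruct (finite_bound (k + 1) (fun m K => forall x, 0 <= x <= 1 ->
      Rabs (beta m x) <= K /\ Rabs (Derive (beta m) x) <= K)) as [K [HK HB]].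
  - intros m K K' H HKK x Hx. destruct (H x Hx). split; lra.
  - intros m. destruct (is_poly_Derive k _ (Hb m)) as [Hb1 _].
    destruct (cont_bounded (beta m) 0 1 ltac:(lra) (is_poly_cont _ _ (Hb m))) as [K1 H1].
    destruct (cont_bounded (Derive (beta m)) 0 1 ltac:(lra) (is_poly_cont _ _ Hb1)) as [K2 H2].
    exists (Rmax K1 K2). intros x Hx. generalize (H1 x Hx) (H2 x Hx) (Rmax_l K1 K2) (Rmax_r K1 K2).
    split; lra.
  - exists beta, K. repeat split; auto; now apply HB.
Qed.

(** * Transport to a cell [c, c+h] *)

(** Derivative of order [m] of the function on [c, c+h] with coefficients [d] in the transported
    reference basis; [(/ h) ^ m] is the chain-rule factor of the affine map. *)
Definition comb (k : nat) (beta : nat -> R -> R) (c h : R) (d : nat -> R) (m : nat) (y : R) : R :=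
  ssum (k + 1) (fun i => d i * ((/ h) ^ m * Derive_n (beta i) m (/ h * y + - c / h))).

Definition pull (c h : R) (f : R -> R) (x : R) : R := f (c + h * x).

Lemma cont_pull c h f : cont f -> cont (pull c h f).
Proof. intros Cf. apply (cont_comp f); auto with cont. Qed.
#[export] Hint Resolve cont_pull : cont.

Lemma is_poly_pull k c h f : is_poly k f -> is_poly k (pull c h f).
Proof.
  intros Hf. apply (is_poly_ext _ (fun x => f (h * x + c))); [intros; unfold pull; f_equal; ring|].
  now apply is_poly_affine.
Qed.

Lemma comb_jet k beta c h d : (forall m, is_poly k (beta m)) -> jet (comb k beta c h d).
Proof.
  intros Hb. unfold comb.
  apply (jet_ssum (k + 1)
    (fun i m y => d i * ((/ h) ^ m * Derive_n (beta i) m (/ h * y + - c / h)))).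
  intros i. apply (jet_scal (d i) (fun m y => (/ h) ^ m * Derive_n (beta i) m (/ h * y + - c / h))).
  intros m x.
  replace ((/ h) ^ S m * Derive_n (beta i) (S m) (/ h * x + - c / h))
    with ((/ h) ^ m * (/ h * Derive_n (beta i) (S m) (/ h * x + - c / h)))
    by (simpl pow; ring).
  apply (is_derive_scal (fun x => Derive_n (beta i) m (/ h * x + - c / h))).
  apply (is_derive_comp (Derive_n (beta i) m) (fun x => / h * x + - c / h)).
  - apply (poly_jet k _ (Hb i)).
  - auto_derive; [easy|ring].
Qed.

Lemma comb_poly k beta c h d : (forall m, is_poly k (beta m)) -> is_poly k (comb k beta c h d 0).
Proof.
  intros Hb. apply (is_poly_ssum k (k + 1)
    (fun i y => d i * ((/ h) ^ 0 * Derive_n (beta i) 0 (/ h * y + - c / h)))).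
  intros i _. apply is_poly_scal, is_poly_scal. apply (is_poly_affine k (/ h) (- c / h) (beta i)), Hb.
Qed.

Lemma pull_comb k beta c h d x : 0 < h ->
  pull c h (comb k beta c h d 0) x = ssum (k + 1) (fun i => d i * beta i x).
Proof.
  intros Hh. apply ssum_ext. intros i _. simpl.
  replace (/ h * (c + h * x) + - c / h) with x by (field; lra). ring.
Qed.

Lemma dof_comb k beta c h d i : (forall m, is_poly k (beta m)) ->
  (forall i m, (1 <= i <= k + 1)%nat -> dof k i (beta m) = if Nat.eqb i m then 1 else 0) ->
  0 < h -> (1 <= i <= k + 1)%nat -> dof k i (pull c h (comb k beta c h d 0)) = d i.
Proof.
  intros Hb Hd Hh Hi.
  assert (Cb : forall m, cont (beta m)) by (intros; now apply (is_poly_cont k)).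
  rewrite (dof_ext k i _ (fun x => ssum (k + 1) (fun m => d m * beta m x)))
    by (intros; now apply pull_comb).
  rewrite (dof_ssum k i (k + 1) (fun m x => d m * beta m x)) by auto with cont.
  rewrite <- (ssum_delta (k + 1) d i Hi). apply ssum_ext. intros m Hm.
  rewrite dof_scal, Hd, (Nat.eqb_sym m i) by auto with cont.
  destruct (Nat.eqb i m); ring.
Qed.

Lemma comb_reproduces k beta c h T : (2 <= k)%nat -> (forall m, is_poly k (beta m)) ->
  (forall i m, (1 <= i <= k + 1)%nat -> dof k i (beta m) = if Nat.eqb i m then 1 else 0) ->
  0 < h -> is_poly k T -> forall y, comb k beta c h (fun i => dof k i (pull c h T)) 0 y = T y.
Proof.
  intros Hk Hb Hd Hh HT.
  set (Q := comb k beta c h (fun i => dof k i (pull c h T)) 0).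
  assert (HQ : is_poly k Q) by now apply comb_poly.
  assert (Z : forall x, pull c h (fun y => Q y - T y) x = 0).
  { apply (dof_unisolvent k); [exact Hk|apply is_poly_pull; now apply is_poly_minus|].
    intros i Hi.
    assert (E := dof_minus k i (pull c h Q) (pull c h T)
      (is_poly_cont k _ (is_poly_pull k c h Q HQ)) (is_poly_cont k _ (is_poly_pull k c h T HT))).
    eapply eq_trans; [exact E|]. unfold Q. rewrite dof_comb by assumption. ring. }
  intros y. specialize (Z ((y - c) / h)). unfold pull in Z.
  replace (c + h * ((y - c) / h)) with y in Z by (field; lra). lra.
Qed.

Lemma comb_plus k beta c h d e m y :
  comb k beta c h (fun i => d i + e i) m y = comb k beta c h d m y + comb k beta c h e m y.
Proof. unfold comb. rewrite <- ssum_plus. apply ssum_ext; intros; ring. Qed.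

Lemma comb_bound k beta K c h d rho m y : 0 <= K ->
  (forall i x, (1 <= i <= k + 1)%nat -> 0 <= x <= 1 -> Rabs (Derive_n (beta i) m x) <= K) ->
  0 < h -> c <= y <= c + h ->
  (forall i, (1 <= i <= k + 1)%nat -> Rabs (d i) <= rho) ->
  Rabs (comb k beta c h d m y) <= (/ h) ^ m * (INR (k + 1) * K * rho).
Proof.
  intros HK HB Hh Hy Hd. unfold comb.
  assert (Hp : 0 < (/ h) ^ m) by (apply pow_lt, Rinv_0_lt_compat, Hh).
  eapply Rle_trans; [apply ssum_abs|].
  replace ((/ h) ^ m * (INR (k + 1) * K * rho)) with (INR (k + 1) * (rho * ((/ h) ^ m * K))) by ring.
  rewrite <- ssum_const. apply ssum_le. intros i Hi.
  rewrite !Rabs_mult, (Rabs_right ((/ h) ^ m)) by lra.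
  apply Rmult_le_compat; auto using Rabs_pos.
  - apply Rmult_le_pos; [lra|apply Rabs_pos].
  - apply Rmult_le_compat_l; [lra|]. apply HB; [exact Hi|].
    replace (/ h * y + - c / h) with ((y - c) / h) by (field; lra).
    split; [apply Rdiv_le_0_compat; lra|]. apply Rle_div_l; lra.
Qed.

Definition local_interp (k : nat) (beta : nat -> R -> R) (c h : R) (W : nat -> R -> R) :=
  comb k beta c h (fun i => dof k i (pull c h (W 0%nat))).

(** The interpolation reproduces the Taylor polynomial T, so the error is the interpolant of W - T
    minus W - T itself. Degrees of freedom on the reference cell are bounded by the sup norm; the
    k+1 basis functions bounded by K give (k+1)K, and the 1 accounts for W - T. *)
Lemma local_interp_error k beta K c h W : (2 <= k)%nat -> 0 <= K ->
  (forall m, is_poly k (beta m)) ->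
  (forall i m, (1 <= i <= k + 1)%nat -> dof k i (beta m) = if Nat.eqb i m then 1 else 0) ->
  (forall m x, (1 <= m <= k + 1)%nat -> 0 <= x <= 1 ->
     Rabs (beta m x) <= K /\ Rabs (Derive (beta m) x) <= K) ->
  jet W -> 0 < h -> forall y, c <= y <= c + h ->
  Rabs (local_interp k beta c h W 0 y - W 0%nat y)
    <= (1 + INR (k + 1) * K) * (h ^ k * (sqrt h * L2norm c (c + h) (W (k + 1)%nat))) /\
  Rabs (local_interp k beta c h W 1 y - W 1%nat y)
    <= (1 + INR (k + 1) * K) * (h ^ (k - 1) * (sqrt h * L2norm c (c + h) (W (k + 1)%nat))).
Proof.
  intros Hk HK Hb Hd HB HW Hh y Hy.
  destruct (taylor1 (k - 1) W c h HW Hh) as [T [HT BT]].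
  replace (S (k - 1)) with k in * by lia.
  replace (W (k + 1)%nat) with (W (S k)) by (f_equal; lia).
  set (G := sqrt h * L2norm c (c + h) (W (S k))) in *.
  set (r := fun i => dof k i (pull c h (W 0%nat)) - dof k i (pull c h T)).
  assert (CT := is_poly_cont k T HT).
  assert (Hr : forall i, Rabs (r i) <= h ^ k * G).
  { intros i. unfold r. rewrite <- dof_minus by auto with cont.
    apply dof_bound; [auto with cont|]. intros x Hx. apply BT. nra. }
  assert (E : forall m, local_interp k beta c h W m y
      = comb k beta c h r m y + comb k beta c h (fun i => dof k i (pull c h T)) m y).
  { intros m. rewrite <- comb_plus. apply ssum_ext. intros i Hi. unfold r. ring. }
  assert (E0 := comb_reproduces k beta c h T Hk Hb Hd Hh HT).
  assert (E1 : comb k beta c h (fun i => dof k i (pull c h T)) 1 y = Derive T y).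
  { rewrite <- (jet_Derive _ (comb_jet k beta c h _ Hb)). now apply Derive_ext. }
  destruct (BT y Hy) as [B0 B1]. split.
  - rewrite E, E0.
    replace (comb k beta c h r 0 y + T y - W 0%nat y)
      with (comb k beta c h r 0 y + - (W 0%nat y - T y)) by ring.
    eapply Rle_trans; [apply Rabs_triang|]. rewrite Rabs_Ropp.
    assert (C := comb_bound k beta K c h r (h ^ k * G) 0 y HK
      (fun i x Hi Hx => proj1 (HB i x Hi Hx)) Hh Hy (fun i _ => Hr i)).
    rewrite pow_O, Rmult_1_l in C. rewrite Rmult_plus_distr_r, Rmult_1_l. lra.
  - rewrite E, E1.
    replace (comb k beta c h r 1 y + Derive T y - W 1%nat y)
      with (comb k beta c h r 1 y + - (W 1%nat y - Derive T y)) by ring.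
    eapply Rle_trans; [apply Rabs_triang|]. rewrite Rabs_Ropp.
    assert (C := comb_bound k beta K c h r (h ^ k * G) 1 y HK
      (fun i x Hi Hx => proj2 (HB i x Hi Hx)) Hh Hy (fun i _ => Hr i)).
    replace ((/ h) ^ 1 * (INR (k + 1) * K * (h ^ k * G))) with (INR (k + 1) * K * (h ^ (k - 1) * G)) in C.
    + lra.
    + replace k with (S (k - 1)) at 4 by lia. simpl. field. lra.
Qed.

Lemma cell_moments k c h F v : 0 < h -> (2 <= k)%nat -> cont F -> is_poly (k - 2) v ->
  (forall i, (1 <= i < k)%nat -> dof k i (pull c h F) = 0) ->
  RInt (fun y => F y * v y) c (c + h) = 0.
Proof.
  intros Hh Hk CF Hv H.
  assert (E := RInt_comp_lin (V:=R_CompleteNormedModule) (fun y => F y * v y) h c 0 1).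
  replace (h * 0 + c) with c in E by ring. replace (h * 1 + c) with (c + h) in E by ring.
  rewrite <- E by (apply cont_ex_RInt; apply cont_mult; [exact CF|now apply (is_poly_cont (k - 2))]).
  rewrite (RInt_extR 0 1 _ (fun x => h * (pull c h F x * pull c h v x)))
    by (intros; unfold pull, scal; simpl; unfold mult; simpl; rewrite (Rplus_comm c); reflexivity).
  assert (Pv := is_poly_pull (k - 2) c h v Hv).
  rewrite RInt_scalR by (apply cont_mult; [auto with cont|now apply (is_poly_cont (k - 2))]).
  rewrite (dof_moments k); auto with cont. as_real; ring.
Qed.

(** * Approximation operators adapted to the bilinear form *)

(** What the energy argument asks of the projection, stated once for both constructions. In the
    third clause the left side vanishes for the projection of degree k >= 2 built below; for k = 1
    it is of order h^2 times the fourth-order seminorm, which is why k+3 appears there. The fourth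
    clause makes P(u_t) the time derivative of Pu. *)
Definition approx_operator {a b} (M : mesh a b) (k : nat) (kappa : R)
    (P : (nat -> R -> R) -> nat -> nat -> R -> R) : Prop :=
  (forall W, jet W -> poly_jet_broken k (P W)) /\
  (forall W, jet W ->
     bnorm M (fun j x => P W j 0%nat x - W 0%nat x) <= kappa * L2norm a b (W (k + 1)%nat)) /\
  (forall W V, jet W -> periodic_jet a b W -> poly_jet_broken k V ->
     Rabs (Bf M (fun j m x => P W j m x - W m x) V)
     <= kappa * L2norm a b (W (k + 3)%nat) * bnorm M (fun j => V j 0%nat)) /\
  (forall j y, time_linear (fun W => P W j 0%nat y)).

(** * Degree at least two: the global projection *)

Definition dual_basis (k : nat) (beta : nat -> R -> R) (K : R) : Prop :=
  0 <= K /\ (forall m, is_poly k (beta m)) /\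
  (forall i m, (1 <= i <= k + 1)%nat -> dof k i (beta m) = if Nat.eqb i m then 1 else 0) /\
  (forall m x, (1 <= m <= k + 1)%nat -> 0 <= x <= 1 ->
     Rabs (beta m x) <= K /\ Rabs (Derive (beta m) x) <= K).

Definition cellcomb {a b} (M : mesh a b) k beta (d : nat -> nat -> R) (j : nat) : nat -> R -> R :=
  comb k beta (node M (j - 1)) (hcell M j) (d j).

Definition cell_pull {a b} (M : mesh a b) (j : nat) (f : R -> R) : R -> R :=
  pull (node M (j - 1)) (hcell M j) f.

Definition interp_dofs {a b} (M : mesh a b) k (W : nat -> R -> R) (j i : nat) : R :=
  dof k i (cell_pull M j (W 0%nat)).

(* Opposite values on the two sides of every interface, so that the average vanishes. *)
Definition edge_dofs {a b} (M : mesh a b) k (v : nat -> R) (j i : nat) : R :=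
  if Nat.eqb i k then - v (pr M j) else if Nat.eqb i (k + 1) then v j else 0.

Definition correction {a b} (M : mesh a b) k beta (v : nat -> R) : nat -> nat -> R -> R :=
  cellcomb M k beta (edge_dofs M k v).

Definition interp_defect {a b} (M : mesh a b) k beta (W : nat -> R -> R) (j m : nat) (x : R) : R :=
  cellcomb M k beta (interp_dofs M k W) j m x - W m x.

Lemma cell_right {a b} (M : mesh a b) j : node M (j - 1) + hcell M j = node M j.
Proof. unfold hcell. ring. Qed.

Lemma cellcomb_poly {a b} (M : mesh a b) k beta K d : dual_basis k beta K ->
  poly_jet_broken k (cellcomb M k beta d).
Proof.
  intros [_ [Hb _]]. split.
  - intros j. now apply comb_jet.
  - intros j. now apply comb_poly.
Qed.

Lemma cellcomb_dof {a b} (M : mesh a b) k beta K d j i : dual_basis k beta K ->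
  (1 <= j <= ncells M)%nat -> (1 <= i <= k + 1)%nat ->
  dof k i (cell_pull M j (cellcomb M k beta d j 0)) = d j i.
Proof. intros [_ [Hb [Hd _]]] Hj Hi. apply dof_comb; auto. now apply hcell_pos. Qed.

Lemma dof_left k f : dof k k f = f 0.
Proof. unfold dof. now rewrite Nat.ltb_irrefl, Nat.eqb_refl. Qed.

Lemma dof_right k f : dof k (k + 1) f = f 1.
Proof.
  unfold dof. destruct (Nat.ltb_spec (k + 1) k); [lia|].
  destruct (Nat.eqb_spec (k + 1) k); [lia|reflexivity].
Qed.

Lemma cell_pull_left {a b} (M : mesh a b) k j f : dof k k (cell_pull M j f) = f (node M (j - 1)).
Proof. rewrite dof_left. unfold cell_pull, pull. f_equal; ring. Qed.

Lemma cell_pull_right {a b} (M : mesh a b) k j f : dof k (k + 1) (cell_pull M j f) = f (node M j).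
Proof. rewrite dof_right. unfold cell_pull, pull, hcell. f_equal; ring. Qed.

Lemma bin_moments {a b} (M : mesh a b) k F V : (2 <= k)%nat -> (forall j, cont (F j)) ->
  poly_jet_broken k V ->
  (forall j i, (1 <= j <= ncells M)%nat -> (1 <= i < k)%nat -> dof k i (cell_pull M j (F j)) = 0) ->
  bin M F (fun j => V j 2%nat) = 0.
Proof.
  intros Hk CF HV H. apply ssum_eq0. intros j Hj.
  rewrite <- (cell_right M j) at 1. apply (cell_moments k); auto.
  - now apply hcell_pos.
  - now apply poly_broken_deriv.
  - intros i Hi. now apply H.
Qed.

Lemma interp_defect_jet {a b} (M : mesh a b) k beta K W : dual_basis k beta K -> jet W ->
  bjet (interp_defect M k beta W).
Proof.
  intros Hb HW j. apply (jet_minus (cellcomb M k beta (interp_dofs M k W) j) W); [|exact HW].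
  now apply (cellcomb_poly M k beta K).
Qed.

Lemma interp_defect_dof {a b} (M : mesh a b) k beta K W j i : dual_basis k beta K -> jet W ->
  (1 <= j <= ncells M)%nat -> (1 <= i <= k + 1)%nat ->
  dof k i (cell_pull M j (interp_defect M k beta W j 0)) = 0.
Proof.
  intros Hb HW Hj Hi.
  assert (Cc : cont (cellcomb M k beta (interp_dofs M k W) j 0))
    by (apply bjet_cont, (cellcomb_poly M k beta K _ Hb)).
  assert (CW : cont (W 0%nat)) by auto with cont.
  assert (E := dof_minus k i (cell_pull M j (cellcomb M k beta (interp_dofs M k W) j 0))
    (cell_pull M j (W 0%nat)) (cont_pull _ _ _ Cc) (cont_pull _ _ _ CW)).
  rewrite (cellcomb_dof M k beta K _ j i Hb Hj Hi) in E.
  eapply eq_trans; [exact E|]. unfold interp_dofs. ring.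
Qed.

Lemma interp_defect_trace {a b} (M : mesh a b) k beta K W j : (2 <= k)%nat -> dual_basis k beta K ->
  jet W -> (1 <= j <= ncells M)%nat ->
  tm M (interp_defect M k beta W) 0 j = 0 /\ tp M (interp_defect M k beta W) 0 j = 0.
Proof.
  intros Hk Hb HW Hj. split.
  - unfold tm. rewrite <- (cell_pull_right M k j).
    apply (interp_defect_dof M k beta K W j (k + 1)); auto; lia.
  - unfold tp. rewrite <- (cell_pull_left M k (nx M j)).
    apply (interp_defect_dof M k beta K W (nx M j) k); auto; [now apply nx_range|lia].
Qed.

Lemma interp_defect_bound {a b} (M : mesh a b) k beta K W j y : (2 <= k)%nat -> dual_basis k beta K ->
  jet W -> (1 <= j <= ncells M)%nat -> node M (j - 1) <= y <= node M j ->
  Rabs (interp_defect M k beta W j 0 y) <= (1 + INR (k + 1) * K) *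
     (hcell M j ^ k * (sqrt (hcell M j) * L2norm (node M (j - 1)) (node M j) (W (k + 1)%nat))) /\
  Rabs (interp_defect M k beta W j 1 y) <= (1 + INR (k + 1) * K) *
     (hcell M j ^ (k - 1) * (sqrt (hcell M j) * L2norm (node M (j - 1)) (node M j) (W (k + 1)%nat))).
Proof.
  intros Hk [HK [Hb [Hd HB]]] HW Hj Hy.
  assert (Hh := hcell_pos M j Hj).
  generalize (local_interp_error k beta K (node M (j - 1)) (hcell M j) W Hk HK Hb Hd HB HW Hh y).
  rewrite cell_right. intros H. exact (H Hy).
Qed.

Lemma correction_trace {a b} (M : mesh a b) k beta K v j : (2 <= k)%nat -> dual_basis k beta K ->
  (1 <= j <= ncells M)%nat ->
  tm M (correction M k beta v) 0 j = v j /\ tp M (correction M k beta v) 0 j = - v j.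
Proof.
  intros Hk Hb Hj. split.
  - unfold tm. rewrite <- (cell_pull_right M k j).
    unfold correction. rewrite (cellcomb_dof M k beta K) by (auto; lia).
    unfold edge_dofs. destruct (Nat.eqb_spec (k + 1) k); [lia|]. now rewrite Nat.eqb_refl.
  - unfold tp. rewrite <- (cell_pull_left M k (nx M j)).
    assert (Hn := nx_range M j Hj).
    unfold correction. rewrite (cellcomb_dof M k beta K) by (auto; lia).
    unfold edge_dofs. rewrite Nat.eqb_refl, pr_nx by exact Hj. reflexivity.
Qed.

Lemma correction_dof {a b} (M : mesh a b) k beta K v j i : dual_basis k beta K ->
  (1 <= j <= ncells M)%nat -> (1 <= i < k)%nat ->
  dof k i (cell_pull M j (correction M k beta v j 0)) = 0.
Proof.
  intros Hb Hj Hi. unfold correction. rewrite (cellcomb_dof M k beta K) by (auto; lia).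
  unfold edge_dofs. destruct (Nat.eqb_spec i k); [lia|].
  destruct (Nat.eqb_spec i (k + 1)); [lia|reflexivity].
Qed.

(** For k >= 2 the moment of degree 0 is among those that vanish. Zero mean is what allows a
    correction to be controlled by its derivative alone. *)
Lemma correction_mean {a b} (M : mesh a b) k beta K v j : (2 <= k)%nat -> dual_basis k beta K ->
  (1 <= j <= ncells M)%nat ->
  RInt (correction M k beta v j 0) (node M (j - 1)) (node M j) = 0.
Proof.
  intros Hk Hb Hj.
  rewrite (RInt_extR _ _ _ (fun y => correction M k beta v j 0 y * 1)) by (intros; ring).
  rewrite <- (cell_right M j) at 1. apply (cell_moments k); auto.
  - now apply hcell_pos.
  - apply bjet_cont, (cellcomb_poly M k beta K _ Hb).
  - apply is_poly_const.
  - intros i Hi. now apply (correction_dof M k beta K).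
Qed.

(* The two expressions of the form, compared at [correction v] tested with itself. *)
Lemma correction_energy {a b} (M : mesh a b) k beta K v : (2 <= k)%nat -> dual_basis k beta K ->
  bin M (fun j => correction M k beta v j 1%nat) (fun j => correction M k beta v j 1%nat)
  = 2 * ssum (ncells M) (fun j => av M (correction M k beta v) 1 j * v j).
Proof.
  intros Hk Hb. set (E := correction M k beta v).
  assert (HE : poly_jet_broken k E) by now apply (cellcomb_poly M k beta K).
  assert (P := Bf_parts M E E (proj1 HE) (proj1 HE)).
  rewrite (bin_moments M k (fun j => E j 0%nat) E Hk) in P;
    [|apply bjet_cont, HE|exact HE|intros; now apply (correction_dof M k beta K)].
  unfold Bf in P.
  (* At each interface the correction has jump -2v and average 0. The definition of the form thus
     contributes -4 {e_x} v and its integrated version -2 {e_x} v. *)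
  rewrite (ssum_ext _ _ (fun j => -4 * (av M E 1 j * v j))) in P.
  rewrite (ssum_ext (ncells M) (fun j => _ - _) (fun j => -2 * (av M E 1 j * v j))) in P.
  - rewrite !ssum_scal in P. lra.
  - intros j Hj. destruct (correction_trace M k beta K v j Hk Hb Hj) as [Tm Tp]. fold E in Tm, Tp.
    unfold av at 2, jp at 1. rewrite Tm, Tp. field.
  - intros j Hj. destruct (correction_trace M k beta K v j Hk Hb Hj) as [Tm Tp]. fold E in Tm, Tp.
    unfold jp. rewrite Tm, Tp. ring.
Qed.

Lemma correction_value_bound {a b} (M : mesh a b) k beta K v j y : (2 <= k)%nat ->
  dual_basis k beta K -> (1 <= j <= ncells M)%nat -> node M (j - 1) <= y <= node M j ->
  Rabs (correction M k beta v j 0 y)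
  <= sqrt (hcell M j) * L2norm (node M (j - 1)) (node M j) (correction M k beta v j 1).
Proof.
  intros Hk Hb Hj Hy. apply sup_mean_zero; auto.
  - now apply node_incr.
  - apply (cellcomb_poly M k beta K _ Hb).
  - apply bjet_cont, (cellcomb_poly M k beta K _ Hb).
  - now apply (correction_mean M k beta K).
Qed.

Lemma comb_combination k beta c h n (z : nat -> R) d (e : nat -> nat -> R) m y :
  (forall i, (1 <= i <= k + 1)%nat -> d i = ssum n (fun p => z p * e p i)) ->
  comb k beta c h d m y = ssum n (fun p => z p * comb k beta c h (e p) m y).
Proof.
  intros H. unfold comb.
  rewrite (ssum_ext n _ (fun p => ssum (k + 1) (fun i => z p * e p i *
     ((/ h) ^ m * Derive_n (beta i) m (/ h * y + - c / h)))))
    by (intros; rewrite <- ssum_scal; apply ssum_ext; intros; ring).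
  rewrite ssum_exchange. apply ssum_ext. intros i Hi. rewrite (H i Hi), Rmult_comm, <- ssum_scal.
  apply ssum_ext; intros; ring.
Qed.

Definition kron (p q : nat) : R := if Nat.eqb p q then 1 else 0.

Lemma ssum_kron n z q : (1 <= q <= n)%nat -> z q = ssum n (fun p => z p * kron p q).
Proof.
  intros Hq. rewrite <- (ssum_delta n z q Hq). apply ssum_ext. intros p Hp.
  unfold kron. destruct (Nat.eqb p q); ring.
Qed.

Lemma correction_linear {a b} (M : mesh a b) k beta v j m y : (1 <= j <= ncells M)%nat ->
  correction M k beta v j m y
  = ssum (ncells M) (fun p => v p * correction M k beta (kron p) j m y).
Proof.
  intros Hj. apply comb_combination. intros i Hi. unfold edge_dofs.
  destruct (Nat.eqb i k); [|destruct (Nat.eqb i (k + 1))].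
  - rewrite (ssum_kron (ncells M) v (pr M j)) by now apply pr_range.
    rewrite <- ssum_opp. apply ssum_ext; intros; ring.
  - now apply ssum_kron.
  - symmetry. apply ssum_eq0; intros; ring.
Qed.

Lemma correction_av_linear {a b} (M : mesh a b) k beta v j : (1 <= j <= ncells M)%nat ->
  av M (correction M k beta v) 1 j
  = ssum (ncells M) (fun p => av M (correction M k beta (kron p)) 1 j * v p).
Proof.
  intros Hj. unfold av, tm, tp.
  rewrite (correction_linear M k beta v j) by exact Hj.
  rewrite (correction_linear M k beta v (nx M j)) by now apply nx_range.
  rewrite <- ssum_plus. unfold Rdiv. rewrite Rmult_comm, <- ssum_scal.
  apply ssum_ext; intros; ring.
Qed.

(** A correction with zero slope averages has zero energy, hence zero derivative; with zero mean it
    vanishes, and so do its end values. The square interface system is therefore injective, and [B]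
    is its inverse, independent of the data [g]. *)
Lemma correction_solvable {a b} (M : mesh a b) k beta K : (2 <= k)%nat -> dual_basis k beta K ->
  exists B : nat -> nat -> R, forall g j, (1 <= j <= ncells M)%nat ->
    av M (correction M k beta (fun p => ssum (ncells M) (fun l => B p l * g l))) 1 j = g j.
Proof.
  intros Hk Hb.
  destruct (injective_inverse (ncells M) (fun j p => av M (correction M k beta (kron p)) 1 j))
    as [B HB].
  - intros v Hv j Hj.
    assert (E := correction_energy M k beta K v Hk Hb).
    rewrite (ssum_eq0 (ncells M)) in E
      by (intros i Hi; rewrite correction_av_linear, Hv by exact Hi; ring).
    rewrite Rmult_0_r in E.
    assert (Z : L2norm (node M (j - 1)) (node M j) (correction M k beta v j 1) = 0).
    { unfold L2norm, inner. rewrite <- sqrt_0. f_equal. revert j Hj. apply ssum_zero_term; [|exact E].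
      intros i Hi. apply RInt_sq_ge0; [now apply cell_le|].
      apply bjet_cont, (cellcomb_poly M k beta K _ Hb). }
    destruct (correction_trace M k beta K v j Hk Hb Hj) as [<- _]. unfold tm.
    generalize (correction_value_bound M k beta K v j (node M j) Hk Hb Hj
      (conj (cell_le M j Hj) (Rle_refl _))).
    rewrite Z, Rmult_0_r. intros H. apply Rabs_le_between in H. lra.
  - exists B. intros g j Hj. rewrite correction_av_linear by exact Hj.
    rewrite (ssum_ext _ _ (fun p => ssum (ncells M) (fun l =>
       g l * (av M (correction M k beta (kron p)) 1 j * B p l))))
      by (intros; rewrite <- ssum_scal; apply ssum_ext; intros; ring).
    rewrite ssum_exchange.
    rewrite (ssum_ext _ _ (fun l => if Nat.eqb l j then g l else 0)); [now apply ssum_delta|].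
    intros l Hl. rewrite ssum_scal, HB, (Nat.eqb_sym j l) by exact Hj. destruct (Nat.eqb l j); ring.
Qed.

(* With {e_x} prescribed by the interpolation defect, the matching trace bounds on each side of an
   interface make all powers of the local mesh size combine without any mesh-ratio assumption. *)
Lemma correction_estimate {a b} (M : mesh a b) k beta K v W : (2 <= k)%nat -> dual_basis k beta K ->
  jet W ->
  (forall j, (1 <= j <= ncells M)%nat ->
     av M (correction M k beta v) 1 j = - av M (interp_defect M k beta W) 1 j) ->
  bnorm M (fun j => correction M k beta v j 1%nat)
  <= 2 * (1 + INR (k + 1) * K) * hmax M ^ k * L2norm a b (W (k + 1)%nat).
Proof.
  intros Hk Hb HW Hav.
  set (E := correction M k beta v) in *. set (C := 1 + INR (k + 1) * K).
  assert (HC : 0 <= C).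
  { unfold C. generalize (pos_INR (k + 1)) (proj1 Hb). nra. }
  assert (HE : bjet E) by apply (cellcomb_poly M k beta K _ Hb).
  set (G := fun j => L2norm (node M (j - 1)) (node M j) (W (k + 1)%nat)).
  set (D := fun j => L2norm (node M (j - 1)) (node M j) (E j 1%nat)).
  assert (HG : forall j, 0 <= G j) by (intros; apply L2norm_nonneg).
  assert (HD : forall j, 0 <= D j) by (intros; apply L2norm_nonneg).
  (* The slope defect supplies h^(k-1) sqrt(h) and the end value of the correction another sqrt(h),
     all with the size of the same cell: together h^k. *)
  set (X := fun j => C * (hcell M j ^ k * (G j * D j))).
  assert (HX : forall j y z, (1 <= j <= ncells M)%nat -> node M (j - 1) <= y <= node M j ->
     Rabs z <= sqrt (hcell M j) * D j ->
     Rabs (interp_defect M k beta W j 1 y * z) <= X j).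
  { intros j y z Hj Hy Hz. rewrite Rabs_mult.
    destruct (interp_defect_bound M k beta K W j y Hk Hb HW Hj Hy) as [_ B]. fold C in B. fold (G j) in B.
    assert (Hh := hcell_pos M j Hj).
    replace (X j) with (C * (hcell M j ^ (k - 1) * (sqrt (hcell M j) * G j)) * (sqrt (hcell M j) * D j)).
    - apply Rmult_le_compat; auto using Rabs_pos.
    - unfold X. replace k with (S (k - 1)) at 2 by lia. simpl pow.
      rewrite <- (sqrt_sqrt (hcell M j)) at 4 by lra. ring. }
  assert (Sq : bnorm M (fun j => E j 1%nat) * bnorm M (fun j => E j 1%nat)
     <= 2 * C * hmax M ^ k * L2norm a b (W (k + 1)%nat) * bnorm M (fun j => E j 1%nat)).
  { rewrite bnorm_sq by auto with cont. unfold E at 1 2.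
    rewrite (correction_energy M k beta K) by assumption. fold E.
    rewrite <- ssum_scal.
    apply Rle_trans with (ssum (ncells M) (fun j => X j + X (nx M j))).
    - apply ssum_le. intros j Hj. rewrite (Hav j Hj).
      destruct (correction_trace M k beta K v j Hk Hb Hj) as [Tm Tp]. fold E in Tm, Tp.
      assert (Hn := nx_range M j Hj).
      assert (H1 := HX j (node M j) (v j) Hj (conj (cell_le M j Hj) (Rle_refl _))).
      assert (H2 := HX (nx M j) (node M (nx M j - 1)) (v j) Hn
         (conj (Rle_refl _) (cell_le M _ Hn))).
      rewrite <- Tm in H1 at 1. specialize (H1 (correction_value_bound M k beta K v j _ Hk Hb Hj
         (conj (cell_le M j Hj) (Rle_refl _)))).
      replace (Rabs (v j)) with (Rabs (tp M E 0 j)) in H2 by (rewrite Tp; apply Rabs_Ropp).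
      specialize (H2 (correction_value_bound M k beta K v (nx M j) _ Hk Hb Hn
         (conj (Rle_refl _) (cell_le M _ Hn)))).
      unfold av, tm, tp. apply Rabs_le_between in H1, H2. lra.
    - rewrite ssum_plus, ssum_nx. unfold X. rewrite ssum_scal.
      assert (H1 : ssum (ncells M) (fun j => hcell M j ^ k * (G j * D j))
         <= hmax M ^ k * ssum (ncells M) (fun j => G j * D j)).
      { rewrite <- ssum_scal. apply ssum_le. intros j Hj.
        apply Rmult_le_compat_r; [now apply Rmult_le_pos|]. apply pow_incr.
        split; [left; now apply hcell_pos|now apply hcell_le_hmax]. }
      assert (H2 := Rle_trans _ _ _ (Rle_abs _) (ssum_CS (ncells M) G D)).
      assert (NG : bnorm M (fun _ => W (k + 1)%nat) = sqrt (ssum (ncells M) (fun j => G j * G j)))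
        by (apply bnorm_cells; auto with cont).
      assert (ND : bnorm M (fun j => E j 1%nat) = sqrt (ssum (ncells M) (fun j => D j * D j)))
        by (apply bnorm_cells; auto with cont).
      rewrite <- NG, <- ND, bnorm_global in H2 by auto with cont.
      assert (0 <= hmax M ^ k) by (apply pow_le; left; apply hmax_pos).
      apply Rle_trans with (2 * C * (hmax M ^ k * ssum (ncells M) (fun j => G j * D j))); [nra|].
      replace (2 * C * hmax M ^ k * L2norm a b (W (k + 1)%nat) * bnorm M (fun j => E j 1%nat))
        with (2 * C * (hmax M ^ k * (L2norm a b (W (k + 1)%nat) * bnorm M (fun j => E j 1%nat)))) by ring.
      apply Rmult_le_compat_l; [lra|]. now apply Rmult_le_compat_l. }
  (* The bound is quadratic in the norm on the left and linear on the right; the norm cancels unless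
     it is zero. *)
  destruct (Rle_lt_or_eq_dec _ _ (bnorm_nonneg M (fun j => E j 1%nat))) as [Hpos|<-].
  - now apply Rmult_le_reg_r in Sq.
  - assert (0 <= hmax M ^ k) by (apply pow_le; left; apply hmax_pos).
    repeat apply Rmult_le_pos; try lra. apply L2norm_nonneg.
Qed.

Lemma time_linear_dof {a b} (M : mesh a b) k j i : time_linear (fun W => interp_dofs M k W j i).
Proof.
  unfold interp_dofs, dof, cell_pull, pull. destruct (Nat.ltb i k); [|destruct (Nat.eqb i k)].
  - apply time_linear_integral. auto with cont.
  - apply time_linear_eval.
  - apply time_linear_eval.
Qed.

Lemma time_linear_comb k beta c h (d : (nat -> R -> R) -> nat -> R) m y :
  (forall i, time_linear (fun W => d W i)) -> time_linear (fun W => comb k beta c h (d W) m y).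
Proof.
  intros H. unfold comb.
  apply (time_linear_ssum (k + 1) (fun i W =>
    d W i * ((/ h) ^ m * Derive_n (beta i) m (/ h * y + - c / h)))).
  intros i _.
  apply (time_linear_ext (fun W => ((/ h) ^ m * Derive_n (beta i) m (/ h * y + - c / h)) * d W i));
    [intros; ring|]. now apply time_linear_scal.
Qed.

Lemma approx_operator_ge2 (k : nat) : (2 <= k)%nat -> exists C, 0 < C /\
  forall a b (M : mesh a b), exists P, approx_operator M k (C * hmax M ^ (k + 1)) P.
Proof.
  intros Hk. destruct (dof_basis_bounded k Hk) as [beta [K Hb]].
  change (dual_basis k beta K) in Hb.
  set (C := 1 + INR (k + 1) * K).
  assert (HC1 : 1 <= C).
  { unfold C. generalize (pos_INR (k + 1)) (proj1 Hb). nra. }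
  assert (HC : 0 <= C) by lra.
  (* One C for the interpolation defect and two for the correction, whose bound 2 C h^k |W|_{k+1} on
     the derivative gains a factor h by the Poincare inequality. *)
  exists (3 * C). split; [lra|]. intros a b M.
  assert (Hmax := hmax_pos M).
  destruct (correction_solvable M k beta K Hk Hb) as [B HB].
  (* The correction must cancel the slope average of the interpolation defect; [v] holds the
     interface values solving that system. *)
  set (g := fun W l => - av M (interp_defect M k beta W) 1 l).
  set (v := fun W p => ssum (ncells M) (fun l => B p l * g W l)).
  set (d := fun W j i => interp_dofs M k W j i + edge_dofs M k (v W) j i).
  assert (Split : forall W j m x, cellcomb M k beta (d W) j m x - W m x
     = interp_defect M k beta W j m x + correction M k beta (v W) j m x).
  { intros W j m x. unfold interp_defect, correction, cellcomb.
    rewrite (comb_plus k beta _ _ (interp_dofs M k W j) (edge_dofs M k (v W) j)). ring. }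
  assert (HE : forall W, bjet (correction M k beta (v W)))
    by (intros; apply (cellcomb_poly M k beta K _ Hb)).
  exists (fun W => cellcomb M k beta (d W)). split; [|split; [|split]].
  - intros W HW. apply (cellcomb_poly M k beta K _ Hb).
  - intros W HW.
    assert (HD := interp_defect_jet M k beta K W Hb HW).
    rewrite (bnorm_ext M _ (fun j x => interp_defect M k beta W j 0%nat x
       + correction M k beta (v W) j 0%nat x)) by (intros; apply Split).
    eapply Rle_trans; [apply bnorm_triangle; auto with cont|].
    assert (H1 : bnorm M (fun j => interp_defect M k beta W j 0%nat)
       <= C * hmax M ^ (k + 1) * L2norm a b (W (k + 1)%nat)).
    { rewrite <- (bnorm_global M (W (k + 1)%nat)), (bnorm_cells M (fun _ => W (k + 1)%nat))
        by auto with cont.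
      assert (Hp : 0 <= hmax M ^ (k + 1)) by (apply pow_le; lra).
      apply bnorm_le_cells; [auto with cont|now apply Rmult_le_pos|].
      intros j Hj. assert (Hh := hcell_pos M j Hj). assert (Hh2 := hcell_le_hmax M j Hj).
      set (G := L2norm (node M (j - 1)) (node M j) (W (k + 1)%nat)).
      assert (HG : 0 <= G) by apply L2norm_nonneg.
      eapply Rle_trans.
      - apply (L2norm_le_sup _ _ _ (C * (hcell M j ^ k * (sqrt (hcell M j) * G)))).
        + now apply cell_le.
        + auto with cont.
        + repeat apply Rmult_le_pos; auto; [apply pow_le; lra|apply sqrt_pos].
        + intros x Hx. now apply interp_defect_bound.
      - change (node M j - node M (j - 1)) with (hcell M j).
        replace (sqrt (hcell M j) * (C * (hcell M j ^ k * (sqrt (hcell M j) * G))))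
          with (C * (hcell M j ^ (k + 1) * G)).
        + rewrite Rmult_assoc. apply Rmult_le_compat_l; [exact HC|].
          apply Rmult_le_compat_r; [exact HG|]. apply pow_incr; lra.
        + rewrite Nat.add_1_r. simpl pow. rewrite <- (sqrt_sqrt (hcell M j)) at 1 by lra. ring. }
    assert (H2 : bnorm M (fun j => correction M k beta (v W) j 0%nat)
       <= hmax M * bnorm M (fun j => correction M k beta (v W) j 1%nat)).
    { rewrite (bnorm_cells M (fun j => correction M k beta (v W) j 1%nat)) by auto with cont.
      apply bnorm_le_cells; [auto with cont|lra|].
      intros j Hj. eapply Rle_trans.
      - apply (poincare _ _ _ (correction M k beta (v W) j 1%nat)).
        + now apply node_incr.
        + apply HE.
        + auto with cont.
        + now apply (correction_mean M k beta K).
      - apply Rmult_le_compat_r; [apply L2norm_nonneg|]. now apply hcell_le_hmax. }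
    assert (H3 := correction_estimate M k beta K (v W) W Hk Hb HW (HB (g W))). fold C in H3.
    apply (Rmult_le_compat_l (hmax M)) in H3; [|lra].
    replace (hmax M ^ (k + 1)) with (hmax M * hmax M ^ k) in * by (rewrite Nat.add_1_r; reflexivity).
    eapply Rle_trans; [exact (Rplus_le_compat _ _ _ _ H1 (Rle_trans _ _ _ H2 H3))|]. right; ring.
  - intros W V HW HP HV.
    assert (HD := interp_defect_jet M k beta K W Hb HW).
    assert (HS : bjet (fun j m x => cellcomb M k beta (d W) j m x - W m x)).
    { intros j. apply (jet_minus (cellcomb M k beta (d W) j) W); [|exact HW].
      apply (cellcomb_poly M k beta K _ Hb). }
    rewrite Bf_parts by (exact HS || apply HV).
    (* The error is orthogonal to V_xx by its moments. At the interfaces its value average vanishes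
       because interpolation is exact there and the correction has opposite values; its slope
       average vanishes by the choice of [v]. Every term of the form is then zero. *)
    assert (Z : bin M (fun j x => cellcomb M k beta (d W) j 0 x - W 0%nat x) (fun j => V j 2%nat) = 0).
    { apply (bin_moments M k (fun j x => cellcomb M k beta (d W) j 0 x - W 0%nat x) V Hk);
        [exact (bjet_cont _ 0 HS)|exact HV|].
      intros j i Hj Hi.
      rewrite (dof_ext k i _ (fun x => cell_pull M j (interp_defect M k beta W j 0) x
         + cell_pull M j (correction M k beta (v W) j 0) x)) by (intros; apply Split).
      rewrite dof_plus by (apply cont_pull; auto with cont).
      rewrite (interp_defect_dof M k beta K), (correction_dof M k beta K) by (auto; lia). ring. }
    rewrite Z, ssum_eq0.
    + rewrite Ropp_0, Rplus_0_l, Rabs_R0.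
      repeat apply Rmult_le_pos; try apply L2norm_nonneg; try apply bnorm_nonneg; try lra.
      apply pow_le; lra.
    + intros j Hj.
      destruct (interp_defect_trace M k beta K W j Hk Hb HW Hj) as [Z1 Z2].
      destruct (correction_trace M k beta K (v W) j Hk Hb Hj) as [Tm Tp].
      assert (A1 := HB (g W) j Hj). change (fun p => ssum _ _) with (v W) in A1.
      unfold g, av, tm, tp in A1. unfold tm, tp in Z1, Z2, Tm, Tp.
      unfold av, tm, tp. rewrite !Split, Z1, Z2, Tm, Tp.
      replace ((interp_defect M k beta W j 1 (node M j) + correction M k beta (v W) j 1 (node M j) +
         (interp_defect M k beta W (nx M j) 1 (node M (nx M j - 1)) +
          correction M k beta (v W) (nx M j) 1 (node M (nx M j - 1)))) / 2) with 0 by lra.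
      field.
  - intros j y. apply time_linear_comb. intros i.
    apply (time_linear_plus (fun W => interp_dofs M k W j i) (fun W => edge_dofs M k (v W) j i));
      [apply time_linear_dof|].
    assert (Tg : forall l, time_linear (fun W => g W l)).
    { intros l.
      assert (Ti : forall i m x, time_linear (fun W => interp_defect M k beta W i m x)).
      { intros i' m x. apply (time_linear_minus (fun W => cellcomb M k beta (interp_dofs M k W) i' m x)
          (fun W => W m x)); [|apply time_linear_eval].
        apply (time_linear_comb k beta _ _ (fun W => interp_dofs M k W i')). intros; apply time_linear_dof. }
      apply (time_linear_ext (fun W => - / 2 * (interp_defect M k beta W l 1 (node M l)
          + interp_defect M k beta W (nx M l) 1 (node M (nx M l - 1))))).
      - intros W. unfold g, av, tm, tp. field.
      - apply time_linear_scal, time_linear_plus; apply Ti. }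
    assert (Tv : forall p, time_linear (fun W => v W p)).
    { intros p. apply (time_linear_ssum (ncells M) (fun l W => B p l * g W l)).
      intros l _. apply time_linear_scal, Tg. }
    unfold edge_dofs. destruct (Nat.eqb i k); [|destruct (Nat.eqb i (k + 1))].
    + apply (time_linear_ext (fun W => -1 * v W (pr M j))); [intros; ring|].
      apply time_linear_scal, Tv.
    + apply Tv.
    + apply time_linear_zero.
Qed.

(** * Piecewise linear functions on uniform meshes *)

(* Midpoint value and slope of the local approximation. They are chosen so that on two adjacent cells
   of equal size the averages of value and slope at the common node are exact for cubics. *)
Definition lin_value (c h : R) (W : nat -> R -> R) : R :=
  W 0%nat (c + h / 2) + h / 8 * (W 1%nat (c + h) - W 1%nat c).
Definition lin_slope (c h : R) (W : nat -> R -> R) : R :=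
  2 * W 1%nat (c + h / 2) - / 2 * (W 1%nat (c + h) + W 1%nat c).

Definition lin_jet (c h : R) (W : nat -> R -> R) (m : nat) (y : R) : R :=
  match m with
  | 0%nat => lin_value c h W + lin_slope c h W * (y - (c + h / 2))
  | 1%nat => lin_slope c h W
  | _ => 0
  end.

Lemma lin_jet_jet c h W : jet (lin_jet c h W).
Proof.
  intros [|[|m]] x; simpl.
  - unfold lin_jet. generalize (lin_value c h W) (lin_slope c h W). intros p q.
    auto_derive; [exact I|ring].
  - apply (is_derive_const (K:=R_AbsRing) (V:=R_NormedModule) (lin_slope c h W)).
  - apply (is_derive_const (K:=R_AbsRing) (V:=R_NormedModule) 0).
Qed.

Lemma lin_jet_poly c h W : is_poly 1 (lin_jet c h W 0).
Proof.
  exists (fun i => match i with 0%nat => lin_value c h W - lin_slope c h W * (c + h / 2)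
    | _ => lin_slope c h W end). intros y. simpl. ring.
Qed.

Lemma is_poly_3_form T : is_poly 3 T -> exists t0 t1 t2 t3,
  (forall y, T y = t0 + t1 * y + t2 * (y * y) + t3 * (y * y * y)) /\
  (forall y, Derive T y = t1 + 2 * t2 * y + 3 * t3 * (y * y)).
Proof.
  intros [c Hc]. exists (c 0%nat), (c 1%nat), (c 2%nat), (c 3%nat).
  assert (E : forall y, T y = c 0%nat + c 1%nat * y + c 2%nat * (y * y) + c 3%nat * (y * y * y))
    by (intros; rewrite Hc; simpl; ring).
  split; [exact E|]. intros y. rewrite (Derive_ext _ _ y E). apply is_derive_unique.
  auto_derive; [easy|ring].
Qed.

Lemma lin_jet_error c h W y : jet W -> 0 < h -> c <= y <= c + h ->
  Rabs (lin_jet c h W 0 y - W 0%nat y) <= 4 * (h * (sqrt h * L2norm c (c + h) (W 2%nat))).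
Proof.
  intros HW Hh Hy. destruct (taylor1 0 W c h HW Hh) as [T [HT BT]].
  set (g := sqrt h * L2norm c (c + h) (W 2%nat)) in *.
  assert (ET : forall y, T y = T 0 + Derive T 0 * y).
  { destruct HT as [e He]. assert (E : forall y, T y = e 0%nat + e 1%nat * y)
      by (intros; rewrite He; simpl; ring).
    intros z. rewrite !E. rewrite (Derive_ext _ _ 0 E).
    replace (Derive _ 0) with (e 1%nat); [ring|].
    symmetry. apply is_derive_unique. auto_derive; [easy|ring]. }
  assert (ED : forall y, Derive T y = Derive T 0).
  { intros z. rewrite (Derive_ext _ _ z ET). apply is_derive_unique. auto_derive; [easy|ring]. }
  assert (B : forall z, c <= z <= c + h -> - (h * g) <= W 0%nat z - T z <= h * g /\
      - g <= W 1%nat z - Derive T 0 <= g).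
  { intros z Hz. destruct (BT z Hz) as [B0 B1]. simpl pow in B0, B1.
    rewrite ED in B1. rewrite Rmult_1_r in B0. rewrite Rmult_1_l in B1.
    split; now apply Rabs_le_between. }
  destruct (B (c + h / 2) ltac:(lra)) as [B1 B2]. destruct (B c ltac:(lra)) as [_ B3].
  destruct (B (c + h) ltac:(lra)) as [_ B4]. destruct (B y Hy) as [B5 _].
  assert (Hg : 0 <= g) by (apply Rmult_le_pos; [apply sqrt_pos|apply L2norm_nonneg]).
  set (s := lin_slope c h W).
  assert (Hs : - (3 * g) <= s - Derive T 0 <= 3 * g) by (unfold s, lin_slope; lra).
  apply Rabs_le. simpl. fold s. unfold lin_value.
  rewrite (ET (c + h / 2)) in B1. rewrite (ET y) in B5.
  set (e := s - Derive T 0) in *.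
  replace (s * (y - (c + h / 2))) with (Derive T 0 * (y - (c + h / 2)) + e * (y - (c + h / 2)))
    by (unfold e; ring).
  assert (He : - (3 * g * (h / 2)) <= e * (y - (c + h / 2)) <= 3 * g * (h / 2)).
  { apply Rabs_le_between. rewrite Rabs_mult.
    apply Rmult_le_compat; try apply Rabs_pos; apply Rabs_le; lra. }
  set (f := W 1%nat (c + h) - W 1%nat c).
  assert (Hf : - (2 * g) <= f <= 2 * g) by (unfold f; lra).
  assert (Hf' : - (h / 8 * (2 * g)) <= h / 8 * f <= h / 8 * (2 * g)) by (split; nra).
  (* With g bounding the slope remainder and h g the value remainder, the contributions are hg at
     the midpoint, hg/4 from the difference of end slopes, 3hg/2 from the slope error and hg at y;
     they add up to less than 4hg. *)
  split; nra.
Qed.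

(** Exactness for cubics lets a cubic Taylor polynomial on the double cell [c, c+2h] be subtracted.
    Its remainders are at most 8 h^3 g for values and 4 h^2 g for slopes, and adding them with the
    weights of the formulas gives 21.5 h^3 g, rounded up to 23, and 16 h^2 g. *)
Lemma lin_jet_interface c h W : jet W -> 0 < h ->
  Rabs ((lin_value c h W + lin_slope c h W * (h / 2)
     + (lin_value (c + h) h W - lin_slope (c + h) h W * (h / 2))) / 2 - W 0%nat (c + h))
   <= 23 * (h * h * h * (sqrt (2 * h) * L2norm c (c + 2 * h) (W 4%nat))) /\
  Rabs ((lin_slope c h W + lin_slope (c + h) h W) / 2 - W 1%nat (c + h))
   <= 16 * (h * h * (sqrt (2 * h) * L2norm c (c + 2 * h) (W 4%nat))).
Proof.
  intros HW Hh. destruct (taylor1 2 W c (2 * h) HW ltac:(lra)) as [T [HT BT]].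
  set (g := sqrt (2 * h) * L2norm c (c + 2 * h) (W 4%nat)) in *.
  assert (Hg : 0 <= g) by (apply Rmult_le_pos; [apply sqrt_pos|apply L2norm_nonneg]).
  destruct (is_poly_3_form T HT) as [t0 [t1 [t2 [t3 [ET ED]]]]].
  set (r0 := fun y => W 0%nat y - T y). set (r1 := fun y => W 1%nat y - Derive T y).
  assert (E0 : forall y, W 0%nat y = t0 + t1 * y + t2 * (y * y) + t3 * (y * y * y) + r0 y)
    by (intros; unfold r0; rewrite ET; ring).
  assert (E1 : forall y, W 1%nat y = t1 + 2 * t2 * y + 3 * t3 * (y * y) + r1 y)
    by (intros; unfold r1; rewrite ED; ring).
  set (q0 := h * h * h * g). set (q1 := h * h * g).
  assert (B : forall z, c <= z <= c + 2 * h -> - (8 * q0) <= r0 z <= 8 * q0 /\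
      - (4 * q1) <= r1 z <= 4 * q1).
  { intros z Hz. destruct (BT z Hz) as [B0 B1].
    replace ((2 * h) ^ 3 * g) with (8 * q0) in B0 by (unfold q0; simpl; ring).
    replace ((2 * h) ^ 2 * g) with (4 * q1) in B1 by (unfold q1; simpl; ring).
    split; now apply Rabs_le_between. }
  assert (Hq : forall e, - (4 * q1) <= e <= 4 * q1 -> - (4 * q0) <= h * e <= 4 * q0).
  { intros e [He1 He2]. replace q0 with (h * q1) by (unfold q0, q1; ring). split; nra. }
  unfold lin_value, lin_slope. rewrite !E0, !E1.
  destruct (B c ltac:(lra)) as [_ A1]. destruct (B (c + h / 2) ltac:(lra)) as [A2 A3].
  destruct (B (c + h) ltac:(lra)) as [A4 A5]. destruct (B (c + h + h / 2) ltac:(lra)) as [A6 A7].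
  destruct (B (c + h + h) ltac:(lra)) as [_ A8].
  assert (D1 := Hq _ A1). assert (D3 := Hq _ A3). assert (D5 := Hq _ A5).
  assert (D7 := Hq _ A7). assert (D8 := Hq _ A8).
  split; apply Rabs_le; fold q0 q1.
  - match goal with |- _ <= ?X <= _ => replace X with
      ((r0 (c + h / 2) + r0 (c + h + h / 2)) / 2 - r0 (c + h)
       + / 16 * (h * r1 (c + h + h) - h * r1 c)
       + (h * r1 (c + h / 2) - h * r1 (c + h + h / 2)) / 2
       - / 8 * (h * r1 c - h * r1 (c + h + h))) by field end.
    lra.
  - match goal with |- _ <= ?X <= _ => replace X with
      (r1 (c + h / 2) + r1 (c + h + h / 2) - / 4 * (r1 c + 2 * r1 (c + h) + r1 (c + h + h))
       - r1 (c + h)) by field end.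
    lra.
Qed.

(** Inverse estimates read off from the exact norm: with midpoint value v and slope s, its square is
    h v^2 + h^3 s^2 / 12. Hence 4 as a bound for sqrt 12, and 3 = 1 + 4/2 for the end values. *)
Lemma affine_bounds c h V : 0 < h -> jet V -> is_poly 1 (V 0%nat) ->
  (forall x, V 2%nat x = 0) /\
  (forall x, h * sqrt h * Rabs (V 1%nat x) <= 4 * L2norm c (c + h) (V 0%nat)) /\
  sqrt h * Rabs (V 0%nat c) <= 3 * L2norm c (c + h) (V 0%nat) /\
  sqrt h * Rabs (V 0%nat (c + h)) <= 3 * L2norm c (c + h) (V 0%nat).
Proof.
  intros Hh HV [e He].
  set (s := e 1%nat). set (v := e 0%nat + s * (c + h / 2)).
  assert (E0 : forall y, V 0%nat y = v + s * (y - (c + h / 2)))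
    by (intros; rewrite He; unfold v, s; simpl; ring).
  assert (E1 : forall y, V 1%nat y = s).
  { intros y. rewrite <- (jet_Derive V HV), (Derive_ext _ _ y E0). apply is_derive_unique.
    auto_derive; [easy|ring]. }
  assert (N : RInt (fun y => V 0%nat y * V 0%nat y) c (c + h) = h * (v * v) + h * h * h / 12 * (s * s)).
  { rewrite (RInt_extR _ _ _ (fun y => (v + s * (y - (c + h / 2))) * (v + s * (y - (c + h / 2)))))
      by (intros; now rewrite E0).
    rewrite (RInt_deriv c (c + h) (fun y => v * v * (y - (c + h / 2))
       + v * s * ((y - (c + h / 2)) * (y - (c + h / 2)))
       + s * s / 3 * ((y - (c + h / 2)) * (y - (c + h / 2)) * (y - (c + h / 2))))).
    - as_real. field.
    - intros x. auto_derive; [easy|field].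
    - auto 10 with cont. }
  set (D := L2norm c (c + h) (V 0%nat)).
  assert (HD : 0 <= D) by apply L2norm_nonneg.
  assert (SD : D * D = h * (v * v) + h * h * h / 12 * (s * s)).
  { unfold D. rewrite L2norm_sq by (lra || auto with cont). exact N. }
  assert (Sq : sqrt h * sqrt h = h) by (apply sqrt_sqrt; lra).
  assert (Sp := sqrt_pos h).
  assert (Hs : h * sqrt h * Rabs s <= 4 * D).
  { apply Rsqr_incr_0; [|repeat apply Rmult_le_pos; try apply Rabs_pos; lra|lra].
    unfold Rsqr.
    replace (h * sqrt h * Rabs s * (h * sqrt h * Rabs s))
      with (h * h * (sqrt h * sqrt h) * (Rabs s * Rabs s)) by ring.
    rewrite Sq, <- Rabs_mult, (Rabs_right (s * s)) by nra.
    assert (0 <= h * (v * v)) by (apply Rmult_le_pos; [lra|apply Rle_0_sqr]).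
    assert (0 <= h * h * h * (s * s)) by (apply Rmult_le_pos; [repeat apply Rmult_le_pos; lra|apply Rle_0_sqr]).
    nra. }
  assert (Hv : sqrt h * Rabs v <= D).
  { apply Rsqr_incr_0; [|repeat apply Rmult_le_pos; try apply Rabs_pos; lra|lra].
    unfold Rsqr.
    replace (sqrt h * Rabs v * (sqrt h * Rabs v))
      with ((sqrt h * sqrt h) * (Rabs v * Rabs v)) by ring.
    rewrite Sq, <- Rabs_mult, (Rabs_right (v * v)) by nra.
    assert (0 <= h * h * h * (s * s)) by (apply Rmult_le_pos; [repeat apply Rmult_le_pos; lra|apply Rle_0_sqr]).
    nra. }
  assert (Hend : forall d, Rabs d = h / 2 -> sqrt h * Rabs (v + s * d) <= 3 * D).
  { intros d Hd. apply Rle_trans with (sqrt h * (Rabs v + Rabs s * (h / 2))).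
    - apply Rmult_le_compat_l; [exact Sp|]. rewrite <- Hd, <- Rabs_mult. apply Rabs_triang.
    - nra. }
  split; [|split; [|split]].
  - intros x. rewrite <- (jet_Derive V HV). rewrite (Derive_ext _ _ x E1). apply Derive_const.
  - intros x. now rewrite E1.
  - rewrite E0. apply Hend. replace (c - (c + h / 2)) with (- (h / 2)) by field.
    rewrite Rabs_Ropp. apply Rabs_right. lra.
  - rewrite E0. apply Hend. replace (c + h - (c + h / 2)) with (h / 2) by field.
    apply Rabs_right. lra.
Qed.

Lemma RInt_shift f c d s : cont f -> RInt (fun x => f (x + s)) c d = RInt f (c + s) (d + s).
Proof.
  intros Cf. generalize (RInt_comp_lin (V:=R_CompleteNormedModule) f 1 s c d (cont_ex_RInt _ _ _ Cf)).
  rewrite !Rmult_1_l. intros <-. apply RInt_extR. intros x.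
  unfold scal; simpl; unfold mult; simpl. now rewrite !Rmult_1_l.
Qed.

Lemma node_nx {a b} (M : mesh a b) j : (1 <= j <= ncells M)%nat ->
  node M (nx M j - 1) = node M j \/ node M (nx M j - 1) + (b - a) = node M j.
Proof.
  intros Hj. unfold nx. destruct (Nat.eqb_spec j (ncells M)) as [->|].
  - right. simpl. rewrite node_first, node_last. ring.
  - left. f_equal; lia.
Qed.

Lemma periodic_nx {a b} (M : mesh a b) W m j s : periodic_jet a b W -> (1 <= j <= ncells M)%nat ->
  W m (node M (nx M j - 1) + s) = W m (node M j + s).
Proof.
  intros HP Hj. destruct (node_nx M j Hj) as [->|<-]; [reflexivity|].
  rewrite <- HP. f_equal; ring.
Qed.

Lemma approx_operator_1 : exists C, 0 < C /\
  forall a b (M : mesh a b), uniform_mesh M ->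
    exists P, approx_operator M 1 (C * hmax M ^ (1 + 1)) P.
Proof.
  (* 840 = 280 * 3. The number 280 is 2 (16 * 3 + 23 * 4), from the interface errors, the inverse
     estimates and sqrt(2h) <= 2 sqrt(h); the 3 bounds sqrt 8, which arises because two neighbouring
     cells enter each interface term. *)
  exists 840. split; [lra|]. intros a b M HU.
  set (h := (b - a) / INR (ncells M)) in *.
  assert (HN := ncells_pos a b M).
  assert (Hcell : forall j, (1 <= j <= ncells M)%nat -> hcell M j = h) by exact HU.
  clearbody h.
  assert (Hh : 0 < h) by (rewrite <- (Hcell 1%nat) by lia; apply hcell_pos; lia).
  assert (Hhm : h <= hmax M) by (rewrite <- (Hcell 1%nat) by lia; apply hcell_le_hmax; lia).
  assert (Hnode : forall j, (1 <= j <= ncells M)%nat -> node M j = node M (j - 1) + h).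
  { intros j Hj. rewrite <- (Hcell j Hj). unfold hcell. ring. }
  assert (Hh2 : h * h <= hmax M ^ (1 + 1)) by (simpl; nra).
  set (P := fun W j => lin_jet (node M (j - 1)) h W).
  assert (PP : forall W, poly_jet_broken 1 (P W)).
  { intros W. split; intros j; [apply lin_jet_jet|apply lin_jet_poly]. }
  exists P. split; [|split; [|split]].
  - intros W _. apply PP.
  - intros W HW. set (W2 := W (1 + 1)%nat).
    assert (C2 : cont W2) by exact (jet_cont W HW _).
    rewrite <- (bnorm_global M W2), (bnorm_cells M (fun _ => W2)) by auto.
    assert (CP : forall j, cont (fun x => P W j 0%nat x - W 0%nat x)).
    { intros j. apply cont_minus; [apply (bjet_cont (P W) 0 (proj1 (PP W)))|exact (jet_cont W HW _)]. }
    apply bnorm_le_cells; [exact CP|nra|].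
    intros j Hj. set (G := L2norm (node M (j - 1)) (node M j) W2).
    assert (HG : 0 <= G) by apply L2norm_nonneg.
    eapply Rle_trans.
    + apply (L2norm_le_sup _ _ _ (4 * (h * (sqrt h * G)))).
      * now apply cell_le.
      * apply CP.
      * repeat apply Rmult_le_pos; try lra; try apply sqrt_pos; exact HG.
      * intros x Hx. unfold G. rewrite (Hnode j Hj) in *. now apply lin_jet_error.
    + change (node M j - node M (j - 1)) with (hcell M j). rewrite (Hcell j Hj).
      replace (sqrt h * (4 * (h * (sqrt h * G)))) with (4 * (h * (sqrt h * sqrt h)) * G) by ring.
      rewrite sqrt_sqrt by lra. apply Rmult_le_compat_r; [exact HG|]. nra.
  - intros W V HW HP HV. replace (1 + 3)%nat with 4%nat by reflexivity.
    set (W4 := W 4%nat). assert (C4 : cont W4) by exact (jet_cont W HW _).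
    set (D := fun j => L2norm (node M (j - 1)) (node M j) (V j 0%nat)).
    assert (HD : forall j, 0 <= D j) by (intros; apply L2norm_nonneg).
    (* For j = N this double cell leaves [a,b]; periodicity of W brings its second half back to cell
       1. *)
    set (G := fun j => L2norm (node M (j - 1)) (node M (j - 1) + 2 * h) W4).
    assert (HG : forall j, 0 <= G j) by (intros; apply L2norm_nonneg).
    assert (AB : forall j, (1 <= j <= ncells M)%nat ->
      (forall x, V j 2%nat x = 0) /\
      (forall x, h * sqrt h * Rabs (V j 1%nat x) <= 4 * D j) /\
      sqrt h * Rabs (V j 0%nat (node M (j - 1))) <= 3 * D j /\
      sqrt h * Rabs (V j 0%nat (node M j)) <= 3 * D j).
    { intros j Hj. unfold D. rewrite (Hnode j Hj).
      apply affine_bounds; [exact Hh|apply HV|apply HV]. }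
    assert (HZ : bjet (fun j m x => P W j m x - W m x)).
    { intros j. apply (jet_minus (P W j) W); [apply PP|exact HW]. }
    rewrite Bf_parts by (exact HZ || apply HV).
    assert (Z0 : bin M (fun j x => P W j 0%nat x - W 0%nat x) (fun j => V j 2%nat) = 0).
    { apply ssum_eq0. intros j Hj.
      rewrite (RInt_extR _ _ _ (fun _ => 0)); [rewrite RInt_constR; ring|].
      intros x. rewrite (proj1 (AB j Hj)). ring. }
    rewrite Z0, Ropp_0, Rplus_0_l. clear Z0.
    assert (T : forall j, (1 <= j <= ncells M)%nat ->
       Rabs (av M (fun j m x => P W j m x - W m x) 0 j) <= 23 * (h * h * h * (sqrt (2 * h) * G j)) /\
       Rabs (av M (fun j m x => P W j m x - W m x) 1 j) <= 16 * (h * h * (sqrt (2 * h) * G j))).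
    { intros j Hj. destruct (lin_jet_interface (node M (j - 1)) h W HW Hh) as [I0 I1].
      (* At interface N the next cell starts at a, while the cubic argument runs on the adjacent
         cell beyond b. Periodicity makes the local data on the two equal. *)
      assert (Ev : lin_value (node M (nx M j - 1)) h W = lin_value (node M j) h W).
      { unfold lin_value. rewrite <- (Rplus_0_r (node M (nx M j - 1))) at 3.
        rewrite !(periodic_nx M W _ j) by assumption. now rewrite Rplus_0_r. }
      assert (Es : lin_slope (node M (nx M j - 1)) h W = lin_slope (node M j) h W).
      { unfold lin_slope. rewrite <- (Rplus_0_r (node M (nx M j - 1))) at 3.
        rewrite !(periodic_nx M W _ j) by assumption. now rewrite Rplus_0_r. }
      assert (Ew : forall m, W m (node M (nx M j - 1)) = W m (node M j)).
      { intros m. rewrite <- (Rplus_0_r (node M (nx M j - 1))), periodic_nx by assumption.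
        now rewrite Rplus_0_r. }
      fold W4 in I0, I1. fold (G j) in I0, I1. unfold av, tm, tp, P, lin_jet.
      rewrite Ev, Es, !Ew. rewrite <- (Hnode j Hj) in I0, I1.
      split.
      - replace ((_ + _) / 2) with ((lin_value (node M (j - 1)) h W + lin_slope (node M (j - 1)) h W * (h / 2)
           + (lin_value (node M j) h W - lin_slope (node M j) h W * (h / 2))) / 2 - W 0%nat (node M j));
          [exact I0|].
        replace (node M j - (node M (j - 1) + h / 2)) with (h / 2) by (rewrite (Hnode j Hj); field).
        field.
      - replace ((_ + _) / 2) with ((lin_slope (node M (j - 1)) h W + lin_slope (node M j) h W) / 2
           - W 1%nat (node M j)) by field. exact I1. }
    assert (S2 : sqrt (2 * h) <= 2 * sqrt h).
    { rewrite sqrt_mult by lra. apply Rmult_le_compat_r; [apply sqrt_pos|].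
      rewrite <- (sqrt_square 2) at 2 by lra. apply sqrt_le_1_alt. lra. }
    assert (Sp := sqrt_pos h).
    assert (Term : forall j, (1 <= j <= ncells M)%nat ->
       Rabs (av M (fun j m x => P W j m x - W m x) 1 j * jp M V 0 j
         - av M (fun j m x => P W j m x - W m x) 0 j * jp M V 1 j)
       <= 280 * (h * h) * (G j * (D j + D (nx M j)))).
    { intros j Hj. destruct (T j Hj) as [T0 T1]. assert (Hn := nx_range M j Hj).
      destruct (AB j Hj) as [_ [A1 [_ A3]]]. destruct (AB (nx M j) Hn) as [_ [B1 [B2 _]]].
      specialize (A1 (node M j)). specialize (B1 (node M (nx M j - 1))).
      assert (J0 : sqrt h * Rabs (jp M V 0 j) <= 3 * (D j + D (nx M j))).
      { apply Rle_trans with (sqrt h * (Rabs (tp M V 0 j) + Rabs (tm M V 0 j))).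
        - apply Rmult_le_compat_l; [exact Sp|]. unfold jp, Rminus.
          rewrite <- (Rabs_Ropp (tm M V 0 j)). apply Rabs_triang.
        - unfold tp, tm. lra. }
      assert (J1 : h * sqrt h * Rabs (jp M V 1 j) <= 4 * (D j + D (nx M j))).
      { apply Rle_trans with (h * sqrt h * (Rabs (tp M V 1 j) + Rabs (tm M V 1 j))).
        - apply Rmult_le_compat_l; [nra|]. unfold jp, Rminus.
          rewrite <- (Rabs_Ropp (tm M V 1 j)). apply Rabs_triang.
        - unfold tp, tm. lra. }
      eapply Rle_trans; [apply Rabs_triang|]. rewrite Rabs_Ropp, !Rabs_mult.
      assert (K1 : sqrt (2 * h) * G j <= 2 * sqrt h * G j) by (apply Rmult_le_compat_r; auto).
      assert (K2 : 0 <= h * h) by nra. assert (K3 : 0 <= h * h * h) by (apply Rmult_le_pos; lra).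
      apply Rle_trans with (16 * (h * h * (2 * sqrt h * G j)) * Rabs (jp M V 0 j)
         + 23 * (h * h * h * (2 * sqrt h * G j)) * Rabs (jp M V 1 j)).
      - apply Rplus_le_compat; (apply Rmult_le_compat_r; [apply Rabs_pos|]).
        + eapply Rle_trans; [exact T1|]. apply Rmult_le_compat_l; [lra|]. now apply Rmult_le_compat_l.
        + eapply Rle_trans; [exact T0|]. apply Rmult_le_compat_l; [lra|]. now apply Rmult_le_compat_l.
      - replace (16 * (h * h * (2 * sqrt h * G j)) * Rabs (jp M V 0 j)
         + 23 * (h * h * h * (2 * sqrt h * G j)) * Rabs (jp M V 1 j))
        with (h * h * G j * (32 * (sqrt h * Rabs (jp M V 0 j)) + 46 * (h * sqrt h * Rabs (jp M V 1 j))))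
          by ring.
        replace (280 * (h * h) * (G j * (D j + D (nx M j))))
          with (h * h * G j * (280 * (D j + D (nx M j)))) by ring.
        apply Rmult_le_compat_l; [now apply Rmult_le_pos|]. lra. }
    eapply Rle_trans; [apply ssum_abs|]. eapply Rle_trans; [apply ssum_le, Term|].
    rewrite ssum_scal.
    assert (NV : bnorm M (fun j => V j 0%nat) = sqrt (ssum (ncells M) (fun j => D j * D j)))
      by (apply bnorm_cells, (bjet_cont V 0 (proj1 HV))).
    set (g := fun j => L2norm (node M (j - 1)) (node M j) W4).
    assert (NW : L2norm a b W4 = sqrt (ssum (ncells M) (fun j => g j * g j))).
    { rewrite <- (bnorm_global M W4) by exact C4. now apply bnorm_cells. }
    (* The double cells cover the period twice. *)
    assert (SG : ssum (ncells M) (fun j => G j * G j) = 2 * ssum (ncells M) (fun j => g j * g j)).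
    { rewrite (ssum_ext _ _ (fun j => g j * g j + g (nx M j) * g (nx M j))).
      - rewrite ssum_plus, (ssum_nx M (fun j => g j * g j)). ring.
      - intros j Hj. assert (Hn := nx_range M j Hj). unfold G, g.
        rewrite !L2norm_sq by (try exact C4; try (now apply cell_le); lra).
        assert (C44 : cont (fun x => W4 x * W4 x)) by auto with cont.
        rewrite <- (RInt_Chasles (V:=R_CompleteNormedModule) (fun x => W4 x * W4 x) _ (node M j))
          by now apply cont_ex_RInt.
        unfold plus; simpl. apply (f_equal2 Rplus); [reflexivity|].
        rewrite (Hnode (nx M j) Hn).
        replace (node M (j - 1) + 2 * h) with (node M j + h) by (rewrite (Hnode j Hj); ring).
        destruct (node_nx M j Hj) as [E|E]; [now rewrite E|].
        rewrite <- E. replace (node M (nx M j - 1) + (b - a) + h) with (node M (nx M j - 1) + h + (b - a)) by ring.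
        rewrite <- (RInt_shift (fun x => W4 x * W4 x)) by exact C44.
        apply RInt_extR. intros x. unfold W4. now rewrite HP. }
    assert (SD : ssum (ncells M) (fun j => (D j + D (nx M j)) * (D j + D (nx M j)))
       <= 4 * ssum (ncells M) (fun j => D j * D j)).
    { apply Rle_trans with (ssum (ncells M) (fun j => 2 * (D j * D j) + 2 * (D (nx M j) * D (nx M j)))).
      - apply ssum_le. intros j _. generalize (Rle_0_sqr (D j - D (nx M j))). unfold Rsqr. nra.
      - rewrite ssum_plus, !ssum_scal, (ssum_nx M (fun j => D j * D j)). lra. }
    assert (CS := Rle_trans _ _ _ (Rle_abs _) (ssum_CS (ncells M) G (fun j => D j + D (nx M j)))).
    assert (PG : 0 <= ssum (ncells M) (fun j => g j * g j)) by (apply ssum_ge0; intros; nra).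
    assert (PD : 0 <= ssum (ncells M) (fun j => D j * D j)) by (apply ssum_ge0; intros; nra).
    assert (F : ssum (ncells M) (fun j => G j * (D j + D (nx M j)))
       <= 3 * (L2norm a b W4 * bnorm M (fun j => V j 0%nat))).
    { eapply Rle_trans; [exact CS|]. rewrite NV, NW, SG.
      assert (Gen : forall p q x, 0 <= p -> 0 <= q -> 0 <= x -> x <= 4 * q ->
         sqrt (2 * p) * sqrt x <= 3 * (sqrt p * sqrt q)).
      { intros p q x Hp Hq Hx Hxq. assert (0 <= p * q) by now apply Rmult_le_pos.
        rewrite <- (sqrt_square 3) by lra. rewrite <- !sqrt_mult by lra.
        apply sqrt_le_1_alt. nra. }
      apply Gen; [exact PG|exact PD| |exact SD]. apply ssum_ge0. intros. apply Rle_0_sqr. }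
    assert (0 <= L2norm a b W4 * bnorm M (fun j => V j 0%nat))
      by (apply Rmult_le_pos; [apply L2norm_nonneg|apply bnorm_nonneg]).
    apply Rle_trans with (280 * (h * h) * (3 * (L2norm a b W4 * bnorm M (fun j => V j 0%nat)))).
    + apply Rmult_le_compat_l; [nra|exact F].
    + nra.
  - intros j y. unfold P, lin_jet, lin_value, lin_slope. set (c := node M (j - 1)).
    assert (Ts : time_linear (fun W => 2 * W 1%nat (c + h / 2) - / 2 * (W 1%nat (c + h) + W 1%nat c))).
    { apply (time_linear_minus (fun W => 2 * W 1%nat (c + h / 2))
        (fun W => / 2 * (W 1%nat (c + h) + W 1%nat c))).
      - apply time_linear_scal, time_linear_eval.
      - apply time_linear_scal, time_linear_plus; apply time_linear_eval. }
    apply (time_linear_plus (fun W => W 0%nat (c + h / 2) + h / 8 * (W 1%nat (c + h) - W 1%nat c))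
      (fun W => (2 * W 1%nat (c + h / 2) - / 2 * (W 1%nat (c + h) + W 1%nat c)) * (y - (c + h / 2)))).
    + apply time_linear_plus; [apply time_linear_eval|].
      apply time_linear_scal, time_linear_minus; apply time_linear_eval.
    + apply (time_linear_ext (fun W => (y - (c + h / 2))
        * (2 * W 1%nat (c + h / 2) - / 2 * (W 1%nat (c + h) + W 1%nat c)))); [intros; ring|].
      now apply time_linear_scal.
Qed.

(** * The energy estimate *)

Lemma broken_minus k V W : poly_jet_broken k V -> poly_jet_broken k W ->
  poly_jet_broken k (fun j m x => V j m x - W j m x).
Proof.
  intros [HV PV] [HW PW]. split; intros j.
  - apply (jet_minus (V j) (W j)); auto.
  - apply is_poly_minus; auto.
Qed.

Lemma L2norm_ext c d f g : (forall x, f x = g x) -> L2norm c d f = L2norm c d g.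
Proof. intros E. unfold L2norm, inner. f_equal. apply RInt_extR. intros; now rewrite E. Qed.

Lemma L2norm_opp c d f : L2norm c d (fun x => - f x) = L2norm c d f.
Proof. unfold L2norm, inner. f_equal. apply RInt_extR. intros; ring. Qed.

Lemma periodic_jet_opp_shift a b W n : periodic_jet a b W ->
  periodic_jet a b (fun m x => - W (n + m)%nat x).
Proof. intros H m x. now rewrite H. Qed.

Lemma jet_opp W : jet W -> jet (fun m x => - W m x).
Proof. intros H m x. apply (is_derive_opp (W m)), H. Qed.

(** [Dv] stands for the time derivative of u_h and [W1] for u_t. The equation and its differentiated
    form enter as hypotheses on [W1], so the argument is purely spatial, at one fixed time. *)
Lemma energy_step {a b} (M : mesh a b) k kappa P W W1 V Q Dv :
  0 <= kappa -> approx_operator M k kappa P ->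
  jet W -> periodic_jet a b W -> jet W1 ->
  (forall x, W1 0%nat x = - W 4%nat x) -> (forall x, W1 (k + 1)%nat x = - W (k + 5)%nat x) ->
  poly_jet_broken k V -> poly_jet_broken k Q -> (forall j, cont (Dv j)) ->
  (forall Phi, poly_jet_broken k Phi -> bin M Dv (fun j => Phi j 0%nat) = - Bf M Q Phi) ->
  (forall Psi, poly_jet_broken k Psi ->
     bin M (fun j => Q j 0%nat) (fun j => Psi j 0%nat) = Bf M V Psi) ->
  2 * bin M (fun j x => P W1 j 0%nat x - Dv j x) (fun j x => P W j 0%nat x - V j 0%nat x)
  <= 4 * (kappa * L2norm a b (W1 (k + 1)%nat)) * bnorm M (fun j x => P W j 0%nat x - V j 0%nat x)
     + 2 * (kappa * L2norm a b (W (k + 3)%nat)) * (kappa * L2norm a b (W (k + 3)%nat)).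
Proof.
  intros Hkap [HPV [HPE [HPB _]]] HW PW HW1 E4 E5 HV HQ CD EqU EqQ.
  set (Wq := fun m x => - W (2 + m)%nat x).
  assert (HWq : jet Wq) by (apply (jet_opp (fun m => W (2 + m)%nat)); now apply jet_shift).
  assert (PWq : periodic_jet a b Wq) by now apply periodic_jet_opp_shift.
  set (E := fun j m x => P W j m x - V j m x).
  assert (HE : poly_jet_broken k E) by (apply broken_minus; auto).
  set (R := fun j m x => P Wq j m x - Q j m x).
  assert (HR : poly_jet_broken k R) by (apply broken_minus; auto).
  change (fun j x => P W j 0%nat x - V j 0%nat x) with (fun j => E j 0%nat).
  set (e := fun j => E j 0%nat). set (r := fun j => R j 0%nat).
  assert (Ce : forall j, cont (e j)) by apply (bjet_cont E 0 (proj1 HE)).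
  assert (Cr : forall j, cont (r j)) by apply (bjet_cont R 0 (proj1 HR)).
  assert (CP : forall Z, jet Z -> forall j, cont (P Z j 0%nat)).
  { intros Z HZ. apply (bjet_cont (P Z) 0 (proj1 (HPV Z HZ))). }
  assert (CW : forall Z, jet Z -> cont (Z 0%nat)) by (intros Z HZ; exact (jet_cont Z HZ 0)).
  assert (CQ : forall j, cont (Q j 0%nat)) by apply (bjet_cont Q 0 (proj1 HQ)).
  assert (I1 : bin M (fun j x => P W1 j 0%nat x - Dv j x) e
     = bin M (fun j x => P W1 j 0%nat x - W1 0%nat x) e - Bf M R E
       + Bf M (fun j m x => P Wq j m x - Wq m x) E).
  { rewrite (bin_minus_l M (fun j => P W1 j 0%nat) Dv) by auto.
    rewrite (bin_minus_l M (fun j => P W1 j 0%nat) (fun _ => W1 0%nat)) by auto.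
    unfold e at 2. rewrite (EqU E HE).
    rewrite (Bf_minus_l M (P Wq) (fun _ => Wq) E) by (try apply HPV; try (intros j; exact HWq); auto; apply HE).
    unfold R. rewrite (Bf_minus_l M (P Wq) Q E) by (try apply HPV; auto; apply HQ || apply HE).
    rewrite (Bf_consistent M Wq E HWq PWq (proj1 HE)).
    replace (bin M (fun _ => Wq 2%nat) (fun j => E j 0%nat)) with (bin M (fun _ => W1 0%nat) e); [ring|].
    apply bint_ext. intros j x _ _. rewrite E4. reflexivity. }
  assert (I2 : bin M r r = bin M (fun j x => P Wq j 0%nat x - Wq 0%nat x) r
      - Bf M (fun j m x => P W j m x - W m x) R + Bf M R E).
  { unfold r at 1, R at 1.
    rewrite (bin_minus_l M (fun j => P Wq j 0%nat) (fun j => Q j 0%nat)) by auto.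
    rewrite (bin_minus_l M (fun j => P Wq j 0%nat) (fun _ => Wq 0%nat)) by auto.
    unfold r at 2. rewrite (EqQ R HR). rewrite (Bf_sym M R E).
    unfold E. rewrite (Bf_minus_l M (P W) V R) by (try apply HPV; auto; apply HV || apply HR).
    rewrite (Bf_minus_l M (P W) (fun _ => W) R) by (try apply HPV; try (intros j; exact HW); auto; apply HR).
    rewrite (Bf_consistent M W R HW PW (proj1 HR)).
    replace (bin M (fun _ => Wq 0%nat) r) with (- bin M (fun _ => W 2%nat) (fun j => R j 0%nat)); [ring|].
    unfold bin. rewrite <- (Ropp_involutive (bint M (fun j x => Wq 0%nat x * r j x))).
    f_equal. rewrite <- (Rmult_1_l (bint M (fun j x => Wq 0%nat x * r j x))), <- Ropp_mult_distr_l_reverse.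
    rewrite <- bint_scal; [|intros; apply cont_mult; auto]. apply bint_ext. intros.
    unfold Wq, r. simpl. ring. }
  set (N1 := L2norm a b (W1 (k + 1)%nat)) in *. set (N3 := L2norm a b (W (k + 3)%nat)) in *.
  assert (Nq3 : L2norm a b (Wq (k + 3)%nat) = N1).
  { apply L2norm_ext. intros x. rewrite E5. unfold Wq. now replace (2 + (k + 3))%nat with (k + 5)%nat by lia. }
  assert (Nq1 : L2norm a b (Wq (k + 1)%nat) = N3).
  { unfold Wq. rewrite L2norm_opp. unfold N3. now replace (2 + (k + 1))%nat with (k + 3)%nat by lia. }
  assert (B1 : Rabs (bin M (fun j x => P W1 j 0%nat x - W1 0%nat x) e) <= kappa * N1 * bnorm M e).
  { eapply Rle_trans; [apply bin_CS; auto with cont|].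
    apply Rmult_le_compat_r; [apply bnorm_nonneg|now apply HPE]. }
  assert (B2 := HPB Wq E HWq PWq HE). rewrite Nq3 in B2. fold e in B2.
  assert (B3 : Rabs (bin M (fun j x => P Wq j 0%nat x - Wq 0%nat x) r) <= kappa * N3 * bnorm M r).
  { eapply Rle_trans; [apply bin_CS; auto with cont|].
    apply Rmult_le_compat_r; [apply bnorm_nonneg|]. rewrite <- Nq1. now apply HPE. }
  assert (B4 := HPB W R HW PW HR). fold N3 r in B4.
  assert (Sr := bnorm_sq M r Cr).
  change (fun j => E j 0%nat) with e.
  rewrite I1. apply Rabs_le_between in B1, B2, B3, B4.
  (* Completing the square absorbs e_q: -2 |r|^2 + 4 kappa N3 |r| <= 2 (kappa N3)^2. *)
  assert (YI : 0 <= (bnorm M r - kappa * N3) * (bnorm M r - kappa * N3)) by apply Rle_0_sqr.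
  nra.
Qed.

(** sqrt F need not be differentiable where F vanishes. Adding r^2 with r at the scale of the source
    term cures this and costs only r: as Z >= r and Z >= sqrt F, one gets Z' <= p + r, so growth is
    linear and not exponential. *)
Lemma gronwall_sqrt (F F' : R -> R) p r t : 0 <= p -> 0 < r -> 0 < t -> (forall s, 0 <= s -> 0 <= F s) ->
  (forall s, 0 < s <= t -> is_derive F s (F' s) /\ F' s <= 2 * p * sqrt (F s) + 2 * (r * r)) ->
  filterlim F (at_right 0) (locally (F 0)) ->
  sqrt (F t) <= sqrt (F 0) + r + (p + r) * t.
Proof.
  intros Hp Hr Ht HF HD HC.
  set (Z := fun s => sqrt (F s + r * r)).
  assert (Hpos : forall s, 0 <= s -> 0 < F s + r * r) by (intros s Hs; generalize (HF s Hs); nra).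
  assert (DZ : forall s, 0 < s <= t -> is_derive Z s (F' s / (2 * Z s))).
  { intros s Hs. destruct (HD s Hs) as [D _].
    replace (F' s / (2 * Z s)) with (F' s * (/ (2 * sqrt (F s + r * r)))) by reflexivity.
    apply (is_derive_comp sqrt (fun s => F s + r * r) s).
    - apply is_derive_Reals, derivable_pt_lim_sqrt, Hpos; lra.
    - rewrite <- (Rplus_0_r (F' s)).
      apply (is_derive_plus (K:=R_AbsRing) (V:=R_NormedModule) F (fun _ => r * r)); [exact D|].
      apply (is_derive_const (K:=R_AbsRing) (V:=R_NormedModule) (r * r)). }
  assert (BZ : forall s, 0 < s <= t -> F' s / (2 * Z s) <= p + r).
  { intros s Hs. destruct (HD s Hs) as [_ B].
    assert (Z1 : sqrt (F s) <= Z s) by (apply sqrt_le_1_alt; nra).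
    assert (Z2 : r <= Z s).
    { unfold Z. rewrite <- (sqrt_square r) at 1 by lra. apply sqrt_le_1_alt.
      generalize (HF s ltac:(lra)). lra. }
    apply (Rmult_le_reg_r (2 * Z s)); [lra|].
    replace (F' s / (2 * Z s) * (2 * Z s)) with (F' s) by (field; lra). nra. }
  (* F is differentiable only at positive times; the comparison starts at tau > 0, and tau is then
     sent to 0 by continuity from the right. *)
  assert (MV : forall tau, 0 < tau < t -> Z t <= Z tau + (p + r) * t).
  { intros tau Htau.
    destruct (MVT_gen Z tau t (fun s => F' s / (2 * Z s))) as [c [Hc Ec]].
    - intros x Hx. rewrite Rmin_left, Rmax_right in Hx by lra. apply DZ; lra.
    - intros x Hx. rewrite Rmin_left, Rmax_right in Hx by lra. apply continuity_pt_filterlim.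
      apply (ex_derive_continuous (V:=R_NormedModule)). eexists. apply DZ; lra.
    - rewrite Rmin_left, Rmax_right in Hc by lra.
      assert (B := BZ c ltac:(lra)). nra. }
  assert (CZ : filterlim Z (at_right 0) (locally (Z 0))).
  { apply (filterlim_comp _ _ _ F (fun x => sqrt (x + r * r)) _ _ _ HC).
    apply (continuous_comp (fun x => x + r * r) sqrt); [|apply continuous_sqrt].
    assert (K : cont (fun x => x + r * r)) by auto with cont. apply K. }
  assert (L : Z t <= Z 0 + (p + r) * t).
  { destruct (Rle_or_lt (Z t) (Z 0 + (p + r) * t)) as [H|H]; [exact H|exfalso].
    assert (He : 0 < Z t - Z 0 - (p + r) * t) by lra.
    assert (Ev := CZ _ (locally_ball (Z 0) (mkposreal _ He))).
    assert (Ev2 : at_right 0 (fun s => 0 < s < t)).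
    { exists (mkposreal t Ht). intros s Hs Hs0. change (Rabs (s - 0) < t) in Hs.
      apply Rabs_def2 in Hs. lra. }
    unfold filtermap in Ev.
    destruct (filter_ex (F:=at_right 0) _ (filter_and (F:=at_right 0) _ (fun s => 0 < s < t) Ev Ev2))
      as [s [Hs1 Hs2]].
    change (Rabs (Z s - Z 0) < Z t - Z 0 - (p + r) * t) in Hs1. apply Rabs_def2 in Hs1.
    specialize (MV s Hs2). lra. }
  assert (Z1 : sqrt (F t) <= Z t) by (apply sqrt_le_1_alt; nra).
  assert (Z2 : Z 0 <= sqrt (F 0) + r).
  { unfold Z. assert (H0 := HF 0 (Rle_refl 0)). assert (Hs := sqrt_pos (F 0)).
    rewrite <- (sqrt_square (sqrt (F 0) + r)) by lra. apply sqrt_le_1_alt.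
    generalize (sqrt_sqrt (F 0) H0). nra. }
  lra.
Qed.

(** * Broken polynomials through their values at interpolation points *)

(** Nodes inside the open cells, where the scheme guarantees differentiability in time of point
    values. Nodal values determine the cell polynomials, so the whole error inherits that
    regularity. *)
Lemma cell_interpolation {a b} (M : mesh a b) k : exists (y : nat -> nat -> R) (l : nat -> nat -> R -> R),
  (forall j i, is_poly k (l j i)) /\
  (forall j i, (1 <= j <= ncells M)%nat -> (1 <= i <= S k)%nat -> in_cell M j (y j i)) /\
  (forall j, (1 <= j <= ncells M)%nat -> forall p, is_poly k p ->
     forall x, p x = ssum (S k) (fun i => p (y j i) * l j i x)).
Proof.
  set (y := fun j i => node M (j - 1) + hcell M j / INR (S i)).
  assert (HS : forall i, 0 < INR (S i)) by (intros; apply lt_0_INR; lia).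
  destruct (functional_choice (fun j l => (forall i, is_poly k (l i)) /\
     ((1 <= j <= ncells M)%nat -> forall p, is_poly k p ->
        forall x, p x = ssum (S k) (fun i => p (y j i) * l i x)))) as [l Hl].
  - intros j. destruct (classic (1 <= j <= ncells M)%nat) as [Hj|Hj].
    + destruct (interpolation k (y j)) as [l [Pl Il]].
      * intros i i' Hi Hi' Hne E. apply Hne. unfold y in E. apply Rplus_eq_reg_l in E.
        unfold Rdiv in E. apply Rmult_eq_reg_l in E; [|generalize (hcell_pos M j Hj); lra].
        assert (INR (S i) = INR (S i')) by (rewrite <- (Rinv_inv (INR (S i))), E; apply Rinv_inv).
        apply INR_eq in H. lia.
      * exists l. split; [exact Pl|]. intros _. exact Il.
    + exists (fun _ _ => 0). split; [intros; apply is_poly_const|]. tauto.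
  - exists y, l. split; [intros j; apply Hl|split].
    + intros j i Hj Hi. split; [exact Hj|]. unfold y.
      assert (Hh := hcell_pos M j Hj).
      assert (1 < INR (S i)) by (rewrite <- INR_1; apply lt_INR; lia).
      assert (0 < hcell M j / INR (S i)) by (apply Rdiv_lt_0_compat; [lra|apply HS]).
      assert (hcell M j / INR (S i) < hcell M j) by (apply Rlt_div_l; [apply HS|nra]).
      generalize (cell_right M j). lra.
    + intros j. apply Hl.
Qed.

Definition lagrange (k : nat) (l : nat -> nat -> R -> R) (al : nat -> nat -> R) (j : nat) (x : R) : R :=
  ssum (S k) (fun i => al j i * l j i x).

(** The mass-matrix form in nodal values. Its coefficients do not depend on time, so differentiating
    the squared L2 norm reduces to the product rule. *)
Definition gram {a b} (M : mesh a b) (k : nat) (l : nat -> nat -> R -> R) (al be : nat -> nat -> R) : R :=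
  ssum (ncells M) (fun j => ssum (S k) (fun i => ssum (S k) (fun m =>
    RInt (fun x => l j i x * l j m x) (node M (j - 1)) (node M j) * (al j i * be j m)))).

Lemma lagrange_cont k l al j : (forall j i, is_poly k (l j i)) -> cont (lagrange k l al j).
Proof.
  intros Hl. apply (cont_ssum (S k) (fun i x => al j i * l j i x)). intros i.
  apply cont_mult; [apply cont_const|apply (is_poly_cont k), Hl].
Qed.

Lemma bin_lagrange {a b} (M : mesh a b) k l al be : (forall j i, is_poly k (l j i)) ->
  bin M (lagrange k l al) (lagrange k l be) = gram M k l al be.
Proof.
  intros Hl. assert (Cl : forall j i, cont (l j i)) by (intros; apply (is_poly_cont k), Hl).
  apply ssum_ext. intros j Hj.
  rewrite (RInt_extR _ _ _ (fun x => ssum (S k) (fun i => ssum (S k) (fun m =>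
     (al j i * be j m) * (l j i x * l j m x))))).
  - rewrite (RInt_ssum _ _ (S k) (fun i x => ssum (S k) (fun m => (al j i * be j m) * (l j i x * l j m x)))).
    + apply ssum_ext. intros i Hi.
      rewrite (RInt_ssum _ _ (S k) (fun m x => (al j i * be j m) * (l j i x * l j m x))) by auto with cont.
      apply ssum_ext. intros m Hm. rewrite RInt_scalR by auto with cont. as_real. ring.
    + intros i. apply (cont_ssum (S k) (fun m x => (al j i * be j m) * (l j i x * l j m x))).
      auto with cont.
  - intros x. unfold lagrange. rewrite (Rmult_comm (ssum _ _)), <- ssum_scal. apply ssum_ext. intros i Hi.
    rewrite Rmult_comm, <- ssum_scal. apply ssum_ext. intros; ring.
Qed.

Lemma is_derive_ssum n (f : nat -> R -> R) (f' : nat -> R) t :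
  (forall i, (1 <= i <= n)%nat -> is_derive (f i) t (f' i)) ->
  is_derive (fun s => ssum n (fun i => f i s)) t (ssum n f').
Proof.
  induction n as [|n IH]; intros H.
  - apply (is_derive_const (K:=R_AbsRing) (V:=R_NormedModule) 0).
  - apply (is_derive_plus (K:=R_AbsRing) (V:=R_NormedModule) (fun s => ssum n (fun i => f i s)) (f (S n))).
    + apply IH. intros; apply H; lia.
    + apply H; lia.
Qed.

Lemma filterlim_ssum n (f : nat -> R -> R) (l : nat -> R) F {FF : Filter F} :
  (forall i, (1 <= i <= n)%nat -> filterlim (f i) F (locally (l i))) ->
  filterlim (fun s => ssum n (fun i => f i s)) F (locally (ssum n l)).
Proof.
  induction n as [|n IH]; intros H.
  - apply filterlim_const.
  - apply (filterlim_comp_2 (fun s => ssum n (fun i => f i s)) (f (S n)) Rplus (G:=locally (ssum n l))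
      (H:=locally (l (S n)))).
    + apply IH. intros; apply H; lia.
    + apply H; lia.
    + apply (filterlim_plus (K:=R_AbsRing) (V:=R_NormedModule)).
Qed.

Lemma gram_derive {a b} (M : mesh a b) k l (al : R -> nat -> nat -> R) al' t :
  (forall j i, (1 <= j <= ncells M)%nat -> (1 <= i <= S k)%nat ->
     is_derive (fun s => al s j i) t (al' j i)) ->
  is_derive (fun s => gram M k l (al s) (al s)) t (gram M k l al' (al t) + gram M k l (al t) al').
Proof.
  intros H. unfold gram. rewrite <- ssum_plus.
  apply (is_derive_ssum (ncells M) (fun j s => ssum (S k) (fun i => ssum (S k) (fun m =>
    RInt (fun x => l j i x * l j m x) (node M (j - 1)) (node M j) * (al s j i * al s j m))))).
  intros j Hj. rewrite <- ssum_plus.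
  apply (is_derive_ssum (S k) (fun i s => ssum (S k) (fun m =>
    RInt (fun x => l j i x * l j m x) (node M (j - 1)) (node M j) * (al s j i * al s j m)))).
  intros i Hi. rewrite <- ssum_plus.
  apply (is_derive_ssum (S k) (fun m s =>
    RInt (fun x => l j i x * l j m x) (node M (j - 1)) (node M j) * (al s j i * al s j m))).
  intros m Hm. rewrite <- Rmult_plus_distr_l.
  apply (is_derive_scal (fun s => al s j i * al s j m)).
  apply (is_derive_mult (K:=R_AbsRing) (fun s => al s j i) (fun s => al s j m)).
  - now apply H.
  - now apply H.
  - intros; apply Rmult_comm.
Qed.

Lemma gram_filterlim {a b} (M : mesh a b) k l (al : R -> nat -> nat -> R) (al0 : nat -> nat -> R) F {FF : Filter F} :
  (forall j i, (1 <= j <= ncells M)%nat -> (1 <= i <= S k)%nat ->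
     filterlim (fun s => al s j i) F (locally (al0 j i))) ->
  filterlim (fun s => gram M k l (al s) (al s)) F (locally (gram M k l al0 al0)).
Proof.
  intros H. unfold gram.
  apply (filterlim_ssum (ncells M) (fun j s => ssum (S k) (fun i => ssum (S k) (fun m =>
    RInt (fun x => l j i x * l j m x) (node M (j - 1)) (node M j) * (al s j i * al s j m))))); [exact FF|].
  intros j Hj.
  apply (filterlim_ssum (S k) (fun i s => ssum (S k) (fun m =>
    RInt (fun x => l j i x * l j m x) (node M (j - 1)) (node M j) * (al s j i * al s j m)))); [exact FF|].
  intros i Hi.
  apply (filterlim_ssum (S k) (fun m s =>
    RInt (fun x => l j i x * l j m x) (node M (j - 1)) (node M j) * (al s j i * al s j m))); [exact FF|].
  intros m Hm.
  apply (filterlim_comp _ _ _ (fun s => al s j i * al s j m)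
    (fun z => RInt (fun x => l j i x * l j m x) (node M (j - 1)) (node M j) * z) F
    (locally (al0 j i * al0 j m))).
  - apply (filterlim_comp_2 (fun s => al s j i) (fun s => al s j m) Rmult
      (G:=locally (al0 j i)) (H:=locally (al0 j m))); [now apply H|now apply H|].
    apply (filterlim_mult (K:=R_AbsRing)).
  - apply (filterlim_scal_r (K:=R_AbsRing) (V:=R_NormedModule)).
Qed.

(** * The exact solution *)

Lemma sup_time_ub T F t : (exists K, forall s, 0 <= s <= T -> F s <= K) -> 0 <= t <= T ->
  F t <= sup_time T F.
Proof.
  intros [K HK] Ht. unfold sup_time.
  destruct (Lub_Rbar_correct (fun s => exists t, 0 <= t <= T /\ s = F t)) as [Hub Hl].
  set (L := Lub_Rbar _) in *.
  assert (H1 : Rbar_le (F t) L) by (apply Hub; now exists t).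
  assert (H2 : Rbar_le L K).
  { apply Hl. intros x [s [Hs ->]]. now apply HK. }
  destruct L as [l| |]; simpl in *; tauto || exact H1.
Qed.

Lemma right_quotient_lim (f : R -> R) (t l : R) : is_derive f t l ->
  lim (filtermap (fun s => (f s - f t) / (s - t)) (at_right t)) = l.
Proof.
  intros D. apply (lim_filter_unique (F:=filtermap (fun s => (f s - f t) / (s - t)) (at_right t))).
  apply is_derive_Reals in D. intros P [eps HP].
  destruct (D eps (cond_pos eps)) as [del Hdel]. exists del. intros s Hs Hgt. apply HP.
  change (Rabs (s - t) < del) in Hs. specialize (Hdel (s - t) ltac:(lra) Hs).
  assert (Es : forall z : R, t + (z - t) = z) by (intros; ring).
  rewrite Es in Hdel. exact Hdel.
Qed.

Lemma jet_Derive_n W f : jet W -> (forall x, f x = W 0%nat x) -> forall m x, Derive_n f m x = W m x.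
Proof.
  intros HW E m. induction m as [|m IH]; intros x; [apply E|].
  simpl. rewrite (Derive_ext _ _ x IH). now apply jet_Derive.
Qed.

(** Lets identities between functions be differentiated in space to any order: here periodicity, and
    the equation u_t = -u_xxxx. *)
Lemma jet_unique V W : jet V -> jet W -> (forall x, V 0%nat x = W 0%nat x) ->
  forall m x, V m x = W m x.
Proof.
  intros HV HW E m x. rewrite <- (jet_Derive_n V (V 0%nat) HV (fun _ => eq_refl)).
  now apply jet_Derive_n.
Qed.

Lemma jet_translate W s : jet W -> jet (fun m x => W m (x + s)).
Proof.
  intros HW m x. rewrite <- (Rmult_1_l (W (S m) (x + s))).
  apply (is_derive_comp (W m) (fun x => x + s)); [apply HW|]. auto_derive; [exact I|ring].
Qed.

(** A derivative of a periodic function has zero mean, so the Poincare inequality applies. Used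
    twice, it bounds |u|_{k+1} by (b-a)^2 |u|_{k+3}. *)
Lemma periodic_seminorm a b W m : a < b -> jet W -> periodic_jet a b W ->
  L2norm a b (W (S m)) <= (b - a) * L2norm a b (W (S (S m))).
Proof.
  intros Hab HW HP. apply poincare; [exact Hab|apply HW|now apply jet_cont|].
  rewrite (RInt_deriv a b (W m) (W (S m))); [|apply HW|now apply jet_cont].
  replace b with (a + (b - a)) by ring. rewrite HP. as_real. ring.
Qed.

(** * From the approximation operator to the error of the scheme *)

Lemma approx_operator_exists k : (1 <= k)%nat -> exists C, 0 < C /\
  forall a b (M : mesh a b), (k = 1%nat -> uniform_mesh M) ->
    exists P, approx_operator M k (C * hmax M ^ (k + 1)) P.
Proof.
  intros Hk. destruct (Nat.eq_dec k 1) as [->|Hne].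
  - destruct approx_operator_1 as [C [HC H]]. exists C. split; auto.
  - destruct (approx_operator_ge2 k ltac:(lia)) as [C [HC H]]. exists C. split; auto.
Qed.

(** Pu_0 - u_h(0) lies in V_h^k, so orthogonality of the L2 projection replaces u_h(0) by u_0 in its
    inner product with itself; Cauchy-Schwarz then leaves the approximation error of P. *)
Lemma initial_error {a b} (M : mesh a b) k kappa P W V u0 u0h : 0 <= kappa ->
  approx_operator M k kappa P -> jet W -> (forall x, u0 x = W 0%nat x) ->
  poly_jet_broken k V -> represents M u0h (fun j => V j 0%nat) -> is_L2_projection M k u0 u0h ->
  bnorm M (fun j x => P W j 0%nat x - V j 0%nat x) <= kappa * L2norm a b (W (k + 1)%nat).
Proof.
  intros Hkap [HPV [HPE _]] HW E0 HV HR [_ Proj].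
  set (E := fun j m x => P W j m x - V j m x).
  assert (HE : poly_jet_broken k E) by (apply broken_minus; auto).
  set (e := fun j => E j 0%nat). change (bnorm M e <= kappa * L2norm a b (W (k + 1)%nat)).
  assert (Ce : forall j, cont (e j)) by apply (bjet_cont E 0 (proj1 HE)).
  assert (CP : forall j, cont (P W j 0%nat)) by apply (bjet_cont (P W) 0 (proj1 (HPV W HW))).
  assert (CV : forall j, cont (V j 0%nat)) by apply (bjet_cont V 0 (proj1 HV)).
  assert (CW : cont (W 0%nat)) by exact (jet_cont W HW 0).
  destruct (glue M e) as [phi Hphi].
  assert (O := Proj phi (broken_in_Vh M k phi E HE Hphi)).
  rewrite (inner_represents M u0h (fun j => V j 0%nat) phi e) in O by auto.
  rewrite (inner_represents M u0 (fun _ => W 0%nat) phi e) in O by (auto; intros j y _; apply E0).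
  assert (I : bnorm M e * bnorm M e = bin M (fun j x => P W j 0%nat x - W 0%nat x) e).
  { rewrite bnorm_sq by exact Ce. unfold e at 1, E at 1.
    rewrite (bin_minus_l M (fun j => P W j 0%nat) (fun j => V j 0%nat)) by auto.
    rewrite (bin_minus_l M (fun j => P W j 0%nat) (fun _ => W 0%nat)) by auto. now rewrite O. }
  assert (B : bnorm M e * bnorm M e <= kappa * L2norm a b (W (k + 1)%nat) * bnorm M e).
  { rewrite I. eapply Rle_trans; [apply Rle_abs|]. eapply Rle_trans; [apply bin_CS; auto with cont|].
    apply Rmult_le_compat_r; [apply bnorm_nonneg|now apply HPE]. }
  destruct (Rle_lt_or_eq_dec _ _ (bnorm_nonneg M e)) as [Hpos|<-].
  - now apply Rmult_le_reg_r in B.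
  - apply Rmult_le_pos; [exact Hkap|apply L2norm_nonneg].
Qed.

Lemma dg_error_bound {a b} (M : mesh a b) k kappa P U u0 uh qh T S1 S2 : 0 < kappa ->
  approx_operator M k kappa P -> evolution U ->
  (forall s, 0 <= s -> periodic_jet a b (fun m => U 0%nat m s)) ->
  (forall s x, 0 < s -> U 1%nat 0%nat s x = - U 0%nat 4%nat s x) ->
  (forall x, u0 x = U 0%nat 0%nat 0 x) -> DG_solution M k u0 uh qh ->
  (forall s, 0 < s <= T -> L2norm a b (U 1%nat (k + 1)%nat s) <= S1) ->
  (forall s, 0 <= s <= T -> L2norm a b (U 0%nat (k + 3)%nat s) <= S2) ->
  (forall s, 0 <= s <= T -> L2norm a b (U 0%nat (k + 1)%nat s) <= (b - a) * (b - a) * S2) ->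
  forall t, 0 <= t <= T ->
  L2norm a b (fun y => uh t y - U 0%nat 0%nat t y)
  <= kappa * (2 * ((b - a) * (b - a) * S2) + (S2 + 1) + (2 * S1 + S2 + 1) * t).
Proof.
  intros Hkap HP HU Hper Heq Hu0 [Proj [HVh [Hc0 [Hdt [EqU EqQ]]]]] HS1 HS2 HS3 t Ht.
  assert (HP' := HP). destruct HP' as [HPV [HPE [_ HPT]]].
  assert (JU : forall i s, 0 <= s -> jet (fun m => U i m s)).
  { intros i s Hs m x. now apply HU. }
  (* A broken representative of u_h is fixed at every time s >= 0. Nothing relates these choices in
     s, so differentiation in time goes through the nodal values [al]. *)
  destruct (functional_choice (fun s V => 0 <= s -> poly_jet_broken k V /\ represents M (uh s) (fun j => V j 0%nat)))
    as [V HV].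
  { intros s. destruct (Rle_or_lt 0 s) as [Hs|Hs].
    - destruct (in_Vh_broken M k (uh s)) as [V HV]; [|now exists V].
      destruct (Rle_lt_or_eq_dec _ _ Hs) as [Hs'|<-]; [now apply HVh|apply Proj].
    - exists (fun _ _ _ => 0). lra. }
  destruct (cell_interpolation M k) as [y [l [Pl [Hy Il]]]].
  set (W := fun s m => U 0%nat m s).
  set (W1 := fun s m => U 1%nat m s).
  set (al := fun s j i => P (W s) j 0%nat (y j i) - uh s (y j i)).
  set (al' := fun s j i => P (W1 s) j 0%nat (y j i) - Derive (fun z => uh z (y j i)) s).
  set (E := fun s j x => P (W s) j 0%nat x - V s j 0%nat x).
  set (Dv := fun s => lagrange k l (fun j i => Derive (fun z => uh z (y j i)) s)).
  set (F := fun s => gram M k l (al s) (al s)).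
  assert (CE : forall s, 0 <= s -> forall j, cont (E s j)).
  { intros s Hs j. apply cont_minus.
    - apply (bjet_cont (P (W s)) 0 (proj1 (HPV _ (JU 0%nat s Hs)))).
    - apply (bjet_cont (V s) 0 (proj1 (proj1 (HV s Hs)))). }
  assert (EL : forall s, 0 <= s -> forall j x, (1 <= j <= ncells M)%nat ->
     E s j x = lagrange k l (al s) j x).
  { intros s Hs j x Hj. destruct (HV s Hs) as [HVs HRs].
    assert (HpE : is_poly k (E s j)) by (apply is_poly_minus; [apply HPV, JU, Hs|apply HVs]).
    rewrite (Il j Hj (E s j) HpE). apply ssum_ext. intros i Hi. unfold E, al.
    now rewrite (HRs j (y j i)) by now apply Hy. }
  assert (FE : forall s, 0 <= s -> F s = bin M (E s) (E s)).
  { intros s Hs. unfold F. rewrite <- bin_lagrange by exact Pl. symmetry.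
    apply bint_ext. intros j x Hj _. now rewrite (EL s Hs j x Hj). }
  assert (SF : forall s, 0 <= s -> sqrt (F s) = bnorm M (E s)).
  { intros s Hs. unfold bnorm. now rewrite FE. }
  (* The values of u_h in a cell are fixed combinations of its nodal values, so its pointwise time
     derivative is again a broken polynomial, namely [Dv]. *)
  assert (DvR : forall s, 0 < s -> represents M (fun x => Derive (fun z => uh z x) s) (Dv s)).
  { intros s Hs j x Hx. apply is_derive_unique.
    apply (is_derive_ext_loc (fun z => ssum (S k) (fun i => uh z (y j i) * l j i x))).
    - generalize (open_gt 0 s Hs). apply filter_imp. intros z Hz.
      destruct (HV z (Rlt_le _ _ Hz)) as [HVz HRz]. destruct Hx as [Hj Hx].
      rewrite (HRz j x (conj Hj Hx)), (Il j Hj _ (proj2 HVz j)). apply ssum_ext. intros i Hi.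
      now rewrite (HRz j (y j i)) by now apply Hy.
    - apply (is_derive_ssum (S k) (fun i z => uh z (y j i) * l j i x)). intros i Hi.
      apply (is_derive_ext (fun z => l j i x * uh z (y j i))); [intros; apply Rmult_comm|].
      rewrite Rmult_comm. apply (is_derive_scal (fun z => uh z (y j i))).
      apply Derive_correct, (Hdt j); [|exact Hs]. apply Hy; [apply Hx|exact Hi]. }
  assert (CD : forall s j, cont (Dv s j)) by (intros; now apply lagrange_cont).
  assert (N1 : forall s, 0 < s <= T -> 0 <= S1).
  { intros s Hs. eapply Rle_trans; [apply L2norm_nonneg|now apply (HS1 s)]. }
  assert (N2 : 0 <= S2) by (eapply Rle_trans; [apply L2norm_nonneg|apply (HS2 t Ht)]).
  assert (B0 : bnorm M (E 0) <= kappa * ((b - a) * (b - a) * S2)).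
  { eapply Rle_trans; [apply (initial_error M k kappa P (W 0) (V 0) u0 (uh 0)); auto|].
    - lra.
    - apply (JU 0%nat 0 (Rle_refl 0)).
    - apply HV; lra.
    - apply HV; lra.
    - apply Rmult_le_compat_l; [lra|]. apply HS3. lra. }
  assert (Bt : bnorm M (E t) <= kappa * ((b - a) * (b - a) * S2 + (S2 + 1) + (2 * S1 + S2 + 1) * t)).
  { destruct (Rle_lt_or_eq_dec 0 t (proj1 Ht)) as [Htp|<-]; [|nra].
    assert (HN1 := N1 t (conj Htp (proj2 Ht))).
    rewrite <- SF by lra.
    (* The added 1 in r = kappa (S2 + 1) keeps r positive even if S2 = 0. *)
    eapply Rle_trans; [apply (gronwall_sqrt F
       (fun s => 2 * bin M (fun j x => P (W1 s) j 0%nat x - Dv s j x) (E s))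
       (2 * (kappa * S1)) (kappa * (S2 + 1)) t)|].
    - nra.
    - nra.
    - exact Htp.
    - intros s Hs. rewrite FE by exact Hs. apply bin_self_ge0. now apply CE.
    - intros s Hs. assert (Hs0 : 0 <= s) by lra. assert (HsT : 0 < s <= T) by lra.
      destruct (HV s Hs0) as [HVs HRs].
      split.
      + replace (2 * bin M (fun j x => P (W1 s) j 0%nat x - Dv s j x) (E s))
          with (gram M k l (al' s) (al s) + gram M k l (al s) (al' s)).
        * apply gram_derive. intros j i Hj Hi.
          apply (is_derive_minus (K:=R_AbsRing) (V:=R_NormedModule)
            (fun s => P (W s) j 0%nat (y j i)) (fun s => uh s (y j i))).
          -- apply (proj1 (HPT j (y j i) U HU) s). lra.
          -- apply Derive_correct, (Hdt j); [now apply Hy|lra].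
        * rewrite <- !bin_lagrange by exact Pl. rewrite (bin_sym M (lagrange k l (al s))).
          replace (bin M (lagrange k l (al' s)) (lagrange k l (al s)))
            with (bin M (fun j x => P (W1 s) j 0%nat x - Dv s j x) (E s)); [ring|].
          apply bint_ext. intros j x Hj _. rewrite (EL s Hs0 j x Hj). f_equal.
          assert (HpW : is_poly k (P (W1 s) j 0%nat)) by apply HPV, JU, Hs0.
          rewrite (Il j Hj _ HpW). unfold Dv, lagrange. rewrite <- ssum_minus.
          apply ssum_ext. intros i Hi. unfold al'. ring.
      + destruct (in_Vh_broken M k (qh s)) as [Q [HQ HRQ]]; [apply HVh; lra|].
        eapply Rle_trans; [apply (energy_step M k kappa P (W s) (W1 s) (V s) Q (Dv s))|]; auto.
        * lra.
        * apply JU, Hs0.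
        * apply Hper, Hs0.
        * apply JU, Hs0.
        * intros x. apply Heq. lra.
        * intros x. unfold W, W1.
          (* The equation u_t = -u_xxxx is differentiated k+1 times in space. *)
          rewrite (jet_unique (fun m => U 1%nat m s) (fun m z => - U 0%nat (4 + m)%nat s z)).
          -- now replace (4 + (k + 1))%nat with (k + 5)%nat by lia.
          -- apply JU, Hs0.
          -- apply (jet_opp (fun m => U 0%nat (4 + m)%nat s)), (jet_shift (fun m => U 0%nat m s) 4), JU, Hs0.
          -- intros z. apply Heq. lra.
        * intros Phi HPhi. destruct (glue M (fun j => Phi j 0%nat)) as [phi Hphi].
          assert (HpV := broken_in_Vh M k phi Phi HPhi Hphi).
          rewrite <- (A_form_Bf M (qh s) Q phi Phi (proj1 HQ) (proj1 HPhi) HRQ Hphi).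
          rewrite <- (EqU s phi ltac:(lra) HpV). symmetry.
          apply inner_represents; auto; [apply DvR; lra|].
          apply (bjet_cont Phi 0 (proj1 HPhi)).
        * intros Psi HPsi. destruct (glue M (fun j => Psi j 0%nat)) as [psi Hpsi].
          assert (HpV := broken_in_Vh M k psi Psi HPsi Hpsi).
          rewrite <- (A_form_Bf M (uh s) (V s) psi Psi (proj1 HVs) (proj1 HPsi) HRs Hpsi).
          rewrite <- (EqQ s psi ltac:(lra) HpV). symmetry.
          apply inner_represents; auto; [apply (bjet_cont Q 0 (proj1 HQ))|].
          apply (bjet_cont Psi 0 (proj1 HPsi)).
        * change (bnorm M (fun j x => P (W s) j 0%nat x - V s j 0%nat x)) with (bnorm M (E s)).
          rewrite SF by exact Hs0.
          assert (L1 := HS1 s HsT). assert (L2 := HS2 s ltac:(lra)).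
          assert (L3 := L2norm_nonneg a b (W s (k + 3)%nat)).
          change (L2norm a b (W1 s (k + 1)%nat) <= S1) in L1.
          change (L2norm a b (W s (k + 3)%nat) <= S2) in L2.
          assert (K1 : kappa * L2norm a b (W1 s (k + 1)%nat) <= kappa * S1)
            by (apply Rmult_le_compat_l; lra).
          assert (K2 : kappa * L2norm a b (W s (k + 3)%nat) <= kappa * (S2 + 1))
            by (apply Rmult_le_compat_l; lra).
          assert (K3 : 0 <= kappa * L2norm a b (W s (k + 3)%nat)) by (apply Rmult_le_pos; lra).
          assert (K4 := bnorm_nonneg M (E s)).
          apply Rplus_le_compat.
          -- replace (2 * (2 * (kappa * S1))) with (4 * (kappa * S1)) by ring.
             apply Rmult_le_compat_r; [exact K4|]. lra.
          -- nra.
    - apply (gram_filterlim M k l al (al 0) (at_right 0)). intros j i Hj Hi.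
      apply (filterlim_comp_2 (fun s => P (W s) j 0%nat (y j i)) (fun s => uh s (y j i)) Rminus
        (G := locally (P (W 0) j 0%nat (y j i))) (H := locally (uh 0 (y j i)))).
      + apply (proj2 (HPT j (y j i) U HU)).
      + apply (Hc0 j). now apply Hy.
      + apply (filterlim_comp_2 fst (fun z => opp (snd z)) plus
          (G := locally (P (W 0) j 0%nat (y j i))) (H := locally (opp (uh 0 (y j i))))).
        * apply filterlim_fst.
        * apply (filterlim_comp _ _ _ snd opp _ (locally (uh 0 (y j i)))); [apply filterlim_snd|].
          apply (filterlim_opp (K:=R_AbsRing) (V:=R_NormedModule)).
        * apply (filterlim_plus (K:=R_AbsRing) (V:=R_NormedModule)).
    - rewrite SF by lra. nra. }
  destruct (HV t (proj1 Ht)) as [HVt HRt].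
  assert (CV : forall j, cont (V t j 0%nat)) by apply (bjet_cont (V t) 0 (proj1 HVt)).
  assert (JW := JU 0%nat t (proj1 Ht)). change (jet (W t)) in JW.
  assert (CW : cont (W t 0%nat)) by exact (jet_cont (W t) JW 0).
  assert (CP : forall j, cont (P (W t) j 0%nat)) by apply (bjet_cont (P (W t)) 0 (proj1 (HPV _ JW))).
  assert (Final : L2norm a b (fun y => uh t y - U 0%nat 0%nat t y)
     = bnorm M (fun j x => V t j 0%nat x - W t 0%nat x)).
  { unfold L2norm, bnorm. f_equal. apply inner_represents; auto with cont.
    all: intros j x Hx; now rewrite (HRt j x Hx). }
  rewrite Final.
  (* u_h - u is split as (Pu - u) - (Pu - u_h). The first part adds a second (b-a)^2 S2 to the one
     from the initial error. *)
  rewrite (bnorm_ext M _ (fun j x => (P (W t) j 0%nat x - W t 0%nat x) + - E t j x))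
    by (intros; unfold E; ring).
  eapply Rle_trans; [apply bnorm_triangle|].
  - auto with cont.
  - intros j. apply cont_opp, CE, Ht.
  - assert (HE1 := HPE (W t) JW). assert (HE2 := HS3 t Ht).
    change (L2norm a b (W t (k + 1)%nat) <= (b - a) * (b - a) * S2) in HE2.
    assert (Op : bnorm M (fun j x => - E t j x) = bnorm M (E t)).
    { unfold bnorm. f_equal. apply bint_ext. intros; ring. }
    rewrite Op. apply (Rmult_le_compat_l kappa) in HE2; [|lra]. nra.
Qed.

Theorem theorem2p2 :
  forall (a b : R) (k : nat),
    a < b -> (1 <= k)%nat ->
    exists C0 C1 : R -> R -> R,
    forall (M : mesh a b) (u0 : R -> R) (u uh qh : R -> R -> R) (T : R),
      (k = 1%nat -> uniform_mesh M) ->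
      biharmonic_solution a b u0 u ->
      DG_solution M k u0 uh qh ->
      forall t, 0 <= t <= T ->
        let S1 := sup_time T (fun s => Hseminorm a b (k + 1) (dt u s)) in
        let S2 := sup_time T (fun s => Hseminorm a b (k + 3) (u s)) in
        L2norm a b (fun y => uh t y - u t y)
        <= (C0 S1 S2 + C1 S1 S2 * T) * hmax M ^ (k + 1).
Proof.
  intros a b k Hab Hk. destruct (approx_operator_exists k Hk) as [C [HC HA]].
  (* The first function collects the initial error, the error of P at time t and the regularization
     r; the second is the growth rate p + r. Both are divided by h^(k+1). *)
  exists (fun S1 S2 => C * (2 * ((b - a) * (b - a) * S2) + (S2 + 1))),
    (fun S1 S2 => C * (2 * S1 + S2 + 1)).
  intros M u0 u uh qh T Huni [[U [HU0 HUevo]] [Hper [Hini Hpde]]] HDG t Ht S1 S2.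
  destruct (HA a b M Huni) as [P HP].
  assert (HU : evolution U) by exact HUevo.
  assert (Hh := hmax_pos M).
  assert (Hhk : 0 < hmax M ^ (k + 1)) by now apply pow_lt.
  assert (JU : forall i s, 0 <= s -> jet (fun m => U i m s)) by (intros i s Hs m x; now apply HU).
  assert (Pu : forall s, 0 <= s -> periodic_jet a b (fun m => U 0%nat m s)).
  { intros s Hs m x. apply (jet_unique (fun m x => U 0%nat m s (x + (b - a))) (fun m => U 0%nat m s)).
    - now apply (jet_translate (fun m => U 0%nat m s)), JU.
    - now apply JU.
    - intros z. rewrite !HU0 by exact Hs. now apply Hper. }
  assert (Dx : forall s m x, 0 <= s -> Derive_n (u s) m x = U 0%nat m s x).
  { intros s m x Hs. apply (jet_Derive_n (fun m => U 0%nat m s)); [now apply JU|].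
    intros z. symmetry. now apply HU0. }
  assert (Ut : forall s x, 0 < s -> is_derive (fun z => u z x) s (U 1%nat 0%nat s x)).
  { intros s x Hs. apply (is_derive_ext_loc (fun z => U 0%nat 0%nat z x)).
    - generalize (open_gt 0 s Hs). apply filter_imp. intros z Hz. apply HU0. now left.
    - now apply HU. }
  assert (Eq : forall s x, 0 < s -> U 1%nat 0%nat s x = - U 0%nat 4%nat s x).
  { intros s x Hs. rewrite <- Dx by lra.
    rewrite <- (is_derive_unique _ _ _ (Ut s x Hs)). now apply is_derive_unique, Hpde. }
  assert (Dt : forall s m x, 0 < s -> Derive_n (dt u s) m x = U 1%nat m s x).
  { intros s m x Hs. apply (jet_Derive_n (fun m => U 1%nat m s)); [apply JU; lra|].
    intros z. apply (right_quotient_lim (fun s => u s z)). now apply Ut. }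
  assert (N1 : forall s, 0 < s -> Hseminorm a b (k + 1) (dt u s) = L2norm a b (U 1%nat (k + 1)%nat s)).
  { intros s Hs. apply L2norm_ext. intros x. now apply Dt. }
  assert (N2 : forall s, 0 <= s -> Hseminorm a b (k + 3) (u s) = L2norm a b (U 0%nat (k + 3)%nat s)).
  { intros s Hs. apply L2norm_ext. intros x. now apply Dx. }
  assert (HT : 0 <= T) by lra.
  assert (B1 : forall s, 0 < s <= T -> L2norm a b (U 1%nat (k + 1)%nat s) <= S1).
  { intros s Hs. rewrite <- N1 by lra.
    apply (sup_time_ub T (fun s => Hseminorm a b (k + 1) (dt u s))); [|lra].
    destruct (evolution_seminorm_bounded U 1 (k + 1) a b T HU ltac:(lra) HT) as [K HK].
    (* At time 0 the right derivative [dt u] is not identified with [U 1]; its seminorm there is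
       simply included in the bound. *)
    exists (Rmax K (Hseminorm a b (k + 1) (dt u 0))). intros z Hz.
    destruct (Rle_lt_or_eq_dec 0 z (proj1 Hz)) as [Hz'|<-]; [|apply Rmax_r].
    rewrite N1 by exact Hz'. eapply Rle_trans; [now apply HK|apply Rmax_l]. }
  assert (B2 : forall s, 0 <= s <= T -> L2norm a b (U 0%nat (k + 3)%nat s) <= S2).
  { intros s Hs. rewrite <- N2 by lra.
    apply (sup_time_ub T (fun s => Hseminorm a b (k + 3) (u s))); [|exact Hs].
    destruct (evolution_seminorm_bounded U 0 (k + 3) a b T HU ltac:(lra) HT) as [K HK].
    exists K. intros z Hz. rewrite N2 by apply Hz. now apply HK. }
  assert (B3 : forall s, 0 <= s <= T ->
     L2norm a b (U 0%nat (k + 1)%nat s) <= (b - a) * (b - a) * S2).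
  { intros s Hs.
    assert (Q1 := periodic_seminorm a b (fun m => U 0%nat m s) k Hab (JU _ s (proj1 Hs)) (Pu s (proj1 Hs))).
    assert (Q2 := periodic_seminorm a b (fun m => U 0%nat m s) (S k) Hab (JU _ s (proj1 Hs)) (Pu s (proj1 Hs))).
    assert (Q3 := B2 s Hs). cbv beta in Q1, Q2.
    replace (S k) with (k + 1)%nat in Q1, Q2 by lia.
    replace (S (S (k + 1))) with (k + 3)%nat in Q2 by lia.
    rewrite Rmult_assoc. eapply Rle_trans; [exact Q1|]. apply Rmult_le_compat_l; [lra|].
    eapply Rle_trans; [exact Q2|]. apply Rmult_le_compat_l; [lra|exact Q3]. }
  assert (Main := dg_error_bound M k (C * hmax M ^ (k + 1)) P U u0 uh qh T S1 S2
     ltac:(apply Rmult_lt_0_compat; assumption) HP HU Pu Eq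
     ltac:(intros x; rewrite HU0 by lra; symmetry; apply Hini) HDG B1 B2 B3 t Ht).
  rewrite (L2norm_ext a b (fun y => uh t y - u t y) (fun y => uh t y - U 0%nat 0%nat t y))
    by (intros; rewrite HU0 by apply Ht; reflexivity).
  eapply Rle_trans; [exact Main|].
  assert (P2 : 0 <= S2) by (eapply Rle_trans; [apply L2norm_nonneg|apply (B2 t Ht)]).
  assert (X : (2 * S1 + S2 + 1) * t <= (2 * S1 + S2 + 1) * T).
  { destruct (Rle_lt_or_eq_dec 0 T HT) as [HT'|HT'].
    - assert (P1 : 0 <= S1) by (eapply Rle_trans; [apply L2norm_nonneg|apply (B1 T); lra]). nra.
    - assert (t = T) as -> by lra. lra. }
  replace ((C * (2 * ((b - a) * (b - a) * S2) + (S2 + 1)) + C * (2 * S1 + S2 + 1) * T) * hmax M ^ (k + 1))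
    with (C * hmax M ^ (k + 1) * (2 * ((b - a) * (b - a) * S2) + (S2 + 1) + (2 * S1 + S2 + 1) * T)) by ring.
  apply Rmult_le_compat_l; [apply Rmult_le_pos; lra|]. lra.
Qed.
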